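(* Let $\mathbb G=(\mathcal S,\mathcal E)$ be a countable directed graph, let $\boldsymbol\varphi=(\varphi_{ji})_{(j,i)\in\mathcal E}$ with $\varphi_{ji}:[0,\infty)\to\mathbb R$ and let $\boldsymbol h=(h_i)_{i\in\mathcal S}$ with $h_i:\mathbb R\to[0,\infty)$. Assume that there are nonnegative constants $(c_i)_{i\in\mathcal S}$, positive weights $(p_i)_{i\in\mathcal S}$ and a locally integrable function $\phi:[0,\infty)\to[0,\infty)$ such that (a) for every $i\in\mathcal S$ and all $x,y\in\mathbb R$, $|h_i(x)-h_i(y)|\le c_i|x-y|$; (b) $\sum_{i\in\mathcal S}h_i(0)p_i<\infty$; (c) for every $s\in[0,\infty)$ and every $j\in\mathcal S$, $\sum_{i:\,(j,i)\in\mathcal E}c_ip_i|\varphi_{ji}(s)|\le p_j\phi(s)$. Then there exists a pathwise unique Hawkes process $(Z^i_t)_{i\in\mathcal S,t\ge0}$ with parameters $(\mathbb G,\boldsymbol\varphi,\boldsymbol h)$ such that $\sum_{i\in\mathcal S}p_i\,\mathbb E[Z^i_t]<\infty$ for all $t\ge0$.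
   Context: An edge $(j,i)\in\mathcal E$ is oriented from $j$ to $i$; $\sum_{j\to i}$ denotes summation over $\{j:(j,i)\in\mathcal E\}$. On a filtered probability space $(\Omega,\mathcal F,(\mathcal F_t)_{t\ge0},\Pr)$, one is given a family $(\pi^i(ds\,dz))_{i\in\mathcal S}$ of i.i.d. $(\mathcal F_t)_{t\ge0}$-Poisson measures on $[0,\infty)\times[0,\infty)$ with intensity measure $ds\,dz$. A family $(Z^i_t)_{i\in\mathcal S,t\ge0}$ of càdlàg $(\mathcal F_t)_{t\ge0}$-adapted processes is called a Hawkes process with parameters $(\mathbb G,\boldsymbol\varphi,\boldsymbol h)$ if a.s., for all $i\in\mathcal S$ and all $t\ge0$, $$Z^i_t=\int_0^t\int_0^\infty \mathbf 1_{\{z\le h_i(\sum_{j\to i}\int_0^{s-}\varphi_{ji}(s-u)\,dZ^j_u)\}}\,\pi^i(ds\,dz).$$ Pathwise uniqueness means that, for the given Poisson measures $(\pi^i)_{i\in\mathcal S}$, any two such processes (satisfying the stated moment condition) coincide almost surely. *)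

(* Defs.v *)
From HB Require Import structures.
From mathcomp Require Import all_boot all_order all_algebra.
From mathcomp Require Import finmap.
From mathcomp Require Import all_classical all_reals all_analysis.
From mathcomp Require Import measurable_realfun.

Set Implicit Arguments.
Unset Strict Implicit.
Unset Printing Implicit Defensive.

Import Order.TTheory GRing.Theory Num.Theory.
Import numFieldNormedType.Exports.

Local Open Scope classical_set_scope.
Local Open Scope ring_scope.

Section independence.
Context (d : measure_display) (Omega : measurableType d) (R : realType).
Variable P : probability Omega R.

Definition mutually_independent (I : choiceType) (C : I -> set (set Omega)) :=
  forall (J : {fset I}) (A : I -> set Omega),
    (forall i, i \in J -> C i (A i)) ->
    P (\bigcap_(i in [set` J]) A i) = (\prod_(i <- J) P (A i))%E.

Definition independent2 (C1 C2 : set (set Omega)) :=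
  forall A1 A2, C1 A1 -> C2 A2 -> P (A1 `&` A2) = (P A1 * P A2)%E.

End independence.

Definition filtration (d : measure_display) (Omega : measurableType d)
    (R : realType) (F : R -> set (set Omega)) :=
  [/\ forall t, 0 <= t -> sigma_algebra setT (F t),
      forall t, 0 <= t -> F t `<=` measurable &
      forall s t, 0 <= s -> s <= t -> F s `<=` F t].

Section random_measure.
Context (d : measure_display) (Omega : measurableType d) (R : realType).
Implicit Types (P : probability Omega R) (F : R -> set (set Omega)).

(* Random measures on [0, +oo[ ^ 2 are carried by the plane; only their values
   on subsets of [quadrant] are ever used.  The first coordinate is time. *)
Definition quadrant : set (R * R) := `[0, +oo[ `*` `[0, +oo[.

Implicit Type N : Omega -> {measure set (R * R) -> \bar R}.

Definition sigma_of_restriction N (D : set (R * R)) : set (set Omega) :=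
  <<s [set A | exists B (Y : set (\bar R)),
        [/\ measurable B, B `<=` D, measurable Y &
            A = [set w | Y (N w B)]]] >>.

(* Intensity ds dz on the quadrant.  The second argument of [poisson_prob]
   is a dummy.  That N takes infinite values on sets of infinite area, and is
   a locally finite point measure, almost surely, is a consequence. *)
Definition poisson_measure P N :=
  [/\ forall B, measurable B -> B `<=` quadrant ->
        measurable_fun setT (fun w => N w B),
      forall B, measurable B -> B `<=` quadrant ->
        ((lebesgue_measure \x lebesgue_measure) B < +oo)%E ->
        forall k : nat,
          P [set w | N w B = k%:R%:E] =
          poisson_prob
            (fine ((lebesgue_measure \x lebesgue_measure)%E B)) 0%N [set k] &
      forall (n : nat) (B : 'I_n -> set (R * R)),
        (forall k, measurable (B k)) -> (forall k, B k `<=` quadrant) ->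
        trivIset setT B ->
        mutually_independent P
          (fun k => preimage_set_system setT (fun w => N w (B k)) measurable)].

Definition adapted_poisson_measure P F N :=
  [/\ poisson_measure P N,
      forall t, 0 <= t ->
        sigma_of_restriction N (`[0, t] `*` `[0, +oo[) `<=` F t &
      forall t, 0 <= t ->
        independent2 P (F t)
          (sigma_of_restriction N (`]t, +oo[ `*` `[0, +oo[))].

Definition iid_poisson_measures (S : choiceType) P F
    (pi : S -> Omega -> {measure set (R * R) -> \bar R}) :=
  (forall i, adapted_poisson_measure P F (pi i)) /\
  mutually_independent P (fun i => sigma_of_restriction (pi i) quadrant).

End random_measure.

Arguments quadrant {R}.

Section paths.
Context (R : realType).
Implicit Type f : R -> R.

Definition cadlag f :=
  (forall t, 0 <= t -> f u @[u --> t^'+] --> f t) /\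
  (forall t, 0 < t -> cvg (f u @[u --> t^'-])).

(* A path on [0, +oo[ prolonged by f 0 on ]-oo, 0[, so that df has no atom
   at 0. *)
Definition prolong f : R -> R := fun t => f (Num.max t 0).

(* The measure df on [0, +oo[ of a nondecreasing right-continuous path f.  The
   value 0 for other paths is immaterial: the right-hand side of the equation
   in [hawkes_process] is nondecreasing in t. *)
Definition path_measure f : {measure set (measurableTypeR R) -> \bar R} :=
  match pselect ({homo prolong f : x y / x <= y} /\
                 right_continuous (prolong f)) with
  | left H =>
      let g : cumulative R R :=
        HB.pack (prolong f) (isCumulative.Build R _ R (prolong f) H.1 H.2) in
      lebesgue_stieltjes_measure g
  | right _ => mzero
  end.

(* Sum of an absolutely summable family of reals.  When positive and negative
   parts both diverge, the value is 0 (oo - oo = -oo in \bar R).  In the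
   equation below this happens only when h i is constant, or on a null set of
   times not charged by the Poisson measures. *)
Definition countable_sum (S : choiceType) (A : set S) (a : S -> R) : R :=
  fine (\esum_(j in A) (EFin \o a)^\+ j - \esum_(j in A) (EFin \o a)^\- j)%E.

End paths.

Section hawkes.
Context (d : measure_display) (Omega : measurableType d) (R : realType).
Context (S : countType).
Variables (P : probability Omega R) (F : R -> set (set Omega)).
Variable pi : S -> Omega -> {measure set (R * R) -> \bar R}.
Variables (E : set (S * S)) (phi : S -> S -> R -> R) (h : S -> R -> R).
Implicit Type Z : S -> R -> Omega -> R.

Definition hawkes_input Z (i : S) (s : R) (w : Omega) : R :=
  countable_sum [set j | E (j, i)]
    (fun j => \int[path_measure (Z j ^~ w)]_(u in `[0, s[) phi j i (s - u)).

(* An edge (j, i) points from j to i, and phi j i is its kernel; phi j i is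
   irrelevant when (j, i) is not an edge.  The filtration need not be complete,
   so regularity of the paths, like the equation, is required almost surely. *)
Definition hawkes_process Z :=
  [/\ forall i t, 0 <= t ->
        preimage_set_system setT (Z i t) measurable `<=` F t,
      \forall w \ae P, forall i, cadlag (Z i ^~ w) &
      \forall w \ae P, forall i t, 0 <= t ->
        (Z i t w)%:E =
        (\int[pi i w]_(x in `[0%R, t] `*` `[0%R, +oo[)
          (\1_[set y : R * R | (y.2 <= h i (hawkes_input Z i y.1 w))%R] x)%:E)%E].

Definition finite_weighted_mean (p : S -> R) Z :=
  forall t, 0 <= t ->
    (\esum_(i in [set: S]) ((p i)%:E * 'E_P[Z i t]) < +oo)%E.

End hawkes.

(* Main.v *)
(** Unknowns are intensities rather than paths.  A family of predictable
    intensities [lam i] produces the counting paths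
    [N i {(u, z) | 0 < u <= t, 0 <= z <= lam i u}], and these solve the equation
    as soon as [lam i s] is [h i] applied to the sum over the edges [(j, i)] of the
    integrals of [phi j i (s - u)] against the marks of [N j] under the graph of
    [lam j] before time [s]: [lam] is a fixed point of a map [picard].  Measure
    the distance of two families at time [s] by
    [dist lam lam' s = sum_i p i * E |lam i s - lam' i s|].  The number of marks
    between two predictable graphs has mean the area between them, so that the
    Lipschitz bounds (a) and (c) give
    [dist (picard lam) (picard lam') <= Phi * dist lam lam'] (convolution).  With
    the weight [exp (- b s)] and [b] large, convolution with [Phi] has norm at most
    1/2 on [L^1 (0, T)], whence existence by iteration.  Conversely, the intensities
    of any solution with finite weighted mean form a fixed point; as the solution is
    regular only almost surely, they are predictable for the completed filtration,
    for which the noise has the same compensator, and the contraction gives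
    uniqueness. *)
Require Import Defs.
From mathcomp Require Import all_boot all_order all_algebra.
From mathcomp Require Import all_classical all_reals all_analysis.
From mathcomp Require Import measurable_realfun.
From HB Require Import structures.
From mathcomp Require Import ring lra.

Import Order.TTheory GRing.Theory Num.Theory.
Import numFieldNormedType.Exports.

Local Open Scope classical_set_scope.
Local Open Scope ring_scope.

Set SsrOldRewriteGoalsOrder.
Set Implicit Arguments.
Unset Strict Implicit.
Unset Printing Implicit Defensive.

(** * Random measures and countable sums *)

(** Of the noise the argument keeps only the property [compensated]: adaptedness, and the mean mass
    of future sets on past events. A pi-lambda argument extends this to predictable integrands, and
    since it speaks of means only, it survives completion of the filtration. As [Phi] is merely
    locally integrable, a convolution with it is finite only at almost every time; hence the bounds
    on [picard] carry finiteness premises at each time, and the contraction lives in a weighted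
    [L^1] norm in time. Two intensities at distance 0 may still differ on a null set of times; the
    equation is recovered because almost surely no mark falls between their graphs. Signed kernels
    are the other obstacle: sums and integrals take default values where they diverge, so each
    Lipschitz estimate first secures absolute convergence, through the distance to the family [off],
    which produces no points. Existence must yield processes adapted to the given filtration, so
    integrals receive measurable versions defined everywhere ([tame]); only uniqueness passes to the
    completion. *)

Lemma ge0_integral_mrestr d (T : measurableType d) (R : realType)
    (mu : {measure set T -> \bar R}) (D : set T) (mD : measurable D)
    (f : T -> \bar R) : (forall x, 0 <= f x)%E -> measurable_fun setT f ->
  (\int[mrestr mu mD]_x f x = \int[mu]_(x in D) f x)%E.
Proof.
move=> f0 mf.
rewrite -(setvU D) ge0_integral_setU//=; last 3 first.
- exact: measurableC.
- by rewrite setvU.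
- by apply/disj_set2P; rewrite setICl.
have -> : (\int[mrestr mu mD]_(x in ~` D) f x = \int[mzero]_(x in ~` D) f x)%E.
  apply: eq_measure_integral => A mA AD.
  rewrite /= /mrestr (_ : A `&` D = set0) ?measure0//.
  by rewrite -subset0 => x [/AD].
rewrite integral_measure_zero add0e.
apply: eq_measure_integral => A mA AD.
by rewrite /= /mrestr (setIidl AD).
Qed.

Import HBNNSimple.

Lemma measurable_fun_integral_finite d1 d2 (T : measurableType d1)
    (Y : measurableType d2) (R : realType)
    (m : T -> {measure set Y -> \bar R}) (F : T * Y -> \bar R) :
  (forall B, measurable B -> measurable_fun setT (fun x => m x B)) ->
  (forall x, (m x setT < +oo)%E) ->
  (forall z, (0 <= F z)%E) -> measurable_fun setT F ->
  measurable_fun setT (fun x => (\int[m x]_y F (x, y))%E).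
Proof.
move=> mm mfin F0 mF.
pose k : R.-ker T ~> Y := HB.pack m (isKernel.Build _ _ _ _ _ m mm).
pose F_ := nnsfun_approx measurableT mF.
apply: (@measurable_fun_xsection_integral _ _ _ _ _ F m F_).
- by move=> a b ab; exact/nd_nnsfun_approx.
- by move=> z; exact/cvg_nnsfun_approx.
- move=> n r.
  have H := @measurable_prod_subset_xsection_kernel _ _ _ _ _ k setT measurableT.
  (* A bound for each [x] separately suffices; adding 1 to the total mass makes the inequality
     strict. *)
  have K x : exists M, forall X, measurable X -> (mrestr (k x) measurableT X < M%:E)%E.
    exists (fine (m x setT) + 1) => X mX.
    rewrite /mrestr/= setIT (@le_lt_trans _ _ (m x setT))//.
      by apply: le_measure => //; rewrite inE.
    by rewrite EFinD fineK ?ge0_fin_numE// lteDl// ?lte_fin// ge0_fin_numE.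
  have mF_ : measurable (F_ n @^-1` [set r]) by exact: measurable_funPTI.
  have [_] := H K _ mF_.
  by under eq_fun do rewrite /mrestr setIT.
Qed.

Lemma measurable_fun_ltey d (T : measurableType d) (R : realType)
    (f : nat -> T -> \bar R) : (forall n, measurable_fun setT (f n)) ->
  measurable [set x | forall n, (f n x < +oo)%E].
Proof.
move=> mf; rewrite (_ : [set _ | _] = \bigcap_n [set x | (f n x < +oo)%E]).
  apply: bigcapT_measurable => n.
  rewrite -[X in measurable X]setTI; exact: emeasurable_fun_infty_o.
by apply/seteqP; split=> x /= h n; [move=> _|]; exact: h.
Qed.

(** * Measurable versions of integrals against random measures *)

Section tame.
Context d1 d2 (T : measurableType d1) (Y : measurableType d2) (R : realType).
Variables (mu : T -> {measure set Y -> \bar R}) (D : nat -> T -> set Y).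
Hypotheses (mD : forall n x, measurable (D n x))
  (ndD : forall x, nondecreasing_seq (D ^~ x))
  (mmu : forall n B, measurable B -> measurable_fun setT (fun x => mu x (B `&` D n x))).

(* A random measure is only almost surely finite on bounded sets; integrals are
   set to 0 where it is not, which keeps them measurable everywhere. *)
Definition tame x := `[< forall n, (mu x (D n x) < +oo)%E >].

Lemma measurable_tame : measurable [set x | tame x].
Proof.
rewrite (_ : [set x | tame x] = [set x | forall n, (mu x (D n x) < +oo)%E]).
  apply: (@measurable_fun_ltey _ _ _ (fun n x => mu x (D n x))) => n.
  by under eq_fun do rewrite -[D n _]setTI; exact: mmu.
by apply/seteqP; split=> x /=; move/asboolP.
Qed.

Lemma measurable_fun_tame : measurable_fun setT tame.
Proof.
apply: (measurable_fun_bool true).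
by rewrite setTI preimage_true; exact: measurable_tame.
Qed.

(** Where [mu x] is tame, its restrictions to the [D n x] are finite measures, and the integral over
    the union is the increasing limit of the integrals against them. Elsewhere they are replaced by
    the zero measure, which keeps the kernel measurable. *)
Lemma ge0_measurable_fun_integral_tame (F : T * Y -> \bar R) :
  (forall z, (0 <= F z)%E) -> measurable_fun setT F ->
  measurable_fun setT (fun x =>
    if tame x then (\int[mu x]_(y in \bigcup_n D n x) F (x, y))%E else 0%E).
Proof.
move=> F0 mF.
pose m n x : {measure set Y -> \bar R} :=
  if tame x then (mrestr (mu x) (mD n x) : {measure set Y -> \bar R}) else mzero.
apply: (@emeasurable_fun_cvg _ _ _ _ (fun n x => \int[m n x]_y F (x, y))%E).
  move=> n; apply: measurable_fun_integral_finite => //.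
  - move=> B mB; rewrite (_ : (fun _ => _) =
        (fun x => if tame x then mu x (B `&` D n x) else 0%E)); last first.
      by apply/funext => x; rewrite /m; case: ifP.
    apply: measurable_fun_ifT => //; [exact: measurable_fun_tame|exact: mmu].
  - move=> x; rewrite /m; case: ifPn => [/asboolP /(_ n)|_]/=.
      by rewrite /mrestr setTI.
    by rewrite /mzero ltry.
move=> x _; rewrite /m; case: ifPn => [_|_].
  rewrite [X in X @ _ --> _](_ : _ =
      (fun n => \int[mu x]_(y in D n x) F (x, y))%E); last first.
    apply/funext => n; apply: ge0_integral_mrestr => //.
    exact: measurableT_comp.
  apply: ge0_nondecreasing_set_cvg_integral => //.
  - by move=> n; apply: measurable_funTS; exact: measurableT_comp.
rewrite (_ : (fun _ => _) = cst 0%E); first exact: cvg_cst.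
by apply/funext => n; rewrite integral_measure_zero.
Qed.

Lemma measurable_fun_integral_tame (F : T * Y -> \bar R) :
  measurable_fun setT F ->
  measurable_fun setT (fun x =>
    if tame x then (\int[mu x]_(y in \bigcup_n D n x) F (x, y))%E else 0%E).
Proof.
move=> mF.
have := @ge0_measurable_fun_integral_tame (F^\+)%E (fun=> funepos_ge0 _ _)
  (measurable_funepos mF).
have := @ge0_measurable_fun_integral_tame (F^\-)%E (fun=> funeneg_ge0 _ _)
  (measurable_funeneg mF).
move=> mn mp; have := emeasurable_funB mp mn.
congr measurable_fun; apply/funext => x; case: ifP => _; last by rewrite sube0.
rewrite [RHS]integralE; congr (_ - _)%E; apply: eq_integral => y _.
- by rewrite !funeposE.
- by rewrite !funenegE.
Qed.

End tame.

(** * Sums over countable families *)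

Lemma esum_swap (R : realType) (S S' : choiceType) (B : set (S' * S))
    (a : S -> S' -> \bar R) :
  (forall i j, 0 <= a i j)%E ->
  (\esum_(i in [set: S]) \esum_(j in [set j | B (j, i)]) a i j =
   \esum_(j in [set: S']) \esum_(i in [set i | B (j, i)]) a i j)%E.
Proof.
move=> a0; rewrite !esum_esum//.
rewrite (reindex_esum ([set: S'] `*`` (fun j => [set i | B (j, i)])) _
  (fun x => (x.2, x.1)))//.
split => //.
- by move=> [i j] [i' j'] _ _ [-> ->].
- by move=> [i j] [_ /= ?]; exists (j, i).
Qed.

Section esum_countable.
Context (R : realType) (S : countType).
Implicit Types (A : set S) (a b : S -> \bar R).
Local Open Scope ereal_scope.

(** The bridge to series: [pickle] enumerates [S], and integers that code no element of [A]
    contribute 0. Monotone convergence for series then yields linearity, measurability and Tonelli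
    for sums over [S]. *)
Lemma esum_nneseries A a : (forall i, A i -> 0 <= a i) ->
  \esum_(i in A) a i =
  \sum_(0 <= n <oo) (if @pickle_inv S n is Some i then
                      if i \in A then a i else 0 else 0).
Proof.
move=> a0; rewrite esum_mkcond nneseries_esumT; last first.
  move=> n; case: pickle_inv => // i; case: ifPn => //; rewrite inE; exact: a0.
pose b n := if @pickle_inv S n is Some i then if i \in A then a i else 0 else 0.
rewrite -/(b _) (_ : \esum_(i in [set: nat]) b i = \esum_(i in range (@pickle S)) b i).
  rewrite (@reindex_esum _ _ _ [set: S] (range pickle) pickle)//.
    by apply: eq_esum => i _; rewrite /b pickleK_inv.
  split; [by move=> i _; exists i| |by []].
  by move=> i j _ _; exact: (pcan_inj pickleK).
rewrite [RHS]esum_mkcond; apply: eq_esum => n _.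
case: ifPn => //; rewrite /b; case En : (pickle_inv n) => [i|]//.
move=> /negP[]; rewrite inE; exists i => //.
by have := @pickle_invK S n; rewrite En.
Qed.

Lemma esumZl A a (k : R) : (0 <= k)%R -> (forall i, A i -> 0 <= a i) ->
  \esum_(i in A) (k%:E * a i) = k%:E * \esum_(i in A) a i.
Proof.
move=> k0 a0; rewrite !esum_nneseries//; last first.
  by move=> i Ai; rewrite mule_ge0 ?lee_fin ?a0.
rewrite -nneseriesZl; last first.
  by move=> n _; case: pickle_inv => // i; case: ifPn => //; rewrite inE => /a0.
apply: eq_eseriesr => n _; case: pickle_inv => [i|]; last by rewrite mule0.
by case: ifPn => // _; rewrite mule0.
Qed.

Lemma measurable_fun_esum d (T : measurableType d) (D : set T) A
    (f : S -> T -> \bar R) : measurable D ->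
  (forall i x, A i -> D x -> 0 <= f i x) ->
  (forall i, A i -> measurable_fun D (f i)) ->
  measurable_fun D (fun x => \esum_(i in A) f i x).
Proof.
move=> mD f0 mf.
apply: (eq_measurable_fun (fun x => \sum_(0 <= n <oo)
    (if @pickle_inv S n is Some i then
     if i \in A then f i x else 0 else 0))).
  by move=> x /set_mem Dx; rewrite esum_nneseries// => i Ai; exact: f0.
apply: ge0_emeasurable_sum.
  move=> n x Dx _; case: pickle_inv => // i; case: ifPn => //.
  by rewrite inE => Ai; exact: f0.
move=> n _; case: pickle_inv => [i|]; last exact: measurable_cst.
by have [/set_mem/mf|_] := boolP (i \in A); [|exact: measurable_cst].
Qed.

Lemma integral_esum d (T : measurableType d) (mu : {measure set T -> \bar R})
    (D : set T) A (f : S -> T -> \bar R) : measurable D ->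
  (forall i x, A i -> D x -> 0 <= f i x) ->
  (forall i, A i -> measurable_fun D (f i)) ->
  \int[mu]_(x in D) (\esum_(i in A) f i x) =
  \esum_(i in A) (\int[mu]_(x in D) f i x).
Proof.
move=> mD f0 mf.
transitivity (\int[mu]_(x in D) \sum_(0 <= n <oo)
    (if @pickle_inv S n is Some i then
     if i \in A then f i x else 0 else 0)).
  apply: eq_integral => x /set_mem Dx.
  by rewrite esum_nneseries// => i Ai; exact: f0.
rewrite integral_nneseries//; last 2 first.
- move=> n; case: pickle_inv => [i|]; last exact: measurable_cst.
  by have [/set_mem/mf|_] := boolP (i \in A); [|exact: measurable_cst].
- move=> n x Dx; case: pickle_inv => // i; case: ifPn => //.
  by rewrite inE => Ai; exact: f0.
rewrite esum_nneseries; last first.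
  by move=> i Ai; apply: integral_ge0 => x Dx; exact: f0.
apply: eq_eseriesr => n _; case: pickle_inv => [i|]; last by rewrite integral0.
by case: ifPn => // _; rewrite integral0.
Qed.

(** Absolute convergence makes all four sums of positive and negative parts finite, so that neither
    [fine] nor the subtraction in [countable_sum] falls back on a default. *)
Lemma lee_esum_diff A (a b : S -> R) :
  \esum_(i in A) `|a i|%:E < +oo -> \esum_(i in A) `|b i|%:E < +oo ->
  `|countable_sum A a - countable_sum A b|%:E <= \esum_(i in A) `|a i - b i|%:E.
Proof.
move=> sa sb; rewrite /countable_sum.
have fin (c : S -> R) : \esum_(i in A) `|c i|%:E < +oo ->
    (\esum_(i in A) (EFin \o c)^\+ i \is a fin_num) *
    (\esum_(i in A) (EFin \o c)^\- i \is a fin_num).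
  move=> sc; split; rewrite ge0_fin_numE//; try exact: esum_ge0.
  - apply: le_lt_trans sc; apply: le_esum => i _.
    by rewrite funeposE -EFin_max lee_fin ge_max ler_norm normr_ge0.
  - apply: le_lt_trans sc; apply: le_esum => i _.
    by rewrite funenegE -EFinN -EFin_max lee_fin ge_max -normrN ler_norm normr_ge0.
have [d_oo|d_lty] := eqVneq (\esum_(i in A) `|a i - b i|%:E) +oo.
  by rewrite d_oo leey.
have d0 : 0 <= \esum_(i in A) `|a i - b i|%:E.
  by apply: esum_ge0 => i _; rewrite lee_fin.
(* With the negative parts moved to the other side the inequality holds between nonnegative terms,
   which can be summed before any subtraction is performed. *)
have key (u v : S -> R) : \esum_(i in A) (EFin \o u)^\+ i + \esum_(i in A) (EFin \o v)^\- i
    <= \esum_(i in A) (EFin \o u)^\- i + \esum_(i in A) (EFin \o v)^\+ i +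
       \esum_(i in A) `|u i - v i|%:E.
  rewrite -[X in X <= _]esumD// -[X in _ <= X + _]esumD// -esumD//;
    last by move=> i _; rewrite adde_ge0.
  apply: le_esum => i _; rewrite !funeposE !funenegE/= -!EFin_max -!EFinD lee_fin.
  rewrite /Num.max /=; have := ler_norm (u i - v i).
  by do !case: ifPn; rewrite ?lte_fin -?leNgt; move=> *; lra.
have kab := key a b; have := key b a.
under [X in _ <= _ + X]eq_esum do rewrite distrC.
move: kab d_lty d0.
rewrite -(fineK (fin a sa).1) -(fineK (fin a sa).2).
rewrite -(fineK (fin b sb).1) -(fineK (fin b sb).2).
case: (\esum_(i in A) `|a i - b i|%:E) => // r kab _ r0 kba.
rewrite -!EFinB/= lee_fin ler_norml.
by move: kab kba; rewrite -!EFinD !lee_fin => *; apply/andP; split; lra.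
Qed.

Lemma measurable_countable_sum d (T : measurableType d) A (f : S -> T -> R) :
  (forall i, A i -> measurable_fun setT (f i)) ->
  measurable_fun setT (fun x => countable_sum A (fun i => f i x)).
Proof.
move=> mf; apply: measurableT_comp => //.
apply: emeasurable_funB; apply: measurable_fun_esum => // i Ai.
- apply: (eq_measurable_fun (EFin \o f i)^\+).
    by move=> x _; rewrite !funeposE.
  by apply: measurable_funepos; apply/measurable_EFinP; exact: mf.
- apply: (eq_measurable_fun (EFin \o f i)^\-).
    by move=> x _; rewrite !funenegE.
  by apply: measurable_funeneg; apply/measurable_EFinP; exact: mf.
Qed.

Lemma eq_countable_sum A (a b : S -> R) : (forall i, A i -> a i = b i) ->
  countable_sum A a = countable_sum A b.
Proof.
move=> ab; rewrite /countable_sum; congr (fine (_ - _)); apply: eq_esum => i Ai.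
- by rewrite !funeposE/= ab.
- by rewrite !funenegE/= ab.
Qed.

Lemma countable_sum0 A : countable_sum A (fun=> 0%R) = 0%R :> R.
Proof.
rewrite /countable_sum !esum1 ?subee// => i _.
- by rewrite funenegE/= oppr0 maxxx.
- by rewrite funeposE/= maxxx.
Qed.

End esum_countable.

(** * Predictable sets *)

Section predictable.
Context (R : realType) d (Omega : measurableType d).
Variable G : R -> set (set Omega).

(* Only the times [0 < tau y] matter: on the others [B] is unconstrained. *)
Definition pred_rect dY (Y : measurableType dY) (tau : Y -> R) :
    set (set (Omega * Y)) :=
  [set C | exists s A B, [/\ 0 <= s, G s A, measurable B,
     (forall y, B y -> 0 < tau y -> s < tau y) & C = A `*` B]].

Hypothesis hG : filtration G.

Section one_space.
Context dY (Y : measurableType dY) (tau : Y -> R).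

Lemma setI_closed_pred_rect : setI_closed (pred_rect tau).
Proof.
move=> _ _ [s [A [B [s0 GA mB Bs ->]]]] [t [A' [B' [t0 GA' mB' Bt ->]]]].
have [sG _ homG] := hG.
have m0 : 0 <= Num.max s t by rewrite le_max s0.
have homS : G s `<=` G (Num.max s t) by apply: homG; rewrite // le_max lexx.
have homT : G t `<=` G (Num.max s t) by apply: homG; rewrite // le_max lexx orbT.
exists (Num.max s t), (A `&` A'), (B `&` B'); split => //.
- have := @measurableI _ (g_sigma_algebraType (G (Num.max s t))) A A'.
  have sGm := sG _ m0.
  rewrite /measurable/= /measurable/= (sigma_algebra_id sGm).
  by apply; [exact: homS|exact: homT].
- exact: measurableI.
- by move=> y [By B'y] ty; rewrite gt_max Bs// Bt.
- by rewrite setXI.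
Qed.

Lemma pred_rect_measurable : pred_rect tau `<=` measurable.
Proof.
move=> _ [s [A [B [s0 GA mB Bs ->]]]].
by apply: measurableX => //; have [_ + _] := hG; move=> /(_ s s0); exact.
Qed.

Lemma predictable_measurable dV (V : measurableType dV) (f : Omega * Y -> V) :
  measurable_fun [set: g_sigma_algebraType (pred_rect tau)] f ->
  measurable_fun setT f.
Proof.
move=> mf _ B mB; have := mf measurableT B mB.
by rewrite !setTI; apply: smallest_sub => //;
  [exact: sigma_algebra_measurable|exact: pred_rect_measurable].
Qed.

Lemma predictable_snd dV (V : measurableType dV) (f : Y -> V) :
  measurable_fun setT f ->
  measurable_fun [set: g_sigma_algebraType (pred_rect tau)] (fun x => f x.2).
Proof.
move=> mf _ B mB; rewrite setTI; apply: sub_sigma_algebra.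
have [sG _ _] := hG; have [G0 GC GU] := sG 0 (lexx _).
exists 0, setT, (f @^-1` B); split => //.
- by rewrite -setC0 -setTD; exact: GC.
- by rewrite -[_ @^-1` _]setTI; exact: mf.
- by apply/seteqP; split=> [[w y]|[w y] []].
Qed.

Lemma predictable_section dV (V : measurableType dV) (f : Omega * Y -> V) w :
  measurable_fun [set: g_sigma_algebraType (pred_rect tau)] f ->
  measurable_fun setT (fun y => f (w, y)).
Proof.
by move=> /predictable_measurable mf; exact: measurable_fun_pair2.
Qed.

End one_space.

Lemma predictable_time dY (Y : measurableType dY) (tau : Y -> R) dV
    (V : measurableType dV) (f : Omega * R -> V) : measurable_fun setT tau ->
  measurable_fun [set: g_sigma_algebraType (pred_rect (@id R))] f ->
  measurable_fun [set: g_sigma_algebraType (pred_rect tau)]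
    (fun x => f (x.1, tau x.2)).
Proof.
move=> mtau mf.
suff mg : measurable_fun [set: g_sigma_algebraType (pred_rect tau)]
    (fun x => (x.1, tau x.2) : g_sigma_algebraType (pred_rect (@id R))).
  exact: (measurableT_comp mf mg).
apply: (@measurability _ _ _ (g_sigma_algebraType (pred_rect (@id R))) _ _
   (pred_rect (@id R))) => //.
move=> _ [_ [s [A [B [s0 GA mB Bs ->]]]] <-]; rewrite setTI.
apply: sub_sigma_algebra; exists s, A, (tau @^-1` B); split => //.
- by rewrite -[_ @^-1` _]setTI; exact: mtau.
- by move=> y /Bs.
Qed.

(** A predictable field read at the earlier time [tau y] remains predictable in the current time
    [u]: if [B] lies after [s], then [tau y] in [B] and [tau y < u] force [s < u], so the event [A]
    of [G s] can be attached to the predictable rectangle of [A] and []s, +oo[]. *)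
Lemma measurable_before dY (Y : measurableType dY) (tau : Y -> R) :
  measurable_fun setT tau ->
  measurable_fun
    [set x : g_sigma_algebraType (pred_rect (@id R)) * Y | 0 < tau x.2 < x.1.2]
    (fun x => (x.1.1, tau x.2) : g_sigma_algebraType (pred_rect (@id R))).
Proof.
move=> mtau.
apply: (@measurability _ _ _ (g_sigma_algebraType (pred_rect (@id R))) _ _
   (pred_rect (@id R))) => //.
move=> _ [_ [s [A [B [s0 GA mB Bs ->]]]] <-].
pose T := g_sigma_algebraType (pred_rect (@id R)).
have msnd : measurable_fun [set: T * Y] (fun x => x.1.2 : R).
  apply: (@measurableT_comp _ _ _ _ _ _ (fun x : T => x.2)) => //.
  exact: (@predictable_snd _ R id _ R id).
rewrite (_ : _ `&` _ =
   (A `*` [set r | s < r]) `*` (tau @^-1` B) `&`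
   [set x : T * Y | 0 < tau x.2 < x.1.2]).
  apply: measurableI.
    apply: measurableX.
      apply: sub_sigma_algebra; exists s, A, [set r | s < r]; split => //.
      rewrite (_ : [set _ | _] = `]s, +oo[%classic) //.
      by apply/seteqP; split=> r /=; rewrite in_itv/= andbT.
    by rewrite -[_ @^-1` _]setTI; exact: mtau.
  rewrite (_ : [set _ | _] = [set x | 0 < tau x.2] `&` [set x : T * Y | tau x.2 < x.1.2]).
    have mt : measurable_fun [set: T * Y] (fun x => tau x.2) by exact: measurableT_comp.
    apply: measurableI.
      have := measurable_fun_ltr (@measurable_cst _ _ (T * Y)%type R setT 0) mt.
      by move=> /(_ measurableT [set true]); rewrite setTI; exact.
    have := measurable_fun_ltr mt msnd.
    by move=> /(_ measurableT [set true]); rewrite setTI; exact.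
  by apply/seteqP; split=> x /=; [move=> /andP|move=> [-> ->]].
apply/seteqP; split=> [[[w u] y] /= [/andP[t0 tu] [Aw Bu]]|[[w u] y] /= [[[Aw su] Bu] /andP[t0 tu]]].
  by split; [split => //; split => //; rewrite (lt_trans _ tu)// Bs|rewrite t0].
by rewrite t0 tu.
Qed.

(** Up to time [t] only rectangles starting at some [s <= t] are met, and their events lie in [G t];
    a rectangle starting later leaves an empty trace. *)
Lemma measurable_until dY (Y : measurableType dY) (tau : Y -> R) t :
  0 <= t -> measurable_fun setT tau ->
  measurable_fun
    [set x : g_sigma_algebraType (G t) * Y | 0 < tau x.2 <= t]
    (fun x => (x.1, tau x.2) : g_sigma_algebraType (pred_rect (@id R))).
Proof.
move=> t0 mtau.
apply: (@measurability _ _ _ (g_sigma_algebraType (pred_rect (@id R))) _ _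
   (pred_rect (@id R))) => //.
move=> _ [_ [s [A [B [s0 GA mB Bs ->]]]] <-].
pose T := g_sigma_algebraType (G t).
have [ts|st] := ltP t s.
  rewrite (_ : _ `&` _ = set0)// -subset0 => -[w y] /= [/andP[ty yt] [Aw By]].
  by have := Bs _ By ty; rewrite ltNge (le_trans yt)// ltW.
rewrite (_ : _ `&` _ = A `*` (tau @^-1` (B `&` `]0, t]))); last first.
  apply/seteqP; split=> -[w y] /=; rewrite in_itv/=.
    by move=> [-> [? ?]].
  by move=> [? [? ->]].
apply: measurableX.
  by apply: sub_sigma_algebra; have [_ _ homG] := hG; exact: (homG s t).
by rewrite -[_ @^-1` _]setTI; apply: mtau => //; exact: measurableI.
Qed.

(** The mass strictly before [s] is the supremum, over rational [q < s], of the masses up to [q],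
    each of which is known at time [q]. Restricting to rationals keeps the supremum countable. *)
Lemma predictable_measure_before dY (Y : measurableType dY) (tau : Y -> R)
    (m : Omega -> {measure set Y -> \bar R}) (B : set Y) :
  measurable_fun setT tau -> measurable B ->
  (forall q, 0 <= q -> measurable_fun [set: g_sigma_algebraType (G q)]
     (fun w => m w (B `&` [set y | 0 < tau y <= q]))) ->
  measurable_fun [set: g_sigma_algebraType (pred_rect (@id R))]
    (fun x => m x.1 (B `&` [set y | 0 < tau y < x.2])).
Proof.
move=> mtau mB mm.
pose T := g_sigma_algebraType (pred_rect (@id R)).
(* An enumeration of the rationals; integers that code none give 0, again a rational. *)
pose q k : R := ratr (odflt 0%Q (unpickle k)).
pose E c := B `&` [set y | 0 < tau y <= c].
have mE c : measurable (E c).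
  apply: measurableI => //; rewrite (_ : [set _ | _] = tau @^-1` `]0, c]).
    by rewrite -[_ @^-1` _]setTI; exact: mtau.
  by apply/seteqP; split=> y /=; rewrite in_itv.
have mE' c : measurable (B `&` [set y | 0 < tau y < c]).
  apply: measurableI => //; rewrite (_ : [set _ | _] = tau @^-1` `]0, c[).
    by rewrite -[_ @^-1` _]setTI; exact: mtau.
  by apply/seteqP; split=> y /=; rewrite in_itv.
pose f k (x : T) := if (0 <= q k) && (q k < x.2) then m x.1 (E (q k)) else 0%E.
have mf k : measurable_fun setT (f k).
  rewrite /f; have [q0|q0] /= := boolP (0 <= q k); last exact: measurable_cst.
  apply: measurable_fun_if => //.
  - apply: (@measurable_fun_ltr _ T R setT (cst (q k)) (fun x : T => x.2)) => //.
    exact: (@predictable_snd _ R id _ R id).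
  - move=> _ V mV; rewrite setTI.
    rewrite (_ : _ `&` _ = ((fun w => m w (E (q k))) @^-1` V) `*` [set r | q k < r]).
      apply: sub_sigma_algebra; exists (q k), ((fun w => m w (E (q k))) @^-1` V), [set r | q k < r].
      split => //.
      + have := mm _ q0 measurableT V mV; rewrite setTI.
        rewrite /measurable/= /measurable/= sigma_algebra_id//.
        by have [+ _ _] := hG; exact.
      + rewrite (_ : [set _ | _] = `]q k, +oo[%classic) //.
        by apply/seteqP; split=> r /=; rewrite in_itv/= andbT.
    by apply/seteqP; split=> -[w r] /= [].
apply: (eq_measurable_fun (fun x => esups (f ^~ x) 0%N)); last first.
  exact: measurable_fun_esups.
move=> [w s] _ /=; rewrite /esups /sdrop; apply/eqP; rewrite eq_le; apply/andP; split.
  apply: ge_ereal_sup => _ /= [k _ <-]; rewrite /f/=; case: ifPn => //= /andP[q0 qs].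
  apply: le_measure; rewrite ?inE//.
  by apply: setIS => y /= /andP[-> /=] yq; exact: le_lt_trans qs.
(* For the other inequality the times before [s] are exhausted by [s - 1/(n+1)], and a rational is
   inserted between this time and [s]. *)
have : m w (E (s - n.+1%:R^-1)) @[n --> \oo] -->
       m w (\bigcup_n E (s - n.+1%:R^-1)).
  apply: nondecreasing_cvg_mu => //; first exact: bigcupT_measurable.
  move=> a b ab; apply/subsetPset; apply: setIS => y /= /andP[-> /=].
  move=> /le_trans; apply; rewrite lerD2l lerN2 lef_pV2 ?posrE// ler_nat.
  by rewrite ltnS.
rewrite (_ : \bigcup_n _ = B `&` [set y | 0 < tau y < s]); last first.
  apply/seteqP; split=> [y [n _ [By /= /andP[-> ys]]]|y [By /= /andP[y0 ys]]].
    by split => //=; rewrite (le_lt_trans ys)// gtrBl invr_gt0.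
  have sy : 0 < s - tau y by rewrite subr_gt0.
  have [n _ /(_ n (leqnn n)) /= nn] := near_infty_natSinv_lt (PosNum sy).
  exists n => //; split => //=; rewrite y0/=.
  by rewrite lerBrDl addrC -lerBrDl ltW.
move=> cv; rewrite -(cvg_lim _ cv)//; apply: lime_le.
  by apply/cvg_ex; eexists; exact: cv.
(* For [s <= 0] the sets are empty; otherwise the rational is also taken above 0, since only
   nonnegative [q k] count in [f]. *)
apply: nearW => n; have [s0|s0] := leP s 0.
  rewrite (_ : E _ = set0) ?measure0.
    apply: ereal_sup_ge; exists (f 0%N (w, s)); first by exists 0%N.
    by rewrite /f; case: ifP.
  rewrite -subset0 => y [_ /= /andP[y0 ys]].
  have := lt_le_trans y0 ys; rewrite ltNge (le_trans _ s0)//.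
  by rewrite lerBlDr lerDl.
have : Num.max 0 (s - n.+1%:R^-1) < s.
  by rewrite gt_max; apply/andP; split=> //; rewrite gtrBl invr_gt0.
move=> /rat_in_itvoo[r]; rewrite in_itv/= gt_max => /andP[/andP[r0 nr] rs].
apply: ereal_sup_ge; exists (f (pickle r) (w, s)); first by exists (pickle r).
rewrite /f /q pickleK/= (ltW r0) rs/=; apply: le_measure; rewrite ?inE//.
by apply: setIS => y /= /andP[-> /=] ys; exact: (le_trans ys (ltW nr)).
Qed.

End predictable.

(** * Poisson measures and their compensators *)

Section mixture.
Context dT dY (T : measurableType dT) (Y : measurableType dY) (R : realType).
Variables (P : {measure set T -> \bar R}) (m : T -> {measure set Y -> \bar R}).
Local Open Scope ereal_scope.

Definition measurable_sections := forall U : set (T * Y), measurable U ->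
  measurable_fun setT (fun t => m t (xsection U t)).

(** The semidirect product of [P] and [m], where [m] may have infinite mass. The proof of
    measurability is an argument, so that it travels with the function and the measure structure can
    be attached to it. *)
Definition mixture (_ : measurable_sections) (U : set (T * Y)) :=
  \int[P]_t m t (xsection U t).

Hypothesis mm : measurable_sections.

Let mixture0 : mixture mm set0 = 0.
Proof.
by rewrite /mixture; under eq_integral do rewrite xsection0 measure0; rewrite integral0.
Qed.

Let mixture_ge0 U : 0 <= mixture mm U. Proof. exact: integral_ge0. Qed.

Let mixture_sigma_additive : semi_sigma_additive (mixture mm).
Proof.
move=> F mF tF mUF.
have -> : mixture mm (\bigcup_n F n) = \sum_(0 <= n <oo) mixture mm (F n).
  rewrite /mixture -integral_nneseries//; last by move=> n; exact: mm.
  apply: eq_integral => t _; rewrite xsection_bigcup.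
  apply/esym/cvg_lim => //; apply: measure_semi_sigma_additive.
  - by move=> n; exact: measurable_xsection.
  - exact: trivIset_xsection.
  - by apply: bigcupT_measurable => n; exact: measurable_xsection.
by apply: is_cvg_nneseries => n _ _.
Qed.

HB.instance Definition _ := isMeasure.Build _ _ _ (mixture mm)
  mixture0 mixture_ge0 mixture_sigma_additive.

Let integral_mixture_nnsfun (f : {nnsfun (T * Y) >-> R}) :
  \int[mixture mm]_z (f z)%:E = \int[P]_t \int[m t]_y (f (t, y))%:E /\
  measurable_fun setT (fun t => \int[m t]_y (f (t, y))%:E).
Proof.
have sect t : \int[m t]_y (f (t, y))%:E =
    \sum_(r \in range f) r%:E * m t (xsection (f @^-1` [set r]) t).
  under eq_integral do rewrite fimfunE -fsumEFin//.
  rewrite ge0_integral_fsum//; last 2 first.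
  - move=> r; apply/measurable_EFinP/measurableT_comp => //.
    exact: measurableT_comp.
  - by move=> r y _; rewrite EFinM nnfun_muleindic_ge0.
  apply: eq_fsbigr => r /set_mem [z _ <-].
  under eq_integral do rewrite EFinM.
  rewrite ge0_integralZl_EFin//; last first.
    by apply/measurable_EFinP; exact: measurableT_comp.
  congr (_ * _); have mr : measurable (f @^-1` [set f z]) by exact: measurable_funPTI.
  rewrite -[xsection _ _]setIT -integral_indic//; last exact: measurable_xsection.
  apply: eq_integral => y _; congr EFin; rewrite !indicE; congr (nat_of_bool _)%:R.
  by apply/idP/idP; rewrite -?mem_xsection// !inE.
have ms r : measurable_fun setT (fun t => m t (xsection (f @^-1` [set r]) t)).
  by apply: mm; exact: measurable_funPTI.
have fr (r : R) : range f r -> (0 <= r)%R by move=> [z _ <-].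
split; last first.
  under eq_fun do rewrite sect.
  by apply: emeasurable_fsum => // r; exact: measurable_funeM.
rewrite integralT_nnsfun sintegralE; under [RHS]eq_integral do rewrite sect.
under [RHS]eq_integral.
  (* The exchange of integral and sum asks for nonnegative terms at every index, even outside the
     range of [f]; the positive part of [r] provides this and leaves the sum unchanged. *)
  move=> t _; rewrite (eq_fsbigr (fun r => (Num.max r 0)%:E * m t (xsection (f @^-1` [set r]) t))); last first.
    by move=> r /set_mem /fr r0; rewrite max_l.
  over.
rewrite ge0_integral_fsum//; last 2 first.
- by move=> r; exact: measurable_funeM.
- by move=> r t _; rewrite mule_ge0// lee_fin le_max lexx orbT.
apply: eq_fsbigr => r /set_mem /fr r0.
by rewrite max_l// ge0_integralZl_EFin.
Qed.

Lemma ge0_integral_mixture (f : T * Y -> \bar R) :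
  (forall z, 0 <= f z) -> measurable_fun setT f ->
  \int[mixture mm]_z f z = \int[P]_t \int[m t]_y f (t, y).
Proof.
move=> f0 mf; pose g := nnsfun_approx measurableT mf.
have cg z : (g n z)%:E @[n --> \oo] --> f z by exact: cvg_nnsfun_approx.
have ndg z : {homo (fun n => (g n z)%:E) : a b / (a <= b)%N >-> a <= b}.
  by move=> a b ab; rewrite lee_fin; exact/lefP/nd_nnsfun_approx.
transitivity (limn (fun n => \int[mixture mm]_z (g n z)%:E)).
  rewrite -monotone_convergence//.
  - by apply: eq_integral => z _; apply/esym/cvg_lim => //; exact: cg.
  - by move=> n; exact/measurable_EFinP.
  - by move=> n z _; rewrite lee_fin.
rewrite (_ : (fun n => _) = (fun n => \int[P]_t \int[m t]_y (g n (t, y))%:E)); last first.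
  by apply/funext => n; rewrite (integral_mixture_nnsfun (g n)).1.
have mgt n t : measurable_fun setT (fun y => (g n (t, y))%:E).
  by apply/measurable_EFinP; exact: measurableT_comp.
rewrite -monotone_convergence//.
- apply: eq_integral => t _; rewrite -monotone_convergence//.
  + by apply: eq_integral => y _; apply/cvg_lim => //; exact: cg.
  + by move=> n y _; rewrite lee_fin.
- by move=> n; exact: (integral_mixture_nnsfun (g n)).2.
- by move=> n t _; apply: integral_ge0 => y _; rewrite lee_fin.
- move=> t _ a b ab; apply: ge0_le_integral => //.
  + by move=> y _; rewrite lee_fin.
  + by move=> y _; exact: ndg.
Qed.

End mixture.

Section poisson_mean.
Context (R : realType).
Local Open Scope ereal_scope.

Lemma poisson_prob_pmf (r : R) k :
  poisson_prob r 0%N [set k] = (if (0 < r)%R then poisson_pmf r k else (k == 0)%:R)%:E.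
Proof.
rewrite /poisson_prob; case: ifPn => r0.
  by rewrite esum_set1// lee_fin poisson_pmf_ge0.
rewrite diracE; congr (_%:R)%:E; congr nat_of_bool.
apply/idP/idP => [|/eqP ->]; last by rewrite inE.
by rewrite inE/= => <-.
Qed.

Lemma nneseries_poisson_prob (r : R) :
  \sum_(0 <= k <oo) poisson_prob r 0%N [set k] = 1.
Proof.
have tr : trivIset setT (fun k : nat => [set k]).
  by move=> i j _ _ [k [-> ->]].
have := @measure_semi_sigma_additive _ _ _ (poisson_prob r 0%N) (fun k => [set k])
  (fun=> I) tr I.
move=> /cvg_lim -> //; rewrite (_ : \bigcup_k [set k] = setT).
  exact: (@probability_setT _ _ _ (poisson_prob r 0%N)).
by apply/seteqP; split => // k _; exists k.
Qed.

(** The relation [(k + 1) p(k + 1) = r p(k)] between consecutive probabilities reduces the mean to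
    [r] times the total mass 1; for [r = 0] the law is the Dirac mass at 0. *)
Lemma poisson_prob_mean (r : R) : (0 <= r)%R ->
  \sum_(0 <= k <oo) k%:R%:E * poisson_prob r 0%N [set k] = r%:E.
Proof.
move=> r0; rewrite nneseries_recl ?mul0e ?add0e//; last first.
  by move=> k _; rewrite mule_ge0// lee_fin.
rewrite -(@nneseries_addn _ _ 1%N); last by move=> k; rewrite mule_ge0// lee_fin.
rewrite (eq_eseriesr (g := fun k => r%:E * poisson_prob r 0%N [set k])).
  by rewrite nneseriesZl// nneseries_poisson_prob mule1.
move=> k _; rewrite addn1 !poisson_prob_pmf /poisson_pmf; case: ifPn => [rgt0|].
  rewrite -!EFinM; congr EFin; rewrite exprS factS natrM invfM.
  rewrite rgt0; set x : R := k.+1%:R%R; set y : R := (k`!%:R^-1)%R.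
  transitivity (x / x * (r * (r ^+ k * y * expR (- r))))%R; first by ring.
  by rewrite divff ?mul1r// pnatr_eq0.
by rewrite -leNgt => r_le0; rewrite (@le_anti _ _ r 0%R) ?r_le0// !mule0 mul0e.
Qed.

End poisson_mean.

(** The probabilities of the integer values add up to 1, so [X] is almost surely the sum over [k] of
    [k] times the indicator of [X = k]; independence from [A] is applied to each of these levels. *)
Lemma integral_poisson d (Omega : measurableType d) (R : realType)
    (P : probability Omega R) (X : Omega -> \bar R) (r : R) (A : set Omega) :
  measurable A -> measurable_fun setT X -> (forall w, 0 <= X w)%E -> 0 <= r ->
  (forall k, P [set w | X w = k%:R%:E] = poisson_prob r 0%N [set k]) ->
  (forall k, P (A `&` [set w | X w = k%:R%:E]) =
             P A * P [set w | X w = k%:R%:E])%E ->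
  (\int[P]_(w in A) X w = P A * r%:E)%E.
Proof.
move=> mA mX X0 r0 Xr XA.
pose E k := [set w | X w = k%:R%:E].
have mE k : measurable (E k).
  rewrite (_ : E k = X @^-1` [set k%:R%:E])//.
  by rewrite -[_ @^-1` _]setTI; exact: mX.
have tE : trivIset setT E.
  by move=> i j _ _ [w [/= Xi]]; rewrite /E/= Xi => -[/eqP]; rewrite eqr_nat => /eqP.
have PE : P (\bigcup_k E k) = 1%E.
  rewrite measure_semi_bigcup//; last exact: bigcupT_measurable.
  by rewrite -(nneseries_poisson_prob r); apply: eq_eseriesr => k _; exact: Xr.
pose g w : \bar R := (\sum_(0 <= k <oo) k%:R%:E * (\1_(E k) w)%:E)%E.
have mg k : measurable_fun A (fun w => k%:R%:E * (\1_(E k) w)%:E : \bar R)%E.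
  by apply: measurable_funeM; apply/measurable_EFinP.
have g0 k w : (0 <= k%:R%:E * (\1_(E k) w)%:E :> \bar R)%E.
  by rewrite mule_ge0// lee_fin.
transitivity (\int[P]_(w in A) g w)%E.
  apply: ge0_ae_eq_integral => //.
  - exact: measurable_funTS.
  - by apply: ge0_emeasurable_sum.
  - by move=> w _; apply: nneseries_ge0.
  exists (~` \bigcup_k E k); split.
  - by apply: measurableC; exact: bigcupT_measurable.
  - by have := probability_setC P (bigcupT_measurable _ mE); rewrite PE subee.
  - move=> w /= + [k _ Ekw]; apply => _; rewrite /g (@nneseriesD1 _ _ k)//.
    rewrite eseries0 ?adde0; first by rewrite indicE mem_set// mule1.
    move=> i _ /= ik; rewrite indicE memNset ?mule0// => Eiw.
    by move: ik; rewrite (tE i k I I) ?eqxx//; exists w.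
have PA : P A = (fine (P A))%:E by rewrite fineK// fin_num_measure.
rewrite integral_nneseries// -(poisson_prob_mean r0) PA -nneseriesZl//; last first.
  by move=> k _; rewrite mule_ge0// lee_fin.
apply: eq_eseriesr => k _; rewrite ge0_integralZl_EFin//; last first.
  by apply/measurable_EFinP.
by rewrite integral_indic// -Xr muleCA -PA -XA setIC.
Qed.

Section real_lebesgue.
Context (R : realType).

(* [lebesgue_measure] lives on [measurableTypeR R], whose display differs from the
   default one of [R]; [leb] is the same function on the default structure. *)
Definition leb : set R -> \bar R := lebesgue_measure.

Let leb0 : leb set0 = 0%E. Proof. exact: (measure0 (@lebesgue_measure R)). Qed.

Let leb_ge0 A : (0 <= leb A)%E. Proof. exact: (measure_ge0 (@lebesgue_measure R)). Qed.

Let leb_sigma_additive : semi_sigma_additive leb.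
Proof. exact: (@measure_semi_sigma_additive _ _ _ (@lebesgue_measure R)). Qed.

HB.instance Definition _ := isMeasure.Build _ R R leb leb0 leb_ge0 leb_sigma_additive.

Let leb_sigma_finite : sigma_finite setT leb.
Proof. exact: (@sigma_finiteT _ _ _ (@lebesgue_measure R)). Qed.

HB.instance Definition _ := Measure_isSigmaFinite.Build _ _ _ leb leb_sigma_finite.

Lemma ge0_integral_leb (D : set R) (f : R -> \bar R) : measurable D ->
  measurable_fun D f -> (forall x, D x -> (0 <= f x)%E) ->
  (\int[lebesgue_measure]_(x in D) f x = \int[leb]_(x in D) f x)%E.
Proof.
move=> mD mf f0.
have mid : measurable_fun [set: measurableTypeR R] (id : measurableTypeR R -> R) by [].
have := @ge0_integral_pushforward _ _ (measurableTypeR R) R R id mid lebesgue_measure D f mD mf.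
rewrite preimage_id => <-; last by move=> x /set_mem; exact: f0.
by apply: eq_measure_integral => A mA _.
Qed.

Definition leb2 : {measure set (R * R) -> \bar R} := (leb \x leb)%E.

Lemma leb2E (B : set (R * R)) : measurable B ->
  (lebesgue_measure \x lebesgue_measure)%E B = leb2 B.
Proof.
move=> mB.
pose mR2 := (measurableTypeR R * measurableTypeR R)%type.
have mid : measurable_fun [set: R * R] (id : R * R -> mR2) by [].
pose mid_pack : {mfun (R * R)%type >-> mR2} := HB.pack (id : R * R -> mR2)
  (isMeasurableFun.Build _ _ _ _ _ mid).
apply: (@product_measure_unique _ _ _ _ _ lebesgue_measure lebesgue_measure
  (pushforward leb2 mid_pack)) => //.
by move=> A A' mA mA'; exact: product_measure1E.
Qed.

End real_lebesgue.

Arguments leb {R}.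

Section compensated.
Context d (Omega : measurableType d) (R : realType).
Variable P : probability Omega R.
Local Open Scope ereal_scope.

(** Adaptedness together with the mean on past events of the mass of future sets: these values
    determine the compensator [ds dz]. No law appears, so the property can be transferred to the
    completed filtration. The last clause also covers sets that meet the line at time 0. *)
Definition compensated (G : R -> set (set Omega))
    (N : Omega -> {measure set (R * R) -> \bar R}) :=
  [/\ forall B : set (R * R), measurable B -> B `<=` quadrant ->
        measurable_fun setT (fun w => N w B),
      forall (t : R) (B : set (R * R)), (0 <= t)%R -> measurable B -> B `<=` `[0%R, t] `*` `[0%R, +oo[ ->
        measurable_fun [set: g_sigma_algebraType (G t)] (fun w => N w B),
      forall (s : R) (A : set Omega) (B : set (R * R)), (0 <= s)%R -> G s A -> measurable B ->
        B `<=` `]s, +oo[ `*` `[0%R, +oo[ ->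
        @leb2 R B < +oo ->
        \int[P]_(w in A) N w B = P A * @leb2 R B &
      forall B : set (R * R), measurable B -> B `<=` quadrant ->
        @leb2 R B < +oo ->
        \int[P]_w N w B = @leb2 R B].

Lemma adapted_poisson_compensated F N : filtration F ->
  adapted_poisson_measure P F N -> compensated F N.
Proof.
move=> [sF mF _] [[mN pN _] adN indN].
have leb2_fin B : @leb2 R B < +oo -> @leb2 R B = (fine (@leb2 R B) : R)%:E.
  by move=> Boo; rewrite fineK// ge0_fin_numE.
split => //.
- move=> t B t0 mB Bt; move=> _ V mV; rewrite setTI.
  apply: sub_sigma_algebra; apply: (adN t t0); apply: sub_sigma_algebra.
  by exists B, V.
- move=> s A B s0 FA mB Bs Boo; rewrite [in RHS]leb2_fin//.
  have Bq : B `<=` quadrant.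
    move=> y /Bs [/= ys y0]; split => //=; move: ys; rewrite !in_itv/= !andbT.
    by move=> /ltW; exact: le_trans.
  apply: integral_poisson => //.
  + exact: (mF s).
  + exact: mN.
  + by move=> k; rewrite pN ?leb2E.
  + move=> k; apply: (indN s s0) => //; apply: sub_sigma_algebra.
    by exists B, [set k%:R%:E].
- move=> B mB Bq Boo; rewrite [in RHS]leb2_fin//.
  rewrite (@integral_poisson _ _ _ P _ (fine (@leb2 R B)))//.
  + by rewrite probability_setT mul1e.
  + exact: mN.
  + by move=> k; rewrite pN ?leb2E.
  + by move=> k; rewrite setTI probability_setT mul1e.
Qed.

End compensated.

Section strip.
Context (R : realType).
Local Notation leb2 := (leb2 R).

(** Time 0 is left out because predictable rectangles do not control it; the line at time 0 is dealt
    with in [ae_no_atom]. *)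
Definition strip : set (R * R) := [set y | 0 < y.1 /\ 0 <= y.2].

Definition box (n : nat) : set (R * R) := `]0, n%:R] `*` `[0, n%:R].

Lemma measurable_box n : measurable (box n).
Proof. exact: measurableX. Qed.

Lemma stripE : strip = `]0, +oo[ `*` `[0, +oo[.
Proof.
by apply/seteqP; split=> -[u z] /=; rewrite !in_itv/= !andbT.
Qed.

Lemma measurable_strip : measurable strip.
Proof. by rewrite stripE; exact: measurableX. Qed.

Lemma nondecreasing_box : nondecreasing_seq box.
Proof.
move=> a b ab; apply/subsetPset => -[u z] [/=]; rewrite !in_itv/=.
have ab' : a%:R <= b%:R :> R by rewrite ler_nat.
move=> /andP[u0 ua] /andP[z0 za]; split; rewrite /= in_itv/= ?u0 ?z0/=.
  exact: le_trans ab'.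
exact: le_trans ab'.
Qed.

Lemma bigcup_box : \bigcup_n box n = strip.
Proof.
apply/seteqP; split=> [y [n _ [/=]]|[u z] [/= u0 z0]].
  by rewrite !in_itv/= => /andP[? _] /andP[].
exists (Num.truncn (Num.max u z)).+1 => //; split => /=; rewrite in_itv/= ?u0 ?z0/=.
  by rewrite (le_trans _ (ltW (truncnS_gt _)))// le_max lexx.
by rewrite (le_trans _ (ltW (truncnS_gt _)))// le_max lexx orbT.
Qed.

Lemma leb2_rect (a b c e : R) : (leb2 (`[a, b] `*` `[c, e]) < +oo)%E.
Proof.
have f x y : (leb `[x, y] < +oo :> \bar R)%E.
  have -> : leb `[x, y] = lebesgue_measure `[x, y] by [].
  by rewrite lebesgue_measure_itv/= lte_fin; case: ifPn => _; rewrite -?EFinB ltry.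
rewrite [X in (X < _)%E]product_measure1E//.
by apply: lte_mul_pinfty => //; [rewrite ge0_fin_numE//; exact: f|exact: f].
Qed.

Lemma lebesgue_box n : (leb2 (box n) < +oo)%E.
Proof.
apply: le_lt_trans (leb2_rect 0 n%:R 0 n%:R).
apply: le_measure; rewrite ?inE; [exact: measurable_box|exact: measurableX|].
by move=> -[u z] [/=]; rewrite !in_itv/= => /andP[/ltW -> ->].
Qed.

Lemma box_strip n : box n `<=` strip.
Proof. by rewrite -bigcup_box; exact: bigcup_sup. Qed.

Lemma strip_quadrant : strip `<=` quadrant.
Proof.
by move=> [u z] [/= u0 z0]; split => /=; rewrite in_itv/= andbT// ltW.
Qed.

End strip.

Section compensation.
Context d (Omega : measurableType d) (R : realType).
Variable P : probability Omega R.
Variables (G : R -> set (set Omega)) (N : Omega -> {measure set (R * R) -> \bar R}).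
Hypotheses (hG : filtration G) (hN : compensated P G N).
Local Open Scope ereal_scope.
Local Notation leb2 := (leb2 R).
Local Notation Rbox := (fun n (_ : Omega) => @box R n).

Definition good := tame N Rbox.

Definition strip_integral (H : Omega * (R * R) -> \bar R) (w : Omega) :=
  if good w then \int[N w]_(y in @strip R) H (w, y) else 0.

Let mbox n (w : Omega) : measurable (@box R n). Proof. exact: measurable_box. Qed.

Let ndbox (w : Omega) : nondecreasing_seq (@box R). Proof. exact: nondecreasing_box. Qed.

Lemma measurable_noise_box n B : measurable B -> measurable_fun setT (fun w => N w (B `&` @box R n)).
Proof.
move=> mB; have [h _ _ _] := hN; apply: h.
  by apply: measurableI => //; exact: measurable_box.
by move=> y [_ /box_strip/strip_quadrant].
Qed.

Lemma ge0_measurable_fun_strip_integral H : (forall z, 0 <= H z) ->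
  measurable_fun setT H -> measurable_fun setT (strip_integral H).
Proof.
move=> H0 mH.
have := ge0_measurable_fun_integral_tame mbox ndbox measurable_noise_box H0 mH.
by rewrite bigcup_box.
Qed.

Lemma ae_good : {ae P, forall w, good w}.
Proof.
have h : {ae P, forall w n, N w (@box R n) < +oo}.
  apply: ae_foralln => n.
  have [mN _ _ EN] := hN.
  have mn : measurable_fun setT (fun w => N w (@box R n)).
    apply: mN; first exact: measurable_box.
    exact: subset_trans (@box_strip R n) (@strip_quadrant R).
  have : P.-integrable setT (fun w => N w (@box R n)).
    apply/integrableP; split => //.
    under eq_integral do rewrite gee0_abs//.
    rewrite EN ?lebesgue_box//; [exact: measurable_box|].
    exact: subset_trans (@box_strip R n) (@strip_quadrant R).
  move=> /(integrable_ae measurableT); apply: filterS => w /(_ I).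
  by rewrite ge0_fin_numE.
by apply: filterS h => w h; apply/asboolP.
Qed.

(** The mean is given for sets of finite area and the boxes exhaust the strip. As [P A] is finite,
    the product passes to the limit even if the limiting area is infinite. *)
Lemma compensated_rect s A B : (0 <= s)%R -> G s A -> measurable B ->
  (B `<=` [set y | (0 < y.1)%R -> (s < y.1)%R]) ->
  \int[P]_(w in A) N w (B `&` @strip R) = P A * leb2 (B `&` @strip R).
Proof.
move=> s0 GA mB Bs; have [mN _ EA _] := hN.
have mA : measurable A by have [_ + _] := hG; move=> /(_ s s0); exact.
have BE : B `&` @strip R = \bigcup_n (B `&` box n) by rewrite -setI_bigcupr bigcup_box.
have mBn n : measurable (B `&` @box R n) by apply: measurableI => //; exact: measurable_box.
have ndB : nondecreasing_seq (fun n => B `&` @box R n).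
  by move=> a b ab; apply/subsetPset; apply: setIS; apply/subsetPset; exact: nondecreasing_box.
have cvB (mu : {measure set (R * R) -> \bar R}) :
    mu (B `&` box n) @[n --> \oo] --> mu (B `&` @strip R).
  rewrite BE; apply: nondecreasing_cvg_mu => //; exact: bigcupT_measurable.
have E n : \int[P]_(w in A) N w (B `&` @box R n) = P A * leb2 (B `&` @box R n).
  apply: (EA s) => //.
    move=> y [/Bs /= ys /box_strip [y1 y2]]; split => /=; rewrite in_itv/= andbT//.
    exact: ys.
  apply: le_lt_trans (lebesgue_box R n); apply: le_measure; rewrite ?inE//.
  exact: measurable_box.
transitivity (limn (fun n => \int[P]_(w in A) N w (B `&` @box R n))).
  rewrite -monotone_convergence//.
  - by apply: eq_integral => w _; apply/esym/cvg_lim => //; exact: cvB.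
  - by move=> n; apply: measurable_funTS; exact: measurable_noise_box.
  - by move=> w _ a b ab; apply: le_measure; rewrite ?inE//; exact/subsetPset/ndB.
apply/cvg_lim => //; rewrite (_ : (fun n => _) = fun n => P A * leb2 (B `&` @box R n)).
  by apply: cvgeZl; [exact: fin_num_measure|exact: cvB].
by apply/funext.
Qed.

Section strip_kernel.
Variable mu : Omega -> {measure set (R * R) -> \bar R}.
Hypothesis mmu : forall n B, measurable B -> measurable_fun setT (fun w => mu w (B `&` @box R n)).

Let mstrip := @measurable_strip R.

Definition strip_kernel (w : Omega) : {measure set (R * R) -> \bar R} :=
  if tame mu Rbox w then (mrestr (mu w) mstrip : {measure set (R * R) -> \bar R}) else mzero.

Lemma measurable_sections_strip_kernel : measurable_sections strip_kernel.
Proof.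
move=> U mU.
have h := ge0_measurable_fun_integral_tame mbox ndbox mmu
  (F := fun z => (\1_U z)%:E) (fun z => ltac:(by rewrite lee_fin)).
have {}h := h (ltac:(by apply/measurable_EFinP)).
apply: eq_measurable_fun h => w _; rewrite /strip_kernel; case: ifPn => // _.
rewrite bigcup_box /= /mrestr -integral_indic//; last exact: measurable_xsection.
by apply: eq_integral => y _; rewrite !indicE mem_xsection.
Qed.

Lemma ge0_integral_strip_kernel w (f : R * R -> \bar R) : (forall y, 0 <= f y) ->
  measurable_fun setT f ->
  \int[strip_kernel w]_y f y =
  if tame mu Rbox w then \int[mu w]_(y in @strip R) f y else 0.
Proof.
move=> f0 mf; rewrite /strip_kernel; case: ifPn => _.
  exact: ge0_integral_mrestr.
exact: integral_measure_zero.
Qed.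

End strip_kernel.

(** A function measurable for a coarser sigma-algebra sees the measures only there: both are pushed
    forward along the identity into the coarser space. *)
Lemma ge0_integral_eq_sub_sigma dT (T : measurableType dT) (C : set (set T))
    (m1 m2 : {measure set T -> \bar R}) (f : T -> \bar R) :
  C `<=` measurable -> (forall A, <<s C >> A -> m1 A = m2 A) ->
  (forall x, 0 <= f x) -> measurable_fun [set: g_sigma_algebraType C] f ->
  \int[m1]_x f x = \int[m2]_x f x.
Proof.
move=> CT m12 f0 mf.
have mid : measurable_fun [set: T] (id : T -> g_sigma_algebraType C).
  move=> _ B mB; rewrite setTI preimage_id.
  by apply: smallest_sub mB => //; exact: sigma_algebra_measurable.
have e1 := @ge0_integral_pushforward _ _ T (g_sigma_algebraType C) R id mid m1 setT f
  measurableT mf (fun x _ => f0 x).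
have e2 := @ge0_integral_pushforward _ _ T (g_sigma_algebraType C) R id mid m2 setT f
  measurableT mf (fun x _ => f0 x).
rewrite preimage_setT in e1 e2; rewrite -[LHS]e1 -[RHS]e2.
by apply: eq_measure_integral => A mA _; exact: m12.
Qed.

(** Both sides integrate [H] against a mixture, of [P] with the noise and of [P] with the area. The
    two mixtures agree on predictable rectangles, which are stable under intersection and generate
    the predictable sigma-algebra. *)
Lemma compensation H : (forall z, 0 <= H z) ->
  measurable_fun [set: g_sigma_algebraType (pred_rect G (@fst R R))] H ->
  \int[P]_w strip_integral H w = \int[P]_w \int[leb2]_(y in @strip R) H (w, y).
Proof.
move=> H0 mH; have mH' := predictable_measurable hG mH.
have mleb n B : measurable B -> measurable_fun [set: Omega] (fun w => leb2 (B `&` @box R n)).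
  by move=> _; exact: measurable_cst.
pose M1 := mixture P (measurable_sections_strip_kernel measurable_noise_box).
pose M2 := mixture P (measurable_sections_strip_kernel mleb).
have tleb w : tame (fun _ : Omega => leb2) Rbox w by apply/asboolP => n; exact: lebesgue_box.
have mHw w : measurable_fun setT (fun y => H (w, y)) by exact: measurableT_comp.
transitivity (\int[M1]_z H z).
  rewrite ge0_integral_mixture//; apply: eq_integral => w _.
  by rewrite ge0_integral_strip_kernel.
transitivity (\int[M2]_z H z); last first.
  rewrite ge0_integral_mixture//; apply: eq_integral => w _.
  by rewrite ge0_integral_strip_kernel// tleb.
have GT : G 0%R setT.
  have [sG _ _] := hG; have [G0 GC GU] := sG 0%R (lexx _).
  by rewrite -setC0 -setTD; exact: GC.
have M2E A B : measurable A -> measurable B ->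
    M2 (A `*` B) = P A * leb2 (B `&` @strip R).
  move=> mA mB; rewrite /M2/= /mixture.
  transitivity (\int[P]_(w in A) (cst (leb2 (B `&` @strip R)) w)).
    rewrite [RHS]integral_mkcond; apply: eq_integral => w _.
    rewrite /strip_kernel tleb/= /mrestr patchE; case: ifPn => wA.
      by rewrite in_xsectionX.
    by rewrite notin_xsectionX// set0I measure0.
  by rewrite integral_cst// muleC.
(* With the sides exchanged, the finiteness asked by the uniqueness theorem concerns [M2], whose
   mass on a rectangle is bounded by an area. *)
apply/esym.
apply: (ge0_integral_eq_sub_sigma (pred_rect_measurable hG (tau := @fst R R))) => //.
(* Predictable rectangles starting at time 0; the squares must cover the whole plane although only
   their part in the strip has mass. *)
pose g n : set (Omega * (R * R)) :=
  setT `*` (`[(- n%:R)%R, n%:R%R] `*` `[(- n%:R)%R, n%:R%R]).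
apply: (@g_sigma_algebra_measure_unique _ R _ (pred_rect G (@fst R R)) _ g).
- exact: pred_rect_measurable.
- move=> n; exists 0%R, setT, (`[(- n%:R)%R, n%:R%R] `*` `[(- n%:R)%R, n%:R%R]); split => //.
  exact: measurableX.
- apply/seteqP; split => // -[w [u z]] _.
  exists (Num.truncn (Num.max `|u| `|z|)%R).+1 => //; split => //.
  have h x : (x <= Num.max `|u| `|z|)%R ->
      (x <= (Num.truncn (Num.max `|u| `|z|)%R).+1%:R)%R.
    by move=> /le_trans; apply; exact: ltW (truncnS_gt _).
  split => /=; rewrite in_itv/= -ler_norml; apply: h; rewrite le_max lexx ?orbT//.
- exact: setI_closed_pred_rect.
- move=> _ [s [A [B [s0 GA mB Bs ->]]]].
  have mA : measurable A by have [_ + _] := hG; move=> /(_ s s0); exact.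
  transitivity (P A * leb2 (B `&` @strip R)); first exact: M2E.
  rewrite -(compensated_rect s0 GA mB Bs) /M1/= /mixture [LHS]integral_mkcond.
  (* The masses agree only almost surely: outside [good] the kernel was set to 0 while [N w] was
     not. *)
  apply/esym; apply: ae_eq_integral => //.
  + exact: (measurable_sections_strip_kernel measurable_noise_box (measurableX mA mB)).
  + apply/measurable_restrict => //; apply: measurable_funTS.
    have [mN _ _ _] := hN; apply: mN.
      by apply: measurableI => //; exact: measurable_strip.
    by move=> y [_ /strip_quadrant].
  apply: filterS ae_good => w gw _ /=.
  rewrite /strip_kernel -/(good w) gw/= /mrestr patchE; case: ifPn => wA.
    by rewrite in_xsectionX.
  by rewrite notin_xsectionX// set0I measure0.
- move=> n; pose C : set (R * R) := `[(- n%:R)%R, n%:R%R] `*` `[(- n%:R)%R, n%:R%R].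
  apply: (@le_lt_trans _ _ (P setT * leb2 (C `&` @strip R))).
    by rewrite -M2E//; exact: measurableX.
  rewrite probability_setT mul1e; apply: (@le_lt_trans _ _ (leb2 (`[(- n%:R)%R, n%:R%R] `*` `[(- n%:R)%R, n%:R%R]))).
    apply: le_measure; rewrite ?inE//; last exact: measurableX.
    by apply: measurableI; [exact: measurableX|exact: measurable_strip].
  exact: leb2_rect.
Qed.

End compensation.

(** * Convolution and exponential weights *)

Section translation.
Context (R : realType).
Local Open Scope ereal_scope.

Lemma leb_translate (u : R) (A : set R) : measurable A ->
  leb ((fun x => x - u)%R @^-1` A) = leb A.
Proof.
move=> mA; pose f : measurableTypeR R -> measurableTypeR R := fun x => (x - u)%R.
have mf : measurable_fun setT f by apply: measurable_funB.
pose F : {mfun measurableTypeR R >-> measurableTypeR R} :=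
  HB.pack f (isMeasurableFun.Build _ _ _ _ _ mf).
rewrite -[RHS]/(lebesgue_measure A).
rewrite (@lebesgue_measure_unique _ (pushforward lebesgue_measure F))//.
move=> _ [[a b]] _ <- /=; rewrite /pushforward.
rewrite (_ : _ @^-1` _ = `](a + u)%R, (b + u)%R]%classic); last first.
  by apply/seteqP; split=> x /=; rewrite /f !in_itv/= ltrBrDr lerBlDr.
rewrite !lebesgue_measure_itv/= !lte_fin ltrD2r; case: ifPn => // _.
by rewrite -!EFinB; congr EFin; ring.
Qed.

Lemma ge0_integral_translate (u : R) (f : R -> \bar R) :
  measurable_fun setT f -> (forall x, 0 <= f x) ->
  \int[leb]_x f (x - u)%R = \int[leb]_x f x.
Proof.
move=> mf f0.
have mg : measurable_fun [set: R] (fun x : R => x - u)%R by apply: measurable_funB.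
have := @ge0_integral_pushforward _ _ R R R _ mg leb setT f measurableT mf (fun x _ => f0 x).
rewrite preimage_setT => <-.
by apply: eq_measure_integral => A mA _; exact: leb_translate.
Qed.

End translation.

Section convolution.
Context (R : realType).
Variable Phi : R -> R.
Hypotheses (Phi_ge0 : forall r, 0 <= Phi r) (Phi_meas : measurable_fun setT Phi)
  (Phi_le0 : forall r, r <= 0 -> Phi r = 0).
Local Open Scope ereal_scope.

Implicit Types M : R -> \bar R.

Definition weight (b s : R) : R := expR (- (b * s))%R.

Definition wint (T b : R) (M : R -> \bar R) :=
  \int[leb]_(s in `]0%R, T]) ((weight b s)%:E * M s).

(** A domain independent of [s] suits Tonelli. The kernels to which it is applied vanish on
    nonpositive reals, so only the times [u < s] contribute. *)
Definition convol (M : R -> \bar R) (s : R) :=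
  \int[leb]_(u in `]0%R, +oo[) ((Phi (s - u))%:E * M u).

Lemma weight_ge0 b s : (0 <= weight b s)%R. Proof. exact: expR_ge0. Qed.

Lemma measurable_weight b : measurable_fun setT (weight b).
Proof.
apply: measurableT_comp => //; exact: measurableT_comp.
Qed.

Lemma measurable_convol_integrand M : measurable_fun setT M ->
  measurable_fun [set: R * R]
    (fun x => (Phi (x.1 - x.2))%:E * (M \_ `]0%R, +oo[) x.2).
Proof.
move=> mM; apply: emeasurable_funM.
  apply/measurable_EFinP; apply: measurableT_comp => //.
  exact: measurable_funB.
apply: (measurableT_comp (f := (M \_ `]0%R, +oo[))) => //.
by apply/measurable_restrict => //; exact: measurable_funTS.
Qed.

Lemma convolE M s : convol M s = \int[leb]_u ((Phi (s - u))%:E * (M \_ `]0%R, +oo[) u).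
Proof.
rewrite /convol integral_mkcond; apply: eq_integral => u _.
by rewrite !patchE; case: ifPn => // _; rewrite mule0.
Qed.

Lemma measurable_convol M : measurable_fun setT M -> (forall s, 0 <= M s) ->
  measurable_fun setT (convol M).
Proof.
move=> mM M0; have -> : convol M = fun s =>
    \int[leb]_u ((Phi (s - u))%:E * (M \_ `]0%R, +oo[) u).
  by apply/funext => s; exact: convolE.
have F0 x : 0 <= (Phi (x.1 - x.2))%:E * (M \_ `]0%R, +oo[) x.2.
  rewrite mule_ge0 ?lee_fin//.
  by rewrite patchE; case: ifPn.
have := measurable_fun_fubini_tonelli_F (m2 := leb) _ (measurable_convol_integrand mM) F0.
exact.
Qed.

Lemma convol_ge0 M s : (forall s, 0 <= M s) -> 0 <= convol M s.
Proof.
by move=> M0; apply: integral_ge0 => u _; rewrite mule_ge0 ?lee_fin.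
Qed.

(** Young's inequality for the weighted norm: [weight b s] is the product of [weight b u] and
    [weight b (s - u)], and after Tonelli the substitution [r = s - u] separates the two integrals.
    Both stay in []0, T]] because [s <= T], [0 < u] and [Phi] vanishes on nonpositive reals. *)
Lemma wint_convol T b M : measurable_fun setT M -> (forall s, 0 <= M s) -> (0 <= T)%R ->
  wint T b (convol M) <= (\int[leb]_(r in `]0%R, T]) (weight b r * Phi r)%:E) * wint T b M.
Proof.
move=> mM M0 T0; set K := (X in _ <= X * _).
have K0 : 0 <= K.
  by apply: integral_ge0 => r _; rewrite lee_fin mulr_ge0// weight_ge0.
pose M' := M \_ `]0%R, +oo[.
have M'0 s : 0 <= M' s by rewrite /M' patchE; case: ifPn.
pose ind : R -> R := \1_(`]0%R, T]%classic : set R).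
have ind0 s : (0 <= ind s)%R by [].
have mind : measurable_fun setT ind by exact: measurable_indic.
have mPhiw D : measurable_fun D (fun r => (weight b r * Phi r)%:E).
  apply: measurable_funTS; apply/measurable_EFinP; apply: measurable_funM => //.
  exact: measurable_weight.
have mshift (f : R -> R) (v : R) : measurable_fun setT f ->
    measurable_fun setT (fun s : R => f (s + v)%R).
  by move=> mf; apply: measurableT_comp => //; exact: measurable_funD.
have miw : measurable_fun setT (fun s => ind s * weight b s)%R.
  by apply: measurable_funM => //; exact: measurable_weight.

pose F (x : R * R) := (ind x.1 * weight b x.1)%:E * ((Phi (x.1 - x.2))%:E * M' x.2).
have F0 x : 0 <= F x.
  by rewrite /F mule_ge0 ?lee_fin ?mulr_ge0 ?weight_ge0// mule_ge0 ?lee_fin.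
have mF : measurable_fun setT F.
  apply: emeasurable_funM; last exact: measurable_convol_integrand.
  apply/measurable_EFinP; apply: measurable_funM; first exact: measurableT_comp.
  by apply: (measurableT_comp (measurable_weight b)).
have -> : wint T b (convol M) = \int[leb]_s \int[leb]_u F (s, u).
  rewrite /wint integral_mkcond; apply: eq_integral => s _.
  transitivity ((ind s * weight b s)%:E * convol M s).
    rewrite patchE /ind indicE; case: ifPn => _; last by rewrite mul0r mul0e.
    by rewrite mul1r.
  rewrite convolE -ge0_integralZl_EFin//.
  - by move=> u _; rewrite mule_ge0 ?lee_fin.
  - exact: (measurable_fun_pair2 s (measurable_convol_integrand mM)).
  - by rewrite mulr_ge0 ?weight_ge0.
rewrite (@fubini_tonelli _ _ _ _ _ leb leb F)//.
rewrite /wint -ge0_integralZl//; last 2 first.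
- apply: emeasurable_funM; last exact: measurable_funTS.
  by apply: measurable_funTS; apply/measurable_EFinP; exact: measurable_weight.
- by move=> s _; rewrite mule_ge0// lee_fin weight_ge0.
rewrite [leRHS]integral_mkcond.
apply: ge0_le_integral => //.
- by move=> u _; apply: integral_ge0.
- by have := measurable_fun_fubini_tonelli_G (m1 := leb) _ mF F0; exact.
- apply/measurable_restrict => //; apply: measurable_funeM.
  apply: emeasurable_funM; last exact: measurable_funTS.
  by apply: measurable_funTS; apply/measurable_EFinP; exact: measurable_weight.
move=> u _; rewrite [leRHS]patchE; case: ifPn => [|uT].
  rewrite inE/= in_itv/= => /andP[u0 uT].
  have -> : \int[leb]_s F (s, u) =
      M u * \int[leb]_s ((ind s * weight b s)%:E * (Phi (s - u))%:E).
    rewrite -ge0_integralZl//; last 2 first.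
    + apply: emeasurable_funM; apply/measurable_EFinP => //.
      exact: mshift.
    + by move=> s _; rewrite mule_ge0 ?lee_fin ?mulr_ge0 ?weight_ge0.
    apply: eq_integral => s _; rewrite /F/= /M' patchE.
    rewrite mem_set/=; last by rewrite in_itv/= u0.
    by rewrite [RHS]muleC muleA.
  rewrite muleA [leRHS]muleC; apply: lee_pmul => //.
    by apply: integral_ge0 => s _; rewrite mule_ge0 ?lee_fin ?mulr_ge0 ?weight_ge0.
  pose g (r : R) := (ind (r + u) * weight b (r + u))%:E * (Phi r)%:E.
  rewrite (_ : (\int[leb]_s _) = \int[leb]_s g (s - u)%R); last first.
    by apply: eq_integral => s _; rewrite /g subrK.
  rewrite ge0_integral_translate; last 2 first.
  + apply: emeasurable_funM; apply/measurable_EFinP => //.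
    exact: (mshift _ _ miw).
  + by move=> r; rewrite mule_ge0 ?lee_fin ?mulr_ge0 ?weight_ge0.
  rewrite muleC -ge0_integralZl_EFin//; last 2 first.
  + by move=> r _; rewrite lee_fin mulr_ge0// weight_ge0.
  + exact: weight_ge0.
  rewrite [leRHS]integral_mkcond; apply: ge0_le_integral => //.
  + by move=> r _; rewrite mule_ge0 ?lee_fin ?mulr_ge0 ?weight_ge0.
  + apply: emeasurable_funM; apply/measurable_EFinP => //.
    exact: (mshift _ _ miw).
  + apply/measurable_restrict => //; apply: measurable_funeM; exact: mPhiw.
  move=> r _; rewrite patchE /g; have [r0|r0] := leP r 0%R.
    rewrite Phi_le0// mule0; case: ifPn => // _.
    by rewrite mule_ge0 ?lee_fin ?mulr_ge0 ?weight_ge0.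
  have [rT|rT] := boolP (r \in `]0%R, T]%classic).
    rewrite -!EFinM lee_fin mulrA ler_wpM2r// /weight -expRD.
    rewrite (_ : - (b * u) + - (b * r) = - (b * (r + u)))%R; last by ring.
    by rewrite ler_piMl ?expR_ge0// /ind indicE; case: (_ \in _).
  rewrite /ind indicE memNset ?mul0r ?mul0e//=.
  move/negP : rT => rT; rewrite in_itv/= => /andP[_ ruT]; apply: rT.
  by rewrite inE/= in_itv/= r0/= (le_trans _ ruT)// lerDl ltW.
(* Outside []0, T]] the integrand is 0: for [u <= 0] by the cut in [M'], for [u > T] because
   [s <= T] makes [s - u] negative. *)
rewrite integral0_eq// => s _; rewrite /F/=.
have [u0|u0] := leP u 0%R.
  by rewrite /M' patchE memNset ?mule0//= in_itv/= ltNge u0.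
rewrite /ind indicE; have [sT|sT] := boolP (s \in _); last by rewrite mul0r mul0e.
rewrite Phi_le0 ?mul0e ?mule0//.
move/negP : uT => uT; rewrite leNgt; apply/negP => su; apply: uT.
move: sT; rewrite !inE/= !in_itv/= u0/= => /andP[_ sT].
by rewrite (le_trans _ sT)// -subr_ge0 ltW.
Qed.

(** Dominated convergence along integer rates: at each [r > 0] the weights decrease to 0, and [Phi]
    dominates. The bound 1/2 becomes the contraction ratio, so that the geometric series of the
    iteration sums to 2. *)
Lemma small_weight T : (0 <= T)%R -> leb.-integrable `]0%R, T] (EFin \o Phi) ->
  exists b : R, (0 <= b)%R /\ \int[leb]_(r in `]0%R, T]) (weight b r * Phi r)%:E <= (2^-1)%:E.
Proof.
move=> T0 iPhi.
have mw n : measurable_fun `]0%R, T] (fun r => (weight n%:R r * Phi r)%:E).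
  apply: measurable_funTS; apply/measurable_EFinP; apply: measurable_funM => //.
  exact: measurable_weight.
have [||||_ _] := @dominated_convergence _ _ _ leb `]0%R, T] (measurable_itv _)
  (fun n r => (weight n%:R r * Phi r)%:E) (cst 0) (EFin \o Phi) mw.
- exact: measurable_cst.
- apply: aeW => r /=; rewrite in_itv/= => /andP[r0 _].
  apply: cvg_EFin; first exact: nearW.
  rewrite -(mul0r (Phi r)); apply: cvgMl.
  rewrite (_ : (fun n => _) = (fun n => expR (- r) ^+ n)%R).
    by apply: cvg_expr; rewrite ger0_norm ?expR_ge0// -expR0 ltr_expR oppr_lt0.
  by apply/funext => n; rewrite /weight -mulrN expRM_natl.
- exact: iPhi.
- apply: aeW => r n /=; rewrite in_itv/= => /andP[r0 _].
  rewrite lee_fin ger0_norm; last by rewrite mulr_ge0// weight_ge0.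
  by rewrite ler_piMl// /weight -expR0 ler_expR oppr_le0 mulr_ge0// ltW.
rewrite integral0 => cv.
have /cv[n _ /(_ n (leqnn n)) /= h] :
    nbhs (0 : \bar R) [set x | x < (2^-1)%:E].
  apply: open_nbhs_nbhs; split; first exact: open_ereal_lt_ereal.
  by rewrite /= lte_fin invr_gt0.
by exists n%:R%R; split => //; exact: ltW.
Qed.

End convolution.

(** * Thinning by a predictable intensity *)

Section thinning.
Context d (Omega : measurableType d) (R : realType).
Variable P : probability Omega R.
Variables (G : R -> set (set Omega)) (N : Omega -> {measure set (R * R) -> \bar R}).
Hypotheses (hG : filtration G) (hN : compensated P G N).
Local Open Scope ereal_scope.
Local Notation predT := (g_sigma_algebraType (pred_rect G (@id R))).
Local Notation markT := (g_sigma_algebraType (pred_rect G (@fst R R))).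
Implicit Types (l : Omega * R -> R) (K : R -> R).

Definition below l (w : Omega) (y : R * R) : R :=
  if (y.2 <= l (w, y.1))%R then 1%R else 0%R.

Definition past n (x : Omega * R) : set (R * R) :=
  [set y | (0 < y.1 < x.2)%R /\ (0 <= y.2 <= n%:R)%R].

Definition tame_past := tame (fun x : Omega * R => N x.1) past.

(** The shot noise at time [s] of the points of [N] under the graph of [l]. The time interval is
    open at [s], which makes it predictable; where the integral is infinite, [fine] gives 0. *)
Definition shot K l (x : Omega * R) : R :=
  if tame_past x then
    fine (\int[N x.1]_(y in \bigcup_n past n x) (K (x.2 - y.1) * below l x.1 y)%:E)
  else 0%R.

Lemma bigcup_past x : \bigcup_n past n x = [set y | (0 < y.1 < x.2)%R /\ (0 <= y.2)%R].
Proof.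
apply/seteqP; split=> [y [n _ [? /andP[]]]//|[u z] [/= us z0]].
exists (Num.truncn z).+1 => //; split => //=; rewrite z0/=.
exact: ltW (truncnS_gt _).
Qed.

Lemma measurable_past n x : measurable (past n x).
Proof.
rewrite (_ : past n x = `]0%R, x.2[ `*` `[0%R, n%:R]); first exact: measurableX.
by apply/seteqP; split=> y /=; rewrite !in_itv/=.
Qed.

Lemma nondecreasing_past x : nondecreasing_seq (past ^~ x).
Proof.
move=> a b ab; apply/subsetPset => y [yx /andP[y0 ya]]; split => //.
by rewrite y0 (le_trans ya)// ler_nat.
Qed.

Lemma predictable_noise_past n B : measurable B ->
  measurable_fun [set: predT] (fun x => N x.1 (B `&` past n x)).
Proof.
move=> mB; have [_ mN _ _] := hN.
have mBn : measurable (B `&` (setT `*` `[0%R, n%:R])).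
  by apply: measurableI => //; exact: measurableX.
rewrite (_ : (fun x => _) = (fun x : Omega * R =>
  N x.1 ((B `&` (setT `*` `[0%R, n%:R])) `&` [set y | (0 < y.1 < x.2)%R]))); last first.
  apply/funext => x; congr (N x.1 _); apply/seteqP; split => y /=; rewrite in_itv/=.
    by move=> [By [yx yn]].
  by move=> [[By [_ yn]] yx].
apply: (@predictable_measure_before _ _ _ _ hG _ _ (@fst R R)) => //.
move=> q q0; apply: mN => //.
  apply: measurableI => //; rewrite (_ : [set _ | _] = `]0%R, q] `*` setT).
    exact: measurableX.
  by apply/seteqP; split => y /=; rewrite in_itv/=; [move=> ->|move=> [->]].
move=> y /= [[_ [_]]]; rewrite in_itv/= => /andP[y0 _] /andP[/ltW u0 uq].
by split; rewrite /= in_itv/= ?y0 ?u0.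
Qed.

Lemma below_ge0 l w y : (0 <= below l w y)%R.
Proof. by rewrite /below; case: ifP. Qed.

Lemma measurable_before_below l : measurable_fun [set: predT] l ->
  measurable_fun [set x : predT * (R * R) | (0 < x.2.1 < x.1.2)%R]
    (fun x => below l x.1.1 x.2).
Proof.
move=> ml mW; have mfst : measurable_fun [set: R * R] (@fst R R) by [].
have mb := measurable_before hG mfst.
have mlW : measurable_fun [set x : predT * (R * R) | (0 < x.2.1 < x.1.2)%R]
    (fun x => l (x.1.1, x.2.1)).
  have := @measurable_comp _ _ _ _ _ _ [set: predT] l _ _ measurableT (fun _ _ => I) ml mb.
  exact.
move: (mW); apply: measurable_fun_if => //.
by apply: measurable_fun_ler => //; apply: measurable_funTS; exact: measurableT_comp.
Qed.

Lemma predictable_below l : measurable_fun [set: predT] l ->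
  measurable_fun [set: markT] (fun x => below l x.1 x.2).
Proof.
move=> ml; apply: measurable_fun_if => //; apply: measurable_fun_ler.
  exact: (@predictable_snd _ _ _ _ hG _ _ _ _ R (@snd R R)).
have mfst : measurable_fun [set: R * R] (@fst R R) by [].
exact: (predictable_time mfst ml).
Qed.

Lemma predictable_shot K l : measurable_fun setT K -> measurable_fun [set: predT] l ->
  measurable_fun [set: predT] (shot K l).
Proof.
move=> mK ml.
pose W := [set x : predT * (R * R) | (0 < x.2.1 < x.1.2)%R].
pose F (x : predT * (R * R)) : \bar R := (K (x.1.2 - x.2.1) * below l x.1.1 x.2)%:E.
have mtime : measurable_fun [set: predT * (R * R)] (fun x => x.1.2 : R).
  apply: (@measurableT_comp _ _ _ _ _ _ (fun x : predT => x.2)) => //.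
  exact: (@predictable_snd _ _ _ _ hG _ R id _ R id).
have mage : measurable_fun [set: predT * (R * R)] (fun x => x.2.1 : R).
  exact: measurableT_comp.
have mW : measurable W.
  rewrite (_ : W = [set x | (0 < x.2.1)%R] `&` [set x | (x.2.1 < x.1.2)%R]).
    apply: measurableI.
      have := measurable_fun_ltr (@measurable_cst _ _ (predT * (R * R))%type R setT 0%R) mage.
      by move=> /(_ measurableT [set true]); rewrite setTI; exact.
    have := measurable_fun_ltr mage mtime.
    by move=> /(_ measurableT [set true]); rewrite setTI; exact.
  by rewrite /W; apply/seteqP; split=> x /=; [move=> /andP|move=> [-> ->]].
have mF : measurable_fun W F.
  apply/measurable_EFinP; apply: measurable_funM; last exact: measurable_before_below.
  apply: measurable_funTS; apply: measurableT_comp => //.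
  exact: measurable_funB.
(* Joint measurability of [below l] is available only where the mark precedes the current time. The
   integrand is therefore cut to [W], which contains all marks of every [past n x]. *)
have := @measurable_fun_integral_tame _ _ _ _ _ (fun x : predT => N x.1) past
   measurable_past nondecreasing_past predictable_noise_past (F \_ W).
have mFW : measurable_fun [set: predT * (R * R)] (F \_ W).
  by apply/measurable_restrict => //; apply: measurable_funS mF => // x [].
move=> /(_ mFW) h; rewrite /shot; apply: measurable_fun_if => //.
- have := @measurable_fun_tame _ _ _ _ _ (fun x : predT => N x.1) past predictable_noise_past.
  exact.
- apply: (eq_measurable_fun (fun x : predT => fine (if tame_past x then
     \int[N x.1]_(y in \bigcup_n past n x) (F \_ W) (x, y) else 0))).
    move=> x; rewrite inE/= => -[_ /= tx]; rewrite tx; congr fine.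
    apply: eq_integral => y; rewrite bigcup_past inE/= => -[xy _].
    by rewrite patchE mem_set.
  by apply: measurable_funTS; apply: measurableT_comp => //; exact: h.
Qed.

Lemma good_tame_past w s : good N w -> tame_past (w, s).
Proof.
move=> /asboolP gw; apply/asboolP => n.
pose m := maxn n (Num.truncn s).+1.
apply: le_lt_trans (gw m); apply: le_measure; rewrite ?inE.
- exact: measurable_past.
- exact: measurable_box.
move=> y [/andP[y0 ys] /andP[z0 zn]].
have nm : (n%:R <= m%:R :> R)%R by rewrite ler_nat leq_maxl.
have sm : (s <= m%:R :> R)%R.
  by rewrite (le_trans (ltW (truncnS_gt _)))// ler_nat leq_maxr.
split; rewrite /= in_itv/=.
  by rewrite y0 (le_trans (ltW ys)).
by rewrite z0 (le_trans zn).
Qed.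

(* Intensities are arbitrary reals; only their positive parts matter, since the
   marks are nonnegative. *)
Definition gap l l' (x : Omega * R) : R := `|Num.max (l x) 0 - Num.max (l' x) 0|%R.

Lemma gap_ge0 l l' x : (0 <= gap l l' x)%R. Proof. exact: normr_ge0. Qed.

Definition mean_gap l l' (u : R) : \bar R := \int[P]_w (gap l l' (w, u))%:E.

Lemma mean_gap_ge0 l l' u : 0 <= mean_gap l l' u.
Proof. by apply: integral_ge0 => w _; rewrite lee_fin /gap. Qed.

Lemma measurable_gap l l' : measurable_fun [set: predT] l ->
  measurable_fun [set: predT] l' ->
  measurable_fun [set: Omega * R] (fun x => (gap l l' x)%:E : \bar R).
Proof.
move=> /predictable_measurable ml /predictable_measurable ml'.
apply/measurable_EFinP; apply: measurableT_comp => //.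
apply: measurable_funB; apply: measurable_maxr => //; [exact: ml|exact: ml'].
Qed.

Lemma measurable_mean_gap l l' : measurable_fun [set: predT] l ->
  measurable_fun [set: predT] l' -> measurable_fun setT (mean_gap l l').
Proof.
move=> ml ml'.
have := measurable_fun_fubini_tonelli_G (m1 := P) _ (measurable_gap ml ml') (fun x => ltac:(by rewrite lee_fin gap_ge0)).
exact.
Qed.

(** Once [a <= b], the integrand is the indicator of []a, b]]; marks start at 0, which produces the
    positive parts. *)
Lemma integral_below_gap (a b : R) :
  \int[leb]_(z in `[0%R, +oo[)
    `|(if (z <= a)%R then 1%R else 0%R) - (if (z <= b)%R then 1%R else 0%R)|%:E =
  `|Num.max a 0 - Num.max b 0|%:E :> \bar R.
Proof.
wlog ab : a b / (a <= b)%R => [h|].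
  have [ab|ba] := leP a b; first exact: h.
  rewrite distrC -h//; last exact: ltW.
  by apply: eq_integral => z _; rewrite distrC.
transitivity (\int[leb]_(z in `[0%R, +oo[) (\1_(`]a, b]%classic) z)%:E : \bar R).
  apply: eq_integral => z; rewrite inE/= in_itv/= andbT => z0.
  rewrite indicE; have [za|az] := leP z a.
    rewrite (le_trans za ab) subrr normr0 memNset//=.
    by rewrite in_itv/= ltNge za.
  have [zb|bz] := leP z b.
    by rewrite sub0r normrN1 mem_set//= in_itv/= az.
  rewrite subrr normr0 memNset//= in_itv/= az/=.
  by rewrite leNgt bz.
rewrite integral_indic//.
have [b0|b0] := ltP b 0%R.
  rewrite (max_r (le_trans ab (ltW b0))) subrr normr0.
  rewrite (_ : _ `&` _ = set0) ?measure0// -subset0 => z [] /=.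
  by rewrite !in_itv/= andbT => /andP[_ zb] /le_lt_trans /(_ (le_lt_trans zb b0)); rewrite ltxx.
have [a0|a0] := leP 0%R a.
  rewrite (setIidl _); last first.
    by move=> z /=; rewrite !in_itv/= andbT => /andP[/ltW/(le_trans a0)].
  rewrite -[LHS]/(lebesgue_measure `]a, b]%classic) lebesgue_measure_itv/= lte_fin.
  rewrite ler0_norm ?subr_le0//; case: ltP => [_|ba]; first by rewrite -EFinD opprB.
  by rewrite (@le_anti _ _ a b) ?ab// subrr oppr0.
rewrite (_ : _ `&` _ = `[0%R, b]%classic); last first.
  apply/seteqP; split=> z /=; rewrite !in_itv/= andbT.
    by move=> [/andP[_ ->] ->].
  by move=> /andP[z0 ->]; rewrite (lt_le_trans a0).
rewrite -[LHS]/(lebesgue_measure `[0%R, b]%classic) lebesgue_measure_itv/= lte_fin.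
rewrite sub0r normrN ger0_norm//; case: ltP => [_|ba]; first by rewrite oppr0 adde0.
by rewrite (@le_anti _ _ b 0%R) ?ba.
Qed.

(** Compensation replaces points by area, the length of the slice between the two graphs at time [u]
    is the gap, and Tonelli exchanges [w] and [u]. *)
Lemma mean_strip_gap (k : R -> R) l l' : measurable_fun setT k -> (forall u, (0 <= k u)%R) ->
  measurable_fun [set: predT] l -> measurable_fun [set: predT] l' ->
  \int[P]_w strip_integral N
     (fun x => (k x.2.1 * `|below l x.1 x.2 - below l' x.1 x.2|)%:E) w =
  \int[leb]_(u in `]0%R, +oo[) ((k u)%:E * mean_gap l l' u).
Proof.
move=> mk k0 ml ml'.
rewrite (compensation hG hN); last 2 first.
- by move=> x; rewrite lee_fin mulr_ge0.
- apply/measurable_EFinP; apply: measurable_funM.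
    exact: (@predictable_snd _ _ _ _ hG _ _ _ _ R (fun y : R * R => k y.1)
      (measurableT_comp mk (@measurable_fst _ _ R R))).
  apply: measurableT_comp => //; apply: measurable_funB; exact: predictable_below.
pose F (x : Omega * R) : \bar R :=
  ((k \_ `]0%R, +oo[) x.2)%:E * (gap l l' x)%:E.
have k'0 u : (0 <= (k \_ `]0%R, +oo[) u)%R by rewrite patchE; case: ifPn.
have mk' : measurable_fun setT (k \_ `]0%R, +oo[).
  by apply/measurable_restrict => //; exact: measurable_funTS.
have F0 x : 0 <= F x by rewrite /F mule_ge0// lee_fin// /gap.
have mF : measurable_fun setT F.
  apply: emeasurable_funM; last exact: measurable_gap.
  by apply/measurable_EFinP; exact: measurableT_comp.
transitivity (\int[P]_w \int[leb]_u F (w, u)).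
  apply: eq_integral => w _.
  have mlw : measurable_fun setT (fun u => l (w, u)) by exact: (predictable_section hG w ml).
  have ml'w : measurable_fun setT (fun u => l' (w, u)) by exact: (predictable_section hG w ml').
  have mbl (f : R -> R) : measurable_fun setT f ->
      measurable_fun [set: R * R] (fun y => if (y.2 <= f y.1)%R then 1%R else 0%R : R).
    move=> mf; apply: measurable_fun_if => //; apply: measurable_fun_ler => //.
    exact: measurableT_comp.
  pose H (y : R * R) : \bar R := (k y.1 * `|below l w y - below l' w y|)%:E.
  have mH : measurable_fun setT H.
    apply/measurable_EFinP; apply: measurable_funM; first exact: measurableT_comp.
    apply: measurableT_comp => //; apply: measurable_funB.
      exact: (mbl (fun u => l (w, u))).
    exact: (mbl (fun u => l' (w, u))).
  rewrite integral_mkcond/= (@fubini_tonelli1 _ _ _ _ _ leb leb (H \_ (@strip R))); last 2 first.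
  - by apply/measurable_restrict; [exact: measurable_strip|by []|exact: measurable_funTS].
  - by move=> y; rewrite patchE; case: ifPn => // _; rewrite lee_fin mulr_ge0.
  apply: eq_integral => u _; rewrite /fubini_F/= /F/= patchE.
  case: ifPn => [|u0].
    rewrite inE/= in_itv/= andbT => u0.
    transitivity (\int[leb]_(z in `[0%R, +oo[) ((k u)%:E *
      `|(if (z <= l (w, u))%R then 1%R else 0%R) - (if (z <= l' (w, u))%R then 1%R else 0%R)|%:E)).
      rewrite [RHS]integral_mkcond; apply: eq_integral => z _; rewrite !patchE /strip.
      have -> : ((u, z) \in (@strip R)) = (z \in (`[0%R, +oo[%classic : set R)).
        by apply/idP/idP; rewrite !inE/= in_itv/= andbT => // -[].
      by case: ifPn.
    rewrite ge0_integralZl_EFin//; first by rewrite integral_below_gap.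
    apply/measurable_EFinP; apply: measurableT_comp => //.
    have mb1 a : measurable_fun (`[0%R, +oo[%classic : set R)
        (fun z : R => if (z <= a)%R then 1%R else 0%R : R).
      apply: measurable_funTS; apply: measurable_fun_if => //.
      exact: measurable_fun_ler.
    exact: measurable_funB.
  rewrite mul0e integral0_eq// => z _; rewrite patchE memNset// => -[/= u1 _].
  by move/negP : u0; apply; rewrite inE/= in_itv/= andbT.
rewrite (@fubini_tonelli _ _ _ _ _ P leb F)// [RHS]integral_mkcond.
apply: eq_integral => u _; rewrite /F/= ge0_integralZl_EFin//; last 2 first.
- by move=> w _; rewrite lee_fin gap_ge0.
- exact: (measurable_fun_pair1 u (measurable_gap ml ml')).
rewrite !patchE.
by case: ifPn => // _; rewrite mul0e.
Qed.

(** The total variation attached to a difference of two shots. Against [cst (-1)], below which no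
    mark of the strip lies, it bounds the absolute integral behind a single shot. *)
Definition jump_mass K l l' s w :=
  strip_integral N (fun x => (`|K (s - x.2.1)| * `|below l x.1 x.2 - below l' x.1 x.2|)%:E) w.

Lemma jump_mass_ge0 K l l' s w : 0 <= jump_mass K l l' s w.
Proof.
rewrite /jump_mass /strip_integral; case: ifP => // _.
by apply: integral_ge0 => y _; rewrite lee_fin mulr_ge0.
Qed.

Lemma measurable_belowR l w : measurable_fun [set: predT] l ->
  measurable_fun setT (below l w).
Proof.
move=> ml; have mlw := predictable_section hG w ml.
apply: measurable_fun_if => //; apply: measurable_fun_ler => //.
exact: (measurableT_comp mlw (@measurable_fst _ _ R R)).
Qed.

Lemma measurable_jump_mass K l l' s : measurable_fun setT K ->
  measurable_fun [set: predT] l -> measurable_fun [set: predT] l' ->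
  measurable_fun setT (jump_mass K l l' s).
Proof.
move=> mK ml ml'; apply: (ge0_measurable_fun_strip_integral hN).
  by move=> x; rewrite lee_fin mulr_ge0.
apply/measurable_EFinP; apply: measurable_funM.
  apply: measurableT_comp => //; apply: measurableT_comp => //.
  by apply: measurable_funB => //; exact: measurableT_comp.
apply: measurableT_comp => //.
apply: measurable_funB; exact: (predictable_measurable hG (predictable_below _)).
Qed.

Lemma mean_jump_mass K l l' s : measurable_fun setT K ->
  measurable_fun [set: predT] l -> measurable_fun [set: predT] l' ->
  \int[P]_w jump_mass K l l' s w = convol (fun r => `|K r|%R) (mean_gap l l') s.
Proof.
move=> mK ml ml'.
rewrite /jump_mass (mean_strip_gap (k := fun u => `|K (s - u)|%R))//.
by apply: measurableT_comp => //; apply: measurableT_comp => //; exact: measurable_funB.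
Qed.

(** The two finiteness premises are absolute convergence: neither shot takes its default value, and
    the difference of the integrals is the integral of the difference. *)
Lemma shot_gap K l l' s w : measurable_fun setT K -> (forall r, (r <= 0)%R -> K r = 0%R) ->
  measurable_fun [set: predT] l -> measurable_fun [set: predT] l' -> good N w ->
  jump_mass K l (cst (-1)%R) s w < +oo -> jump_mass K l' (cst (-1)%R) s w < +oo ->
  `|shot K l (w, s) - shot K l' (w, s)|%:E <= jump_mass K l l' s w.
Proof.
move=> mK K0 ml ml' gw.
pose U : set (R * R) := \bigcup_n past n (w, s).
have mU : measurable U by apply: bigcupT_measurable => n; exact: measurable_past.
have US : U `<=` @strip R.
  by rewrite /U bigcup_past => y [/= /andP[y0 _] ?].
have mf (f : Omega * R -> R) : measurable_fun [set: predT] f ->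
    measurable_fun setT (fun y : R * R => K (s - y.1) * below f w y)%R.
  move=> mf; apply: measurable_funM; last exact: measurable_belowR.
  by apply: measurableT_comp => //; apply: measurable_funB => //; exact: measurable_fst.
have ifin f : measurable_fun [set: predT] f -> jump_mass K f (cst (-1)%R) s w < +oo ->
    (N w).-integrable U (EFin \o (fun y : R * R => K (s - y.1) * below f w y)%R).
  move=> mfw; rewrite /jump_mass /strip_integral gw => h.
  apply/integrableP; split.
    by apply: measurable_funTS; apply/measurable_EFinP; exact: mf.
  apply: le_lt_trans h.
  apply: (@le_trans _ _ (\int[N w]_(y in @strip R) `|(K (s - y.1) * below f w y)%:E|)).
    apply: ge0_subset_integral => //; first exact: measurable_strip.
    apply: measurable_funTS; apply: measurableT_comp => //.
    by apply/measurable_EFinP; exact: mf.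
  rewrite le_eqVlt; apply/orP; left; apply/eqP; apply: eq_integral => y.
  rewrite inE /strip/= => -[_ z0].
  rewrite [X in (_ * `|_ - X|)%R](_ : _ = 0%R) ?subr0 ?normrM//.
  by rewrite /below/= ifF//; apply/negbTE; rewrite -ltNge (lt_le_trans _ z0)// oppr_lt0.
move=> /(ifin l ml) il /(ifin l' ml') il'.
rewrite /shot good_tame_past//=.
rewrite -[X in `|X - _|%R]/(Rintegral (N w) U _) -[X in `|_ - X|%R]/(Rintegral (N w) U _).
rewrite -RintegralB//.
have iB := integrableB mU il il'.
apply: (@le_trans _ _ (\int[N w]_(y in U) `|(K (s - y.1) * below l w y - K (s - y.1) * below l' w y)%:E|)).
  rewrite /Rintegral -abse_EFin fineK; last exact: integrable_fin_num.
  apply: le_abse_integral => //.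
  by apply: measurable_funTS; apply/measurable_EFinP; apply: measurable_funB; exact: mf.
rewrite /jump_mass /strip_integral gw.
apply: (@le_trans _ _ (\int[N w]_(y in U) (`|K (s - y.1)| * `|below l w y - below l' w y|)%:E)).
  rewrite le_eqVlt; apply/orP; left; apply/eqP; apply: eq_integral => y _.
  by rewrite -mulrBr/= normrM.
apply: ge0_subset_integral => //; first exact: measurable_strip.
- apply: measurable_funTS; apply/measurable_EFinP; apply: measurable_funM.
    apply: measurableT_comp => //; apply: measurableT_comp => //.
    by apply: measurable_funB => //; exact: measurable_fst.
  by apply: measurableT_comp => //; apply: measurable_funB; exact: measurable_belowR.
Qed.

Lemma shot_below0 K s w l : (forall x, (l x < 0)%R) -> shot K l (w, s) = 0%R.
Proof.
move=> l0; rewrite /shot; case: ifP => // _; rewrite integral0_eq// => y.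
rewrite bigcup_past => -[_ z0]; rewrite /below ifF ?mulr0//.
by apply/negbTE; rewrite -ltNge (lt_le_trans (l0 _)).
Qed.

End thinning.

Lemma le_term_esum (R : realType) (T : choiceType) (A : set T) (a : T -> \bar R) i :
  (forall j, A j -> 0 <= a j)%E -> A i -> (a i <= \esum_(j in A) a j)%E.
Proof.
move=> a0 Ai; rewrite (esumID [set i])// (_ : A `&` [set i] = [set i]); last first.
  by apply/seteqP; split=> [j []//|j ->].
rewrite esum_set1 ?a0// leeDl//; apply: esum_ge0 => j [Aj _]; exact: a0.
Qed.

Lemma esumZr_le (R : realType) (T : choiceType) (A : set T) (a : T -> \bar R) (M : \bar R) :
  (forall j, A j -> 0 <= a j)%E -> (0 <= M)%E ->
  (\esum_(j in A) (a j * M) <= (\esum_(j in A) a j) * M)%E.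
Proof.
move=> a0 M0; apply: ge_ereal_sup => _ [X [finX XA] <-].
have e : (\sum_(j \in X) (a j * M) = (\sum_(j \in X) a j) * M)%E.
  rewrite !fsbig_finite//= !big_seq ge0_sume_distrl// => j.
  by rewrite in_fset_set// inE => /XA/a0.
by rewrite e; apply: lee_wpmul2r => //; apply: ereal_sup_ubound; exists X.
Qed.

Lemma lipschitz_measurable (R : realType) (f : R -> R) (c : R) :
  (forall x y, `|f x - f y| <= c * `|x - y|) -> measurable_fun setT f.
Proof.
move=> fc; apply: continuous_measurable_fun => x.
(* The sign of [c] is not known, and a positive constant is wanted for the division. *)
have c1 : 0 < Num.max c 1 by rewrite lt_max ltr01 orbT.
apply/cvgrPdist_le => e e0; near=> y.
apply: le_trans (fc _ _) _.
apply: (@le_trans _ _ (Num.max c 1 * `|x - y|)).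
  by apply: ler_wpM2r => //; rewrite le_max lexx.
rewrite -ler_pdivlMl//; near: y.
by apply: cvgr_dist_le => //; rewrite mulr_gt0 ?invr_gt0.
Unshelve. all: by end_near. Qed.

Lemma ae_countable d (T : measurableType d) (R : realType) (mu : {measure set T -> \bar R})
    (S : countType) (Q : S -> T -> Prop) :
  (forall j, {ae mu, forall w, Q j w}) -> {ae mu, forall w, forall j, Q j w}.
Proof.
move=> aeQ.
have : {ae mu, forall w, forall n, if unpickle n is Some j then Q j w else True}.
  apply/ae_foralln => n; case: (unpickle n) => [j|]; first exact: aeQ.
  by apply: filterE.
by apply: filterS => w Qw j; have := Qw (pickle j); rewrite pickleK.
Qed.

Lemma lty_pmull (R : realType) (a : R) (x : \bar R) :
  0 < a -> (0 <= x)%E -> (a%:E * x < +oo)%E -> (x < +oo)%E.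
Proof.
move=> a0; case: x => [r _ _|_|//]; first by rewrite ltry.
by rewrite gt0_muley ?lte_fin// ltxx.
Qed.

(** * The Picard map and its fixed point *)

Section system.
Context d (Omega : measurableType d) (R : realType) (S : countType).
Variables (P : probability Omega R) (G : R -> set (set Omega)) (E : set (S * S)).
Variable N : S -> Omega -> {measure set (R * R) -> \bar R}.
Variables (K : S -> S -> R -> R) (h : S -> R -> R) (c p : S -> R) (Phi : R -> R).
Hypotheses (hG : filtration G) (hN : forall i, compensated P G (N i)).
Hypotheses (mK : forall j i, E (j, i) -> measurable_fun setT (K j i))
  (K_le0 : forall j i r, r <= 0 -> K j i r = 0).
Hypotheses (c_ge0 : forall i, 0 <= c i) (p_gt0 : forall i, 0 < p i).
Hypotheses (Phi_ge0 : forall r, 0 <= Phi r) (mPhi : measurable_fun setT Phi).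
Hypothesis h_ge0 : forall i x, 0 <= h i x.
Hypothesis h_lip : forall i x y, `|h i x - h i y| <= c i * `|x - y|.
Hypothesis KPhi : forall r j,
  (\esum_(i in [set i | E (j, i)]) (c i * p i * `|K j i r|)%:E <= (p j * Phi r)%:E)%E.
Local Open Scope ereal_scope.
Local Notation predT := (g_sigma_algebraType (pred_rect G (@id R))).
Implicit Types lam : S -> Omega * R -> R.

Definition predictable lam := forall i, measurable_fun [set: predT] (lam i).

Definition drive lam (i : S) (x : Omega * R) : R :=
  countable_sum [set j | E (j, i)] (fun j => shot (N j) (K j i) (lam j) x).

Definition picard lam (i : S) (x : Omega * R) : R := h i (drive lam i x).

(* A negative intensity produces no point, so [dist lam off] is the weighted mean
   of [lam]. *)
Definition off : S -> Omega * R -> R := fun _ _ => (-1)%R.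

Definition dist lam lam' (s : R) : \bar R :=
  \esum_(i in [set: S]) ((p i)%:E * mean_gap P (lam i) (lam' i) s).

Lemma picardE lam i x : picard lam i x = h i (drive lam i x). Proof. by []. Qed.

Lemma distE lam lam' :
  dist lam lam' = fun s => \esum_(i in [set: S]) ((p i)%:E * mean_gap P (lam i) (lam' i) s).
Proof. by []. Qed.

Lemma off_lt0 i x : (off i x < 0)%R. Proof. exact: ltrN10. Qed.

Lemma predictable_off : predictable off.
Proof. by move=> i; exact: measurable_cst. Qed.

Lemma predictable_picard lam : predictable lam -> predictable (picard lam).
Proof.
move=> ml i; apply: measurableT_comp; first exact: lipschitz_measurable (h_lip i).
apply: measurable_countable_sum => j Eji.
by apply: (predictable_shot hG (hN j)) => //; exact: mK.
Qed.

Lemma dist_ge0 lam lam' s : 0 <= dist lam lam' s.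
Proof.
by apply: esum_ge0 => i _; rewrite mule_ge0 ?mean_gap_ge0// lee_fin ltW.
Qed.

Lemma measurable_dist lam lam' : predictable lam -> predictable lam' ->
  measurable_fun setT (dist lam lam').
Proof.
move=> ml ml'; apply: measurable_fun_esum => //.
  by move=> i s _ _; rewrite mule_ge0 ?mean_gap_ge0// lee_fin ltW.
by move=> i _; apply: measurable_funeM; exact: (measurable_mean_gap P hG (ml i) (ml' i)).
Qed.

Let absK j i (r : R) : R := `|K j i r|%R.

Let absK_ge0 j i r : (0 <= absK j i r)%R. Proof. exact: normr_ge0. Qed.

Let mabsK j i : E (j, i) -> measurable_fun setT (absK j i).
Proof. by move=> Eji; apply: measurableT_comp => //; exact: mK. Qed.

Lemma mshift (f : R -> R) (s : R) : measurable_fun setT f ->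
  measurable_fun setT (fun u : R => f (s - u))%R.
Proof. by move=> mf; apply: measurableT_comp => //; exact: measurable_funB. Qed.

(** Exchanging the sums over the edges leaves, for each source [j], the sum of [c i * p i * |K j i|]
    over its targets, and [KPhi] bounds it by [p j * Phi]. All terms are nonnegative, so Tonelli
    applies without further conditions. *)
Lemma sum_convol (m : S -> R -> \bar R) s :
  (forall j, measurable_fun setT (m j)) -> (forall j u, 0 <= m j u) ->
  \esum_(i in [set: S]) ((p i)%:E * ((c i)%:E *
     \esum_(j in [set j | E (j, i)]) convol (absK j i) (m j) s)) <=
  convol Phi (fun u => \esum_(j in [set: S]) ((p j)%:E * m j u)) s.
Proof.
move=> mm m0.
have cv0 j i : 0 <= convol (absK j i) (m j) s by exact: convol_ge0.
have p0 i : (0 <= p i)%R by exact: ltW.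
rewrite (eq_esum (b := fun i => \esum_(j in [set j | E (j, i)])
    ((c i * p i)%:E * convol (absK j i) (m j) s))); last first.
  move=> i _; rewrite muleA -EFinM -esumZl//; last by rewrite mulr_ge0.
  by apply: eq_esum => j _; rewrite mulrC.
have sw := @esum_swap R S S E (fun i j => (c i * p i)%:E * convol (absK j i) (m j) s).
have cp0 i : 0 <= (c i * p i)%:E by rewrite lee_fin; exact: mulr_ge0.
rewrite {}sw; last by move=> i j; exact: mule_ge0 (cp0 i) (cv0 j i).
have pm0 j u : 0 <= (p j)%:E * m j u.
  by apply: mule_ge0; [rewrite lee_fin; exact: p0|exact: m0].
have Ppm0 j u : 0 <= (Phi (s - u))%:E * ((p j)%:E * m j u).
  by apply: mule_ge0; [rewrite lee_fin; exact: Phi_ge0|exact: pm0].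
have -> : convol Phi (fun u => \esum_(j in [set: S]) ((p j)%:E * m j u)) s =
    \int[leb]_(u in `]0%R, +oo[) (\esum_(j in [set: S]) ((Phi (s - u))%:E * ((p j)%:E * m j u))).
  apply: eq_integral => u _; rewrite esumZl//; exact: Phi_ge0.
rewrite integral_esum//; last first.
  move=> j _; apply: emeasurable_funM.
    by apply: measurable_funTS; apply/measurable_EFinP; exact: mshift.
  by apply: measurable_funTS; apply: measurable_funeM; exact: mm.
rewrite /convol; apply: le_esum => j _.
have mint i : E (j, i) -> measurable_fun (`]0%R, +oo[%classic : set R)
    (fun u : R => (c i * p i)%:E * ((absK j i (s - u))%:E * m j u)).
  move=> Eji; apply: measurable_funeM; apply: emeasurable_funM.
    by apply: measurable_funTS; apply/measurable_EFinP; apply: mshift; exact: mabsK.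
  exact: measurable_funTS.
have Km0 i u : 0 <= (absK j i (s - u))%:E * m j u.
  by apply: mule_ge0; [rewrite lee_fin; exact: absK_ge0|exact: m0].
have nn i u : 0 <= (c i * p i)%:E * ((absK j i (s - u))%:E * m j u).
  exact: mule_ge0 (cp0 i) (Km0 i u).
rewrite (eq_esum (b := fun i => \int[leb]_(u in `]0%R, +oo[)
   ((c i * p i)%:E * ((absK j i (s - u))%:E * m j u)))); last first.
  move=> i Eji; rewrite ge0_integralZl_EFin//.
  - apply: emeasurable_funM; last exact: measurable_funTS.
    by apply: measurable_funTS; apply/measurable_EFinP; apply: mshift; exact: mabsK.
  - by rewrite mulr_ge0.
rewrite -integral_esum//.
apply: ge0_le_integral => //.
- by move=> u _; apply: esum_ge0.
- exact: measurable_fun_esum.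
- apply: emeasurable_funM.
    by apply: measurable_funTS; apply/measurable_EFinP; exact: mshift.
  by apply: measurable_funTS; exact: measurable_funeM.
move=> u _.
rewrite (eq_esum (b := fun i => (c i * p i * `|K j i (s - u)|)%:E * m j u)); last first.
  by move=> i _; rewrite muleA -EFinM.
apply: (@le_trans _ _ ((\esum_(i in [set i | E (j, i)])
     (c i * p i * `|K j i (s - u)|)%:E) * m j u)).
  apply: esumZr_le => // i _; rewrite lee_fin; apply: mulr_ge0 => //; exact: mulr_ge0.
by rewrite muleA -EFinM mulrC; apply: lee_wpmul2r.
Qed.

(** Finite means give almost surely finite sums of jump masses against [off], hence absolutely
    convergent drives; the Lipschitz bound of [h i] and [shot_gap] then hold path by path, and
    [mean_jump_mass] evaluates the resulting mean. *)
Lemma mean_picard_gap lam lam' i s : predictable lam -> predictable lam' ->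
  (c i)%:E * (\esum_(j in [set j | E (j, i)])
     convol (absK j i) (mean_gap P (lam j) (off j)) s) < +oo ->
  (c i)%:E * (\esum_(j in [set j | E (j, i)])
     convol (absK j i) (mean_gap P (lam' j) (off j)) s) < +oo ->
  mean_gap P (picard lam i) (picard lam' i) s <=
  (c i)%:E * (\esum_(j in [set j | E (j, i)])
     convol (absK j i) (mean_gap P (lam j) (lam' j)) s).
Proof.
move=> ml ml' fl fl'.
pose I l l' j w := jump_mass (N j) (K j i) (l j) (l' j) s w.
have I0 l l' j w : 0 <= I l l' j w by exact: jump_mass_ge0.
have mI l l' j : predictable l -> predictable l' -> E (j, i) -> measurable_fun setT (I l l' j).
  by move=> pl pl' Eji; apply: (measurable_jump_mass hG (hN j)) => //; exact: mK.
have EI l l' : predictable l -> predictable l' ->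
    \int[P]_w (\esum_(j in [set j | E (j, i)]) I l l' j w) =
    \esum_(j in [set j | E (j, i)]) convol (absK j i) (mean_gap P (l j) (l' j)) s.
  move=> pl pl'; rewrite integral_esum//; last by move=> j Eji; exact: mI.
  by apply: eq_esum => j Eji; rewrite (mean_jump_mass hG (hN j))//; exact: mK.
have mEI l l' : predictable l -> predictable l' ->
    measurable_fun setT (fun w => \esum_(j in [set j | E (j, i)]) I l l' j w).
  by move=> pl pl'; apply: measurable_fun_esum => // j Eji; exact: mI.
have hdiff w : `|Num.max (picard lam i (w, s)) 0 - Num.max (picard lam' i (w, s)) 0|%R =
    `|picard lam i (w, s) - picard lam' i (w, s)|%R.
  by rewrite (max_l (h_ge0 i _)) (max_l (h_ge0 i _)).
have mgapp : measurable_fun setT (fun w => (gap (picard lam i) (picard lam' i) (w, s))%:E : \bar R).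
  have := measurable_fun_pair1 s (measurable_gap hG (predictable_picard ml i) (predictable_picard ml' i)).
  exact.
(* For [c i = 0] the premises carry no information, as 0 times infinity is 0; but then [h i] is
   constant and the gap vanishes. *)
have [c0|c0] := eqVneq (c i) 0%R.
  rewrite c0 mul0e /mean_gap integral0_eq// => w _.
  rewrite /gap hdiff; congr EFin; apply/eqP; rewrite -normr_le0.
  by rewrite normr_id (le_trans (h_lip _ _ _))// c0 mul0r.
have cgt0 : (0 < c i)%R by rewrite lt_neqAle eq_sym c0 c_ge0.
have aefin l : predictable l -> (c i)%:E * (\esum_(j in [set j | E (j, i)])
     convol (absK j i) (mean_gap P (l j) (off j)) s) < +oo ->
    {ae P, forall w, (\esum_(j in [set j | E (j, i)]) I l off j w) < +oo}.
  move=> pl; rewrite -EI//; last exact: predictable_off.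
  move=> fin; have : P.-integrable setT (fun w => \esum_(j in [set j | E (j, i)]) I l off j w).
    apply/integrableP; split; first exact: mEI pl predictable_off.
    under eq_integral do rewrite gee0_abs ?esum_ge0//.
    have e0 : 0 <= \int[P]_w (\esum_(j in [set j | E (j, i)]) I l off j w).
      by apply: integral_ge0 => w _; exact: esum_ge0.
    exact: lty_pmull cgt0 e0 fin.
  move=> /(integrable_ae measurableT); apply: filterS => w /(_ Logic.I).
  by rewrite ge0_fin_numE// esum_ge0.
have ae_good_all : {ae P, forall w, forall j, good (N j) w}.
  by apply: ae_countable => j; exact: ae_good (hN j).
rewrite -EI// /mean_gap -ge0_integralZl_EFin//; last 2 first.
- by move=> w _; exact: esum_ge0.
- exact: mEI.
apply: ae_ge0_le_integral => //.
- by move=> w _; rewrite lee_fin gap_ge0.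
- by move=> w _; rewrite mule_ge0 ?lee_fin// esum_ge0.
- by apply: measurable_funeM; exact: mEI.
apply: filterS3 (aefin _ ml fl) (aefin _ ml' fl') ae_good_all => w fw fw' gw _.
have term l : (\esum_(j in [set j | E (j, i)]) I l off j w) < +oo ->
    forall j, E (j, i) -> I l off j w < +oo.
  move=> fin j Eji; apply: le_lt_trans fin.
  exact: (@le_term_esum _ _ _ (fun j => I l off j w)).
have shotlt l : predictable l -> (\esum_(j in [set j | E (j, i)]) I l off j w) < +oo ->
    (\esum_(j in [set j | E (j, i)]) `|shot (N j) (K j i) (l j) (w, s)|%:E) < +oo.
  move=> pl fin; apply: le_lt_trans (fin); apply: le_esum => j Eji.
  have := @shot_gap _ _ _ G (N j) hG (K j i) (l j) (off j) s w (mK Eji) (fun r => @K_le0 j i r)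
    (pl j) (predictable_off j) (gw j) (term _ fin j Eji).
  rewrite [shot _ _ (off j) _]shot_below0; last by move=> x; rewrite /off oppr_lt0.
  rewrite subr0; apply; rewrite /jump_mass /strip_integral gw.
  by rewrite integral0_eq ?ltry// => y _; rewrite subrr normr0 mulr0.
apply: (@le_trans _ _ ((c i)%:E * `|drive lam i (w, s) - drive lam' i (w, s)|%:E)).
  by rewrite /gap hdiff -EFinM lee_fin; exact: h_lip.
apply: lee_wpmul2l; first by rewrite lee_fin.
apply: le_trans (lee_esum_diff (shotlt _ ml fw) (shotlt _ ml' fw')) _.
apply: le_esum => j Eji; apply: (@shot_gap _ _ _ G (N j) hG) => //.
- exact: mK.
- exact: K_le0.
- exact: term fw j Eji.
- exact: term fw' j Eji.
Qed.

(** A finite sum of nonnegative terms has finite terms, and dividing by [p i > 0] gives the premises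
    of [mean_picard_gap] for each [i]; [sum_convol] collects the bounds. *)
Lemma dist_picard lam lam' s : predictable lam -> predictable lam' ->
  convol Phi (dist lam off) s < +oo -> convol Phi (dist lam' off) s < +oo ->
  dist (picard lam) (picard lam') s <= convol Phi (dist lam lam') s.
Proof.
move=> ml ml' fl fl'.
have mg l l' j : predictable l -> predictable l' ->
  measurable_fun setT (mean_gap P (l j) (l' j)).
  by move=> pl pl'; exact: (measurable_mean_gap P hG (pl j) (pl' j)).
have g0 (l l' : S -> Omega * R -> R) (j : S) u : 0 <= mean_gap P (l j) (l' j) u by exact: mean_gap_ge0.
have sc l l' pl pl' := @sum_convol (fun j => mean_gap P (l j) (l' j)) s
  (fun j => mg l l' j pl pl') (g0 l l').
apply: le_trans (sc _ _ ml ml'); apply: le_esum => i _.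
apply: lee_wpmul2l; first by rewrite lee_fin ltW.
have fin l : predictable l -> convol Phi (dist l off) s < +oo ->
    (c i)%:E * (\esum_(j in [set j | E (j, i)])
     convol (absK j i) (mean_gap P (l j) (off j)) s) < +oo.
  move=> pl fin.
  have t0 k : 0 <= (c k)%:E * (\esum_(j in [set j | E (j, k)])
     convol (absK j k) (mean_gap P (l j) (off j)) s).
    rewrite mule_ge0 ?lee_fin//; apply: esum_ge0 => j _; exact: convol_ge0.
  have : (p i)%:E * ((c i)%:E * (\esum_(j in [set j | E (j, i)])
     convol (absK j i) (mean_gap P (l j) (off j)) s)) < +oo.
    apply: le_lt_trans fin; apply: le_trans (sc _ _ pl predictable_off).
    apply: (@le_term_esum _ _ _ (fun i => (p i)%:E * ((c i)%:E * (\esum_(j in [set j | E (j, i)])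
     convol (absK j i) (mean_gap P (l j) (off j)) s)))) => // k _.
    by rewrite mule_ge0// lee_fin ltW.
  exact: lty_pmull (p_gt0 i) (t0 i).
by apply: mean_picard_gap => //; exact: fin.
Qed.

End system.

(** * Weighted time integrals and the triangle inequality *)

Section wint_theory.
Context (R : realType).
Implicit Types M : R -> \bar R.
Local Open Scope ereal_scope.

Lemma measurable_wint_integrand T b M : measurable_fun setT M ->
  measurable_fun (`]0%R, T]%classic : set R) (fun s : R => (weight b s)%:E * M s).
Proof.
move=> mM; apply: measurable_funTS; apply: emeasurable_funM => //.
by apply/measurable_EFinP; exact: measurable_weight.
Qed.

Lemma weight_mul_ge0 b M s : (forall s, 0 <= M s) -> 0 <= (weight b s)%:E * M s.
Proof. by move=> M0; apply: mule_ge0; [rewrite lee_fin; exact: weight_ge0|]. Qed.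

Lemma wint_ge0 T b M : (forall s, 0 <= M s) -> 0 <= wint T b M.
Proof. by move=> M0; apply: integral_ge0 => s _; exact: weight_mul_ge0. Qed.

Lemma le_wint T b M M' : measurable_fun setT M -> measurable_fun setT M' ->
  (forall s, 0 <= M s) -> (forall s, M s <= M' s) -> wint T b M <= wint T b M'.
Proof.
move=> mM mM' M0 MM'; apply: ge0_le_integral => //.
- by move=> s _; exact: weight_mul_ge0.
- exact: measurable_wint_integrand.
- exact: measurable_wint_integrand.
- by move=> s _; apply: lee_wpmul2l => //; rewrite lee_fin weight_ge0.
Qed.

Lemma wintD T b M M' : measurable_fun setT M -> measurable_fun setT M' ->
  (forall s, 0 <= M s) -> (forall s, 0 <= M' s) ->
  wint T b (fun s => M s + M' s) = wint T b M + wint T b M'.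
Proof.
move=> mM mM' M0 M'0; rewrite /wint -ge0_integralD//.
- by apply: eq_integral => s _; rewrite ge0_muleDr.
- by move=> s _; exact: weight_mul_ge0.
- exact: measurable_wint_integrand.
- by move=> s _; exact: weight_mul_ge0.
- exact: measurable_wint_integrand.
Qed.

Lemma wint_esum (I : countType) T b (M : I -> R -> \bar R) :
  (forall k, measurable_fun setT (M k)) -> (forall k s, 0 <= M k s) ->
  wint T b (fun s => \esum_(k in [set: I]) M k s) = \esum_(k in [set: I]) wint T b (M k).
Proof.
move=> mM M0; rewrite /wint -integral_esum//.
- by apply: eq_integral => s _; rewrite esumZl ?weight_ge0.
- by move=> k s _ _; exact: weight_mul_ge0.
- by move=> k _; exact: measurable_wint_integrand.
Qed.

Lemma weight0 s : weight 0 s = 1%R :> R.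
Proof. by rewrite /weight mul0r oppr0 expR0. Qed.

Lemma wint_le_weight0 T b M : measurable_fun setT M -> (forall s, 0 <= M s) ->
  (0 <= b)%R -> wint T b M <= wint T 0 M.
Proof.
move=> mM M0 b0; apply: ge0_le_integral => //.
- by move=> s _; exact: weight_mul_ge0.
- exact: measurable_wint_integrand.
- exact: measurable_wint_integrand.
- move=> s; rewrite /= in_itv/= => /andP[s0 _]; apply: lee_wpmul2r => //.
  by rewrite lee_fin weight0 /weight expR_le1 oppr_le0 mulr_ge0// ltW.
Qed.

(** On []0, T]] the weight is bounded below, so finiteness does not depend on the rate:
    [locally_finite] can use rate 0 while the contraction needs a large one. *)
Lemma wint_weight0_le T b M : measurable_fun setT M -> (forall s, 0 <= M s) ->
  (0 <= b)%R -> wint T 0 M <= (expR (b * T))%:E * wint T b M.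
Proof.
move=> mM M0 b0; rewrite /wint -ge0_integralZl_EFin ?expR_ge0//; last 2 first.
- by move=> s _; exact: weight_mul_ge0.
- exact: measurable_wint_integrand.
apply: ge0_le_integral => //.
- by move=> s _; exact: weight_mul_ge0.
- exact: measurable_wint_integrand.
- by apply: measurable_funeM; exact: measurable_wint_integrand.
- move=> s; rewrite /= in_itv/= => /andP[_ sT]; rewrite muleA; apply: lee_wpmul2r => //.
  rewrite weight0 -EFinM lee_fin /weight -expRD -expR0 ler_expR.
  by rewrite subr_ge0 ler_wpM2l.
Qed.

Lemma wint_cst T b (k : R) : (0 <= T)%R -> (0 <= b)%R -> (0 <= k)%R ->
  wint T b (cst k%:E) < +oo.
Proof.
move=> T0 b0 k0; apply: le_lt_trans (wint_le_weight0 _ _ _ b0) _ => //.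
rewrite /wint; under eq_integral do rewrite weight0 mul1e.
rewrite integral_cst//= (_ : leb _ = T%:E) ?ltry//.
rewrite -[LHS]/(lebesgue_measure `]0%R, T]%classic) lebesgue_measure_itv/= lte_fin.
by case: ltP => [_|T1]; [rewrite sube0|rewrite (@le_anti _ _ T 0%R) ?T1].
Qed.

End wint_theory.

Section gap_theory.
Context d (Omega : measurableType d) (R : realType).
Variables (P : probability Omega R) (G : R -> set (set Omega)).
Hypothesis hG : filtration G.
Local Open Scope ereal_scope.
Local Notation predT := (g_sigma_algebraType (pred_rect G (@id R))).
Implicit Type l : Omega * R -> R.

Lemma gapC l l' : gap l l' = gap l' l.
Proof. by apply/funext => x; rewrite /gap distrC. Qed.

Lemma gap_triangle l' l l'' x : (gap l l'' x <= gap l l' x + gap l' l'' x)%R.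
Proof. exact: ler_distD. Qed.

Lemma mean_gapC l l' : mean_gap P l l' = mean_gap P l' l.
Proof. by rewrite /mean_gap gapC. Qed.

Lemma mean_gap_triangle l' l l'' u : measurable_fun [set: predT] l ->
  measurable_fun [set: predT] l' -> measurable_fun [set: predT] l'' ->
  mean_gap P l l'' u <= mean_gap P l l' u + mean_gap P l' l'' u.
Proof.
move=> ml ml' ml''.
have mg l1 l2 : measurable_fun [set: predT] l1 -> measurable_fun [set: predT] l2 ->
    measurable_fun setT (fun w => (gap l1 l2 (w, u))%:E : \bar R).
  move=> m1 m2; have := measurable_fun_pair1 u (measurable_gap hG m1 m2); exact.
rewrite /mean_gap -ge0_integralD//.
- apply: ge0_le_integral => //.
  + by move=> w _; rewrite lee_fin gap_ge0.
  + exact: mg.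
  + by apply: emeasurable_funD; exact: mg.
  + by move=> w _; rewrite -EFinD lee_fin; exact: gap_triangle.
- by move=> w _; rewrite lee_fin gap_ge0.
- exact: mg.
- by move=> w _; rewrite lee_fin gap_ge0.
- exact: mg.
Qed.

End gap_theory.

(** * Contraction and Picard iteration *)

Section iteration.
Context d (Omega : measurableType d) (R : realType) (S : countType).
Variables (P : probability Omega R) (G : R -> set (set Omega)) (E : set (S * S)).
Variable N : S -> Omega -> {measure set (R * R) -> \bar R}.
Variables (K : S -> S -> R -> R) (h : S -> R -> R) (c p : S -> R) (Phi : R -> R).
Hypotheses (hG : filtration G) (hN : forall i, compensated P G (N i)).
Hypotheses (mK : forall j i, E (j, i) -> measurable_fun setT (K j i))
  (K_le0 : forall j i r, r <= 0 -> K j i r = 0).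
Hypotheses (c_ge0 : forall i, 0 <= c i) (p_gt0 : forall i, 0 < p i).
Hypotheses (Phi_ge0 : forall r, 0 <= Phi r) (mPhi : measurable_fun setT Phi)
  (Phi_le0 : forall r, r <= 0 -> Phi r = 0)
  (Phi_int : forall T, 0 <= T -> leb.-integrable `]0, T] (EFin \o Phi)).
Hypothesis h_ge0 : forall i x, 0 <= h i x.
Hypothesis h_lip : forall i x y, `|h i x - h i y| <= c i * `|x - y|.
Hypothesis h_sum : (\esum_(i in [set: S]) (h i 0 * p i)%:E < +oo)%E.
Hypothesis KPhi : forall r j,
  (\esum_(i in [set i | E (j, i)]) (c i * p i * `|K j i r|)%:E <= (p j * Phi r)%:E)%E.
Local Open Scope ereal_scope.
Local Notation predT := (g_sigma_algebraType (pred_rect G (@id R))).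
Local Notation predictable := (predictable G).
Local Notation picard := (picard E N K h).
Local Notation dist := (dist P p).
Local Notation off := (@off _ Omega R S).
Implicit Types lam : S -> Omega * R -> R.

Let mdist lam lam' : predictable lam -> predictable lam' ->
  measurable_fun setT (dist lam lam').
Proof. exact: measurable_dist. Qed.

Let d0 lam lam' s : 0 <= dist lam lam' s. Proof. exact: dist_ge0. Qed.

Lemma distC lam lam' : dist lam lam' = dist lam' lam.
Proof.
by apply/funext => s; apply: eq_esum => i _; rewrite mean_gapC.
Qed.

Lemma dist_triangle lam' lam lam'' s : predictable lam -> predictable lam' ->
  predictable lam'' -> dist lam lam'' s <= dist lam lam' s + dist lam' lam'' s.
Proof.
move=> ml ml' ml''; rewrite /dist -esumD; last 2 first.
- by move=> i _; rewrite mule_ge0 ?mean_gap_ge0// lee_fin ltW.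
- by move=> i _; rewrite mule_ge0 ?mean_gap_ge0// lee_fin ltW.
apply: le_esum => i _; rewrite -ge0_muleDr ?mean_gap_ge0//.
apply: lee_wpmul2l; first by rewrite lee_fin ltW.
exact: (mean_gap_triangle P hG _ (ml i) (ml' i) (ml'' i)).
Qed.

Lemma wint_dist_triangle lam' lam lam'' T b : predictable lam -> predictable lam' ->
  predictable lam'' ->
  wint T b (dist lam lam'') <= wint T b (dist lam lam') + wint T b (dist lam' lam'').
Proof.
move=> ml ml' ml''; rewrite -wintD//; try exact: mdist.
apply: le_wint => //; first exact: mdist.
- by apply: emeasurable_funD; exact: mdist.
- by move=> s; exact: dist_triangle.
Qed.

Definition locally_finite lam := forall T, (0 <= T)%R -> wint T 0 (dist lam off) < +oo.

(** The convolution inequality at rate 0 gives a finite integral over []0, T]], hence finiteness at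
    almost every time; it supplies the premises of [dist_picard]. *)
Lemma ae_convol_lty lam T : predictable lam -> locally_finite lam -> (0 <= T)%R ->
  {ae leb, forall s : R, (0 < s <= T)%R -> convol Phi (dist lam off) s < +oo}.
Proof.
move=> ml fl T0.
have mc : measurable_fun setT (convol Phi (dist lam off)).
  by apply: measurable_convol => //; apply: mdist => //; exact: predictable_off.
have c0 s : 0 <= convol Phi (dist lam off) s by exact: convol_ge0.
have : leb.-integrable (`]0%R, T]%classic : set R) (convol Phi (dist lam off)).
  apply/integrableP; split; first exact: measurable_funTS.
  under eq_integral do rewrite gee0_abs//.
  have -> : \int[leb]_(x in `]0%R, T]) convol Phi (dist lam off) x =
      wint T 0 (convol Phi (dist lam off)).
    by apply: eq_integral => s _; rewrite weight0 mul1e.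
  apply: le_lt_trans (wint_convol _ _ _ _ _ _ _) _ => //.
    by apply: mdist => //; exact: predictable_off.
  apply: lte_mul_pinfty.
  - by apply: integral_ge0 => r _; rewrite lee_fin mulr_ge0// weight_ge0.
  - under eq_integral do rewrite weight0 mul1r.
    exact: integrable_fin_num (Phi_int T0).
  - exact: fl.
move=> /(integrable_ae (measurable_itv _)); apply: filterS => s hs sT; have := hs sT.
by rewrite ge0_fin_numE.
Qed.

(** The rate is chosen from [T] alone, before the two families, so one weight serves for all steps
    of the iteration. *)
Lemma picard_contraction T : (0 <= T)%R -> exists b : R, (0 <= b)%R /\
  forall lam lam', predictable lam -> predictable lam' ->
    locally_finite lam -> locally_finite lam' ->
    wint T b (dist (picard lam) (picard lam')) <= (2^-1)%:E * wint T b (dist lam lam').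
Proof.
move=> T0; have [b [b0 hb]] := small_weight Phi_ge0 mPhi T0 (Phi_int T0).
exists b; split => // lam lam' ml ml' fl fl'.
have mp l : predictable l -> predictable (picard l) by exact: (predictable_picard hG hN mK).
apply: (@le_trans _ _ (wint T b (convol Phi (dist lam lam')))).
  apply: ae_ge0_le_integral => //.
  - by move=> s _; exact: weight_mul_ge0.
  - by apply: measurable_wint_integrand; apply: mdist; exact: mp.
  - by move=> s _; apply: weight_mul_ge0 => r; exact: convol_ge0.
  - by apply: measurable_wint_integrand; apply: measurable_convol => //; exact: mdist.
  apply: filterS2 (ae_convol_lty ml fl T0) (ae_convol_lty ml' fl' T0) => s fs fs' sT.
  apply: lee_wpmul2l; first by rewrite lee_fin weight_ge0.
  apply: (dist_picard hG hN mK K_le0 c_ge0 p_gt0 Phi_ge0 mPhi h_ge0 h_lip KPhi) => //.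
  - exact: fs.
  - exact: fs'.
apply: le_trans (wint_convol _ _ _ _ _ _ _) _ => //; first exact: mdist.
by apply: lee_wpmul2r => //; exact: wint_ge0.
Qed.

(** Without points the drive is 0, so [picard off] is the constant family [h i 0]. *)
Lemma dist_picard_off s :
  dist (picard off) off s <= \esum_(i in [set: S]) (h i 0 * p i)%:E.
Proof.
apply: le_esum => i _.
rewrite mulrC EFinM; apply: lee_wpmul2l; first by rewrite lee_fin ltW.
have e w : picard off i (w, s) = h i 0.
  rewrite picardE /drive (eq_countable_sum (b := fun=> 0%R)) ?countable_sum0// => j _.
  by rewrite shot_below0// => x; exact: off_lt0.
rewrite /mean_gap; under eq_integral => w _.
  rewrite /gap e (max_l (h_ge0 _ _)) (max_r (_ : _ <= 0)%R) ?oppr_le0// subr0 ger0_norm//.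
  over.
have := @integral_cst _ _ _ P _ measurableT (h i 0)%:E.
by rewrite /cst/= => ->; rewrite probability_setT mule1.
Qed.

Lemma wint_picard_off T b : (0 <= T)%R -> (0 <= b)%R ->
  wint T b (dist (picard off) off) < +oo.
Proof.
move=> T0 b0; have mo : predictable off := @predictable_off _ _ _ _ G.
have mpo : predictable (picard off) by exact: (predictable_picard hG hN mK h_lip).
have s0 : 0 <= \esum_(i in [set: S]) (h i 0 * p i)%:E.
  by apply: esum_ge0 => i _; rewrite lee_fin mulr_ge0// ltW.
have := @wint_cst R T b (fine (\esum_(i in [set: S]) (h i 0 * p i)%:E)) T0 b0 (fine_ge0 s0).
apply: le_lt_trans; apply: le_wint => //; first exact: mdist.
by move=> s; rewrite /cst/= fineK ?ge0_fin_numE//; exact: dist_picard_off.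
Qed.

Lemma locally_finite_off : locally_finite off.
Proof.
move=> T _; rewrite /wint integral0_eq// => s _.
rewrite distE esum1 ?mule0// => i _.
by rewrite /mean_gap integral0_eq ?mule0// => w _; rewrite /gap subrr normr0.
Qed.

(** The comparison passes through [picard off]: the contraction controls the distance to it, and it
    is itself at finite distance from [off]. *)
Lemma locally_finite_picard lam : predictable lam -> locally_finite lam ->
  locally_finite (picard lam).
Proof.
move=> ml fl T T0; have mo : predictable off := @predictable_off _ _ _ _ G.
have mp l : predictable l -> predictable (picard l) by exact: (predictable_picard hG hN mK h_lip).
have [b [b0 /(_ _ _ ml mo fl locally_finite_off) hb]] := picard_contraction T0.
apply: le_lt_trans (wint_weight0_le _ _ _ b0) _ => //; first exact: (mdist (mp _ ml) mo).
apply: lte_mul_pinfty; rewrite ?lee_fin ?expR_ge0//.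
apply: le_lt_trans (wint_dist_triangle T b (mp _ ml) (mp _ mo) mo) _.
apply: lte_add_pinfty; last exact: wint_picard_off.
apply: le_lt_trans hb _; apply: lte_mul_pinfty => //.
by apply: le_lt_trans (fl _ T0); apply: wint_le_weight0 => //; exact: mdist.
Qed.

Definition iterate n := iter n picard off.

Lemma predictable_iterate n : predictable (iterate n).
Proof.
elim: n => [|n ih]; first exact: predictable_off.
exact: (predictable_picard hG hN mK h_lip).
Qed.

Lemma locally_finite_iterate n : locally_finite (iterate n).
Proof.
elim: n => [|n ih]; first exact: locally_finite_off.
by apply: locally_finite_picard => //; exact: predictable_iterate.
Qed.

Lemma wint_iterate T b : (0 <= T)%R ->
  (forall lam lam', predictable lam -> predictable lam' ->
    locally_finite lam -> locally_finite lam' ->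
    wint T b (dist (picard lam) (picard lam')) <= (2^-1)%:E * wint T b (dist lam lam')) ->
  forall n, wint T b (dist (iterate n.+1) (iterate n)) <=
    (2^-1 ^+ n)%:E * wint T b (dist (picard off) off).
Proof.
move=> T0 hb; elim=> [|n ih]; first by rewrite expr0 mul1e.
have m := predictable_iterate; have f := locally_finite_iterate.
apply: le_trans (hb _ _ (m n.+1) (m n) (f n.+1) (f n)) _.
by rewrite exprS EFinM -muleA; apply: lee_wpmul2l => //; rewrite lee_fin.
Qed.

(* The limit superior is taken in [\bar R]; where it is infinite, [fine] makes the
   limit 0, and the telescoping bound of [gap_limit] is trivial there. *)
Definition limit_intensity i (x : Omega * R) : R :=
  fine (limn_esup (fun n => (Num.max (iterate n i x) 0)%:E)).

Lemma predictable_limit : predictable limit_intensity.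
Proof.
move=> i; apply: measurableT_comp => //.
apply: measurable_fun_limn_esup => n; apply/measurable_EFinP.
by apply: measurable_maxr => //; exact: predictable_iterate.
Qed.

(** A finite sum of increments bounds [a (n + m) - a n] for all [m] by telescoping; the upper limit
    then stays in the same interval around [a n], so it is finite and [fine] is harmless. *)
Lemma gap_limit n i x : (gap (limit_intensity i) (iterate n i) x)%:E <=
  \esum_(k in [set: nat]) (gap (iterate (n + k).+1 i) (iterate (n + k) i) x)%:E.
Proof.
set s := (X in _ <= X); pose a (k : nat) : R := Num.max (iterate k i x) 0%R.
have s0 : 0 <= s by apply: esum_ge0 => k _; rewrite lee_fin gap_ge0.
have [->|] := eqVneq s +oo; first exact: leey.
rewrite -ltey => soo.
have sE : s = (fine s)%:E by rewrite fineK// ge0_fin_numE.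
have tele m : (`|a (n + m)%N - a n| <= fine s)%R.
  have : (`|a (n + m)%N - a n|%:E <= \sum_(0 <= k < m) (`|a (n + k).+1 - a (n + k)%N|)%:E).
    elim: m => [|m ih]; first by rewrite addn0 subrr normr0 big_nil.
    rewrite big_nat_recr//= addnS.
    apply: (@le_trans _ _ (`|a (n + m)%N - a n|%:E + `|a (n + m).+1 - a (n + m)%N|%:E)).
      by rewrite -EFinD lee_fin [leRHS]addrC; exact: ler_distD.
    exact: leeD.
  move=> h1; rewrite -lee_fin -sE; apply: le_trans h1 _.
  rewrite /s -nneseries_esumT; last by move=> k; rewrite lee_fin gap_ge0.
  by apply: nneseries_lim_ge => k _; rewrite lee_fin.
have lo : (a n - fine s)%:E <= limn_esup (EFin \o a).
  rewrite limn_esup_lim; apply: lime_ge; first exact: is_cvg_esups.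
  apply: nearW => m; apply: ereal_sup_ge; exists (a (n + m)%N)%:E.
    by exists (n + m)%N => //=; rewrite leq_addl.
  rewrite lee_fin; have := tele m; rewrite ler_norml => /andP[+ _]; lra.
have hi : limn_esup (EFin \o a) <= (a n + fine s)%:E.
  rewrite limn_esup_lim; apply: lime_le; first exact: is_cvg_esups.
  near=> m; apply: ge_ereal_sup => _ [k /= mk <-].
  have nk : (n <= k)%N by apply: leq_trans mk; near: m; exact: nbhs_infty_ge.
  rewrite lee_fin -(subnKC nk); have := tele (k - n)%N.
  rewrite ler_norml => /andP[_]; lra.
rewrite sE lee_fin.
have Lfin : limn_esup (EFin \o a) = (limit_intensity i x)%:E.
  rewrite /limit_intensity fineK//.
  by move: lo hi; case: (limn_esup _).
move: lo hi; rewrite Lfin !lee_fin => lo hi.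
have a0 : (0 <= a n)%R by rewrite /a le_max lexx orbT.
rewrite /gap -/(a n); have [l0|l0] := leP 0%R (limit_intensity i x).
  by rewrite ler_norml; apply/andP; split; lra.
by rewrite ler_norml; apply/andP; split; lra.
Unshelve. all: by end_near. Qed.

Lemma dist_limit n s : dist limit_intensity (iterate n) s <=
  \esum_(k in [set: nat]) dist (iterate (n + k).+1) (iterate (n + k)) s.
Proof.
have m := predictable_iterate.
have mg l1 l2 : measurable_fun [set: predT] l1 -> measurable_fun [set: predT] l2 ->
    measurable_fun setT (fun w => (gap l1 l2 (w, s))%:E : \bar R).
  move=> m1 m2; have := measurable_fun_pair1 s (measurable_gap hG m1 m2); exact.
have pg0 i (k : nat) : 0 <= (p i)%:E * mean_gap P (iterate (n + k).+1 i) (iterate (n + k) i) s.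
  by rewrite mule_ge0 ?mean_gap_ge0// lee_fin ltW.
have := @esum_swap R S nat setT (fun i k =>
   (p i)%:E * mean_gap P (iterate (n + k).+1 i) (iterate (n + k) i) s) pg0.
move=> <-; apply: le_esum => i _; rewrite esumZl//; last 2 first.
- exact: ltW.
- by move=> k _; exact: mean_gap_ge0.
apply: lee_wpmul2l; first by rewrite lee_fin ltW.
rewrite /mean_gap -integral_esum//; last 2 first.
- by move=> k w _ _; rewrite lee_fin gap_ge0.
- by move=> k _; exact: (mg _ _ (m _ i) (m _ i)).
apply: ge0_le_integral => //.
- by move=> w _; rewrite lee_fin gap_ge0.
- exact: (mg _ _ (predictable_limit i) (m _ i)).
- apply: measurable_fun_esum => //; first by move=> k w _ _; rewrite lee_fin gap_ge0.
  by move=> k _; exact: (mg _ _ (m _ i) (m _ i)).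
- by move=> w _; exact: gap_limit.
Qed.

Lemma wint_limit T b n : (0 <= T)%R -> (0 <= b)%R ->
  (forall lam lam', predictable lam -> predictable lam' ->
    locally_finite lam -> locally_finite lam' ->
    wint T b (dist (picard lam) (picard lam')) <= (2^-1)%:E * wint T b (dist lam lam')) ->
  wint T b (dist limit_intensity (iterate n)) <=
    (2^-1 ^+ n * (2 * fine (wint T b (dist (picard off) off))))%:E.
Proof.
move=> T0 b0 hb; have m := predictable_iterate; have ml := predictable_limit.
have oo0 : 0 <= wint T b (dist (picard off) off) by exact: wint_ge0.
set C := fine _; have C0 : (0 <= C)%R by exact: fine_ge0.
have CE : wint T b (dist (picard off) off) = C%:E.
  by rewrite /C fineK// ge0_fin_numE//; exact: wint_picard_off.
have md k : measurable_fun setT (dist (iterate k.+1) (iterate k)) by exact: mdist.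
apply: (@le_trans _ _ (\esum_(k in [set: nat]) wint T b (dist (iterate (n + k).+1) (iterate (n + k))))).
  rewrite -wint_esum//; apply: le_wint => //.
  - exact: mdist.
  - by apply: measurable_fun_esum.
  - by move=> s; exact: dist_limit.
(* The geometric bound [C / 2^(n+k)] is written as [2 C / 2^n] divided by [2^(k+1)], the form that
   [epsilon_trick0] sums; hence the factor 2 of the statement. *)
apply: (@le_trans _ _ (\esum_(k in [set: nat]) (2^-1 ^+ n * (2 * C) / (2 ^ k.+1)%:R)%:E)).
  apply: le_esum => k _; apply: le_trans (wint_iterate T0 hb _) _.
  rewrite CE -EFinM lee_fin exprD -!mulrA ler_wpM2l ?exprn_ge0//.
  rewrite natrX exprS exprVn le_eqVlt; apply/orP; left; apply/eqP.
  by field; rewrite expf_neq0.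
rewrite -nneseries_esumT; last by move=> k; rewrite lee_fin !mulr_ge0// exprn_ge0.
by apply: epsilon_trick0; rewrite !mulr_ge0// exprn_ge0.
Qed.

Lemma locally_finite_limit : locally_finite limit_intensity.
Proof.
move=> T T0; have [b [b0 hb]] := picard_contraction T0.
apply: le_lt_trans (wint_weight0_le _ _ _ b0) _ => //.
  by apply: mdist; [exact: predictable_limit|exact: predictable_off].
apply: lte_mul_pinfty; rewrite ?lee_fin ?expR_ge0//.
by apply: le_lt_trans (wint_limit 0 T0 b0 hb) _; rewrite ltry.
Qed.

(** The limit and its image are both close to [iterate n.+1]. The rate depends on [T] but
    [limit_intensity] does not, so one family works for all horizons. *)
Lemma limit_fixed_point T : (0 <= T)%R -> exists b : R,
  wint T b (dist (picard limit_intensity) limit_intensity) = 0.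
Proof.
move=> T0; have [b [b0 hb]] := picard_contraction T0; exists b.
have m := predictable_iterate; have f := locally_finite_iterate.
have ml := predictable_limit.
have mp l : predictable l -> predictable (picard l) by exact: (predictable_picard hG hN mK h_lip).
set C := (2 * fine (wint T b (dist (picard off) off)))%R.
have C0 : (0 <= C)%R by rewrite mulr_ge0// fine_ge0// wint_ge0.
have bnd n : wint T b (dist (picard limit_intensity) limit_intensity) <=
    (2^-1 ^+ n * C)%:E.
  apply: le_trans (wint_dist_triangle T b (mp _ ml) (m n.+1) ml) _.
  have h1 := wint_limit n T0 b0 hb; have h2 := wint_limit n.+1 T0 b0 hb.
  have h3 := hb _ _ ml (m n) locally_finite_limit (f n).
  rewrite (distC (iterate n.+1)).
  (* The contraction halves the first bound [C / 2^n], and the second is [C / 2^(n+1)]: together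
     they make exactly [C / 2^n]. *)
  apply: (@le_trans _ _ ((2^-1)%:E * (2^-1 ^+ n * C)%:E + (2^-1 ^+ n.+1 * C)%:E)).
    by apply: leeD => //; apply: le_trans h3 _; apply: lee_wpmul2l.
  rewrite -EFinM -EFinD lee_fin exprS -mulrA -mulrDl.
  by rewrite [X in (X * _)%R](_ : _ = 1%R) ?mul1r//; lra.
apply/eqP; rewrite eq_le wint_ge0// andbT.
have cv : ((2^-1 ^+ n * C)%:E : \bar R) @[n --> \oo] --> 0.
  apply/cvg_EFin; first by apply: nearW.
  rewrite -[X in _ --> X](mul0r C); apply: cvgM; last exact: cvg_cst.
  by apply: cvg_expr; rewrite ger0_norm// invf_lt1// ltr1n.
rewrite -(cvg_lim _ cv)//; apply: lime_ge; first by apply/cvg_ex; exists 0.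
exact: nearW.
Qed.

End iteration.

(** * Counting paths *)

Lemma lebesgue_stieltjes_itvoc (R : realType) (g : cumulative R R) (a b : R) :
  a <= b -> lebesgue_stieltjes_measure g `]a, b]%classic = (g b - g a)%:E.
Proof.
move=> ab; rewrite /lebesgue_stieltjes_measure /measure_extension/=.
by rewrite measurable_mu_extE/= ?wlength_itv_bnd//; exact: is_ocitv.
Qed.

Section under.
Context (R : realType).
Implicit Types (lam : R -> R) (B : set R).

Definition under lam B : set (R * R) :=
  [set y | [/\ 0 < y.1, 0 <= y.2, y.2 <= lam y.1 & B y.1]].

Lemma measurable_under lam B : measurable_fun setT lam -> measurable B ->
  measurable (under lam B).
Proof.
move=> ml mB; have mfst : measurable_fun [set: R * R] (@fst R R) by [].
have mle : measurable [set y : R * R | y.2 <= lam y.1].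
  have := measurable_fun_ler (@measurable_snd _ _ R R) (measurableT_comp ml mfst).
  by move=> /(_ measurableT [set true]); rewrite setTI; exact.
rewrite (_ : under lam B = @strip R `&` [set y | y.2 <= lam y.1] `&` (fst @^-1` B)).
  apply: measurableI; first by apply: measurableI => //; exact: measurable_strip.
  by rewrite -[_ @^-1` _]setTI; exact: mfst.
by apply/seteqP; split=> y /=; [move=> []|move=> [[[]]]].
Qed.

Lemma underI lam B C : under lam (B `&` C) = under lam B `&` (fst @^-1` C).
Proof. by apply/seteqP; split=> y /=; [move=> [? ? ? []]|move=> [[]]]. Qed.

Lemma le_under lam B C : B `<=` C -> under lam B `<=` under lam C.
Proof. by move=> BC y [? ? ? /BC]. Qed.

Lemma prolong_right_continuous (f : R -> R) :
  (forall t, 0 <= t -> f u @[u --> t^'+] --> f t) -> right_continuous (prolong f).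
Proof.
move=> fc t; have [t0|t0] := leP 0 t.
  rewrite {2}/prolong max_l//.
  apply: cvg_trans (fc t t0); apply: near_eq_cvg; near=> u.
  by rewrite /prolong max_l// (le_trans t0)//; near: u; exact: nbhs_right_ge.
rewrite {2}/prolong max_r ?ltW//.
apply: cvg_near_cst; near=> u.
by rewrite /prolong max_r//; near: u; exact: nbhs_right_le.
Unshelve. all: by end_near. Qed.

Section counting_path.
Variables (mu : {measure set (R * R) -> \bar R}) (lam f : R -> R).
Hypothesis mlam : measurable_fun setT lam.
Hypothesis hf : forall t, 0 <= t -> (f t)%:E = mu (under lam [set u | u <= t]).

Let mray t : measurable [set u : R | u <= t].
Proof.
by rewrite (_ : [set _ | _] = `]-oo, t]%classic).
Qed.

Let mUray t : measurable (under lam [set u | u <= t]).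
Proof. exact: measurable_under. Qed.

Lemma prolong_countingE t : (prolong f t)%:E = mu (under lam [set u | u <= t]).
Proof.
rewrite /prolong; have [t0|t0] := leP 0 t; first by rewrite hf.
rewrite hf//; congr (mu _); apply/seteqP; split=> y [y0 z0 zl /= yt].
  by have := lt_le_trans y0 yt; rewrite ltxx.
by have := lt_trans (lt_le_trans y0 yt) t0; rewrite ltxx.
Qed.

Lemma counting_nd : {homo prolong f : x y / x <= y}.
Proof.
move=> x y xy; rewrite -lee_fin !prolong_countingE; apply: le_measure; rewrite ?inE//.
by apply: le_under => u /= /le_trans; apply.
Qed.

(** Continuity of [mu] from above along [a + 1/(n+1)], legitimate because a real-valued path has
    finite masses; monotonicity passes from this sequence to the right limit. *)
Lemma counting_rc : right_continuous (prolong f).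
Proof.
move=> a.
have cv : prolong f (a + n.+1%:R^-1) @[n --> \oo] --> prolong f a.
  suff /fine_cvg : (prolong f (a + n.+1%:R^-1))%:E @[n --> \oo] --> (prolong f a)%:E by [].
  rewrite (_ : (fun n => _) = mu \o (fun n => under lam [set u | u <= a + n.+1%:R^-1])); last first.
    by apply/funext => n /=; rewrite prolong_countingE.
  rewrite prolong_countingE.
  rewrite (_ : under lam [set u | u <= a] =
      \bigcap_n under lam [set u | u <= a + n.+1%:R^-1]).
    apply: nonincreasing_cvg_mu => //.
    - by rewrite -prolong_countingE ltry.
    - by apply: bigcapT_measurable => n; exact: measurable_under.
    - move=> m n mn; apply/subsetPset; apply: le_under => u /= /le_trans; apply.
      by rewrite lerD2l lef_pV2 ?posrE// ler_nat ltnS.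
  apply/seteqP; split=> [y [y0 z0 zl /= ya] n _|y yn].
    by split => //=; rewrite (le_trans ya)// lerDl invr_ge0.
  have [y0 z0 zl _] := yn 0%N Logic.I; split => //=.
  apply/ler_addgt0Pr => e e0.
  have [n _ /(_ n (leqnn n)) /= ne] := near_infty_natSinv_lt (PosNum e0).
  by have [_ _ _ /= /le_trans] := yn n Logic.I; apply; rewrite lerD2l ltW.
apply/cvgrPdist_le => e e0.
move/cvgrPdist_le : cv => /(_ e e0)[n _ /(_ n (leqnn n)) /= ne].
near=> x.
have ax : a <= x by near: x; exact: nbhs_right_ge.
have xn : x <= a + n.+1%:R^-1.
  by near: x; apply: nbhs_right_le; rewrite ltrDl invr_gt0.
have h1 := counting_nd ax; have h2 := counting_nd xn.
apply: le_trans ne; rewrite ler0_norm ?subr_le0// ler0_norm ?subr_le0 ?(le_trans h1)//.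
by rewrite lerN2 lerD2l lerN2.
Unshelve. all: by end_near. Qed.

Lemma counting_cadlag : cadlag f.
Proof.
split=> t t0.
  have := counting_rc (x := t); rewrite {2}/prolong max_l//; apply: cvg_trans.
  apply: near_eq_cvg; near=> u.
  by rewrite /prolong max_l// (le_trans t0)//; near: u; exact: nbhs_right_ge.
have : cvg (prolong f u @[u --> t^'-]).
  apply: nondecreasing_at_left_is_cvgr.
    by apply: nearW => x u v _ _; exact: counting_nd.
  apply: nearW => x; exists (prolong f t) => _ [u /= + <-].
  by rewrite in_itv/= => /andP[_ /ltW]; exact: counting_nd.
move=> /cvg_ex[l cl]; apply/cvg_ex; exists l; apply: cvg_trans cl.
apply: near_eq_cvg; near=> u.
rewrite /prolong max_l//; apply: ltW; near: u; exact: nbhs_left_gt.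
Unshelve. all: by end_near. Qed.

(** The projection to the time axis of [mu] restricted to the subgraph has the increments of [f] on
    half-open intervals, and these determine a Lebesgue-Stieltjes measure. *)
Lemma path_measure_counting B : measurable B -> path_measure f B = mu (under lam B).
Proof.
move=> mB; rewrite /path_measure; case: pselect => [H|]; last first.
  by case; split; [exact: counting_nd|exact: counting_rc].
set g : cumulative R R := (X in lebesgue_stieltjes_measure X).
have mU : measurable (under lam setT) by exact: measurable_under.
pose pr : R * R -> measurableTypeR R := fst.
have mpr : measurable_fun setT pr.
  by have : measurable_fun [set: R * R] (@fst R R) by [].
pose pr' : {mfun (R * R)%type >-> measurableTypeR R} :=
  HB.pack pr (isMeasurableFun.Build _ _ _ _ _ mpr).
have nuE C : pushforward (mrestr mu mU) pr' C = mu (under lam C).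
  rewrite /pushforward/= /mrestr; congr (mu _).
  by rewrite -[in RHS](setTI C) underI setIC.
rewrite -nuE; apply: lebesgue_stieltjes_measure_unique => //.
move=> _ [[a b] _ <-]; transitivity (mu (under lam `]a, b])); last by symmetry; exact: nuE.
have [ab|ba] := leP a b; last first.
  rewrite set_itv_ge ?bnd_simp -?leNgt ?ltW// measure0.
  by rewrite (_ : under _ _ = set0) ?measure0// -subset0 => y [_ _ _ /=].
rewrite lebesgue_stieltjes_itvoc// EFinB /= !prolong_countingE.
rewrite (_ : under lam [set u | u <= b] =
   under lam [set u | u <= a] `|` under lam `]a, b]); last first.
  apply/seteqP; split=> [y [y0 z0 zl /= yb]|y].
    have [ya|ya] := leP y.1 a; [left|right]; split => //=.
    by rewrite in_itv/= ya.
  by move=> [|] [y0 z0 zl /=]; [|rewrite in_itv/= => /andP[_ ?]];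
    split => //=; exact: le_trans ab.
rewrite measureU//; [|exact: measurable_under|].
  transitivity ((prolong f a)%:E + mu (under lam `]a, b]) - (prolong f a)%:E)%E.
    by congr (_ + _)%E; congr (_ + _)%E; rewrite prolong_countingE.
  by rewrite addeAC subee// add0e.
rewrite -subset0 => y [[_ _ _ /= ya] [_ _ _]] /=.
by rewrite in_itv/= ltNge ya.
Qed.

(** [F] is signed and may fail to be integrable, so the change of variables is made on its positive
    and negative parts, from which both integrals are defined. *)
Lemma integral_path_measure_counting (D : set R) (F : R -> R) : measurable D ->
  measurable_fun setT F ->
  (\int[path_measure f]_(u in D) (F u)%:E = \int[mu]_(y in under lam D) (F y.1)%:E)%E.
Proof.
move=> mD mF; have mU := measurable_under mlam mD.
pose pr : R * R -> measurableTypeR R := fst.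
have mpr : measurable_fun setT pr.
  by have : measurable_fun [set: R * R] (@fst R R) by [].
have mUT : measurable (under lam setT) by exact: measurable_under.
have nn (g : R -> \bar R) : measurable_fun setT g -> (forall u, 0 <= g u)%E ->
    (\int[path_measure f]_(u in D) g u = \int[mu]_(y in under lam D) g y.1)%E.
  move=> mg g0.
  transitivity (\int[pushforward (mrestr mu mUT) pr]_(u in (D : set (measurableTypeR R))) g u)%E.
    apply: eq_measure_integral => A mA _; rewrite path_measure_counting//.
    rewrite /pushforward/= /mrestr; congr (mu _).
    by rewrite -[in LHS](setTI A) underI setIC.
  rewrite ge0_integral_pushforward//; last exact: measurable_funTS.
  rewrite integral_mkcond ge0_integral_mrestr.
  - rewrite -integral_mkcondr; congr (integral _ _ _).
    by rewrite -[in RHS](setTI D) underI.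
  - by move=> y; rewrite patchE; case: ifPn => // _; exact: g0.
  - apply/measurable_restrict => //; first by rewrite -[_ @^-1` _]setTI; exact: mpr.
    by apply: measurable_funTS; exact: measurableT_comp.
have mEF : measurable_fun setT (EFin \o F) by exact/measurable_EFinP.
rewrite [LHS]integralE [RHS]integralE; congr (_ - _)%E.
  transitivity (\int[mu]_(y in under lam D) (EFin \o F)^\+ y.1)%E.
    exact: nn (measurable_funepos mEF) (funepos_ge0 _).
  by apply: eq_integral => y _; rewrite !funeposE.
transitivity (\int[mu]_(y in under lam D) (EFin \o F)^\- y.1)%E.
  exact: nn (measurable_funeneg mEF) (funeneg_ge0 _).
by apply: eq_integral => y _; rewrite !funenegE.
Qed.

End counting_path.
End under.

(** * Points of the noise between two graphs *)

Section window.
Context d (Omega : measurableType d) (R : realType) (S : countType).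
Variables (P : probability Omega R) (G : R -> set (set Omega)).
Variable N : S -> Omega -> {measure set (R * R) -> \bar R}.
Variable p : S -> R.
Hypotheses (hG : filtration G) (hN : forall i, compensated P G (N i)).
Hypothesis p_gt0 : forall i, 0 < p i.
Local Open Scope ereal_scope.
Local Notation predT := (g_sigma_algebraType (pred_rect G (@id R))).
Local Notation predictable := (predictable G).
Local Notation dist := (dist P p).
Local Notation off := (@off _ Omega R S).
Implicit Types lam : S -> Omega * R -> R.

Definition window_weight (T b u : R) : R := (\1_(`]0, T]%classic : set R) u * weight b u)%R.

Lemma window_weight_ge0 T b u : (0 <= window_weight T b u)%R.
Proof. by rewrite mulr_ge0// weight_ge0. Qed.

Lemma measurable_window_weight T b : measurable_fun setT (window_weight T b).
Proof.
by apply: measurable_funM; [exact: measurable_indic|exact: measurable_weight].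
Qed.

Definition window_gap T b i lam lam' (w : Omega) : \bar R :=
  strip_integral (N i) (fun x => (window_weight T b x.2.1 *
    `|below (lam i) x.1 x.2 - below (lam' i) x.1 x.2|)%:E) w.

Lemma window_gap_ge0 T b i lam lam' w : 0 <= window_gap T b i lam lam' w.
Proof.
rewrite /window_gap /strip_integral; case: ifP => // _.
by apply: integral_ge0 => y _; rewrite lee_fin mulr_ge0// window_weight_ge0.
Qed.

Lemma measurable_window_integrand T b i lam lam' : predictable lam -> predictable lam' ->
  measurable_fun [set: Omega * (R * R)] (fun x => (window_weight T b x.2.1 *
    `|below (lam i) x.1 x.2 - below (lam' i) x.1 x.2|)%:E : \bar R).
Proof.
move=> ml ml'; apply/measurable_EFinP; apply: measurable_funM.
  apply: measurableT_comp; first exact: measurable_window_weight.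
  by apply: measurableT_comp => //; exact: measurable_fst.
apply: measurableT_comp => //.
by apply: measurable_funB; exact: (predictable_measurable hG (predictable_below hG _)).
Qed.

Lemma measurable_window_gap T b i lam lam' : predictable lam -> predictable lam' ->
  measurable_fun setT (window_gap T b i lam lam').
Proof.
move=> ml ml'; apply: (ge0_measurable_fun_strip_integral (hN i)).
  by move=> x; rewrite lee_fin mulr_ge0// window_weight_ge0.
exact: measurable_window_integrand.
Qed.

(** The link between distances of intensities and counts of points. At rate 0 and against [off] it
    computes mean counts; when the distance is 0 it shows that no point lies between the graphs. *)
Lemma esum_window_gap T b lam lam' : predictable lam -> predictable lam' ->
  \esum_(i in [set: S]) ((p i)%:E * \int[P]_w window_gap T b i lam lam' w) =
  wint T b (dist lam lam').
Proof.
move=> ml ml'.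
have mg i : measurable_fun setT (mean_gap P (lam i) (lam' i)).
  exact: (measurable_mean_gap P hG (ml i) (ml' i)).
have pg0 i u : 0 <= (p i)%:E * mean_gap P (lam i) (lam' i) u.
  by rewrite mule_ge0 ?mean_gap_ge0// lee_fin ltW.
rewrite distE (@wint_esum _ _ T b (fun i u => (p i)%:E * mean_gap P (lam i) (lam' i) u))//.
  apply: eq_esum => i _.
  rewrite /window_gap (mean_strip_gap hG (hN i) (k := window_weight T b))//; last 2 first.
  - exact: measurable_window_weight.
  - exact: window_weight_ge0.
  have -> : \int[leb]_(u in `]0%R, +oo[) ((window_weight T b u)%:E * mean_gap P (lam i) (lam' i) u)
      = wint T b (mean_gap P (lam i) (lam' i)).
    rewrite /wint integral_mkcond [RHS]integral_mkcond; apply: eq_integral => u _.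
    rewrite !patchE /window_weight indicE.
    case: ifPn; case: ifPn => //.
    - by move=> uT _; rewrite mul1r.
    - by move=> uT _; rewrite mul0r mul0e.
    - by move=> uT /negP[]; move: uT; rewrite !inE/= !in_itv/= andbT => /andP[->].
  rewrite -ge0_integralZl_EFin ?ltW//.
  - by apply: eq_integral => u _; rewrite muleCA.
  - by move=> u _; apply: weight_mul_ge0 => s; exact: mean_gap_ge0.
  - exact: measurable_wint_integrand.
by move=> i; exact: measurable_funeM.
Qed.

Lemma mean_window_gap_le T b i lam lam' : predictable lam -> predictable lam' ->
  (p i)%:E * \int[P]_w window_gap T b i lam lam' w <= wint T b (dist lam lam').
Proof.
move=> ml ml'; rewrite -esum_window_gap//.
apply: (@le_term_esum _ _ _ (fun i => (p i)%:E * \int[P]_w window_gap T b i lam lam' w)) => // j _.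
apply: mule_ge0; first by rewrite lee_fin ltW.
by apply: integral_ge0 => w _; exact: window_gap_ge0.
Qed.

(** Intensities at distance 0 need not agree at every time, but the mean weighted number of points
    between their graphs is 0, so the noise does not tell them apart. The rate may change with the
    horizon, hence the existential under the quantifier on [n]. *)
Lemma ae_eq_below lam lam' : predictable lam -> predictable lam' ->
  (forall T, (0 <= T)%R -> exists b : R, wint T b (dist lam lam') = 0) ->
  {ae P, forall w, forall i, {ae N i w, forall y, @strip R y ->
     below (lam i) w y = below (lam' i) w y}}.
Proof.
move=> ml ml' h0; apply: ae_countable => i.
have : {ae P, forall w, forall n : nat, exists b : R, window_gap n%:R b i lam lam' w = 0}.
  apply/ae_foralln => n; have [b hb] := h0 n%:R (ler0n _ _).
  have e0 : \int[P]_w window_gap n%:R b i lam lam' w = 0.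
    have := mean_window_gap_le n%:R b i ml ml'; rewrite hb => le0.
    apply/eqP; rewrite eq_le integral_ge0 ?andbT; last by move=> w _; exact: window_gap_ge0.
    by move: le0; rewrite pmule_rle0// lte_fin.
  have := (@ae_eq_integral_abs _ _ _ P setT measurableT _ (measurable_window_gap n%:R b i ml ml')).1.
  move=> /(_ _); case.
    by rewrite -e0; apply: eq_integral => w _; rewrite gee0_abs// window_gap_ge0.
  move=> A [mA A0 hA]; exists A; split => // w nw; apply: hA => wA; apply: nw.
  by exists b; exact: wA.
apply: filterS2 (ae_good (hN i)) => w gw hw.
have ae_n : {ae N i w, forall y, forall n : nat, exists b : R, @strip R y ->
    window_weight n%:R b y.1 * `|below (lam i) w y - below (lam' i) w y| = 0}%R.
  apply/ae_foralln => n; have [b hb] := hw n.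
  pose F (y : R * R) : \bar R := (window_weight n%:R b y.1 *
    `|below (lam i) w y - below (lam' i) w y|)%:E.
  have mF : measurable_fun (@strip R) F.
    apply: measurable_funTS.
    exact: (measurable_fun_pair2 w (measurable_window_integrand n%:R b i ml ml')).
  have := (@ae_eq_integral_abs _ _ _ (N i w) _ (@measurable_strip R) _ mF).1.
  case.
    transitivity (window_gap n%:R b i lam lam' w) => //.
    rewrite /window_gap /strip_integral gw; apply: eq_integral => y _.
    by rewrite gee0_abs// lee_fin mulr_ge0// window_weight_ge0.
  move=> A [mA A0 hA]; exists A; split => // y ny; apply: hA => yA; apply: ny.
  by exists b => sy; have [] := yA sy.
(* A horizon beyond [y.1] puts the mark inside the window, where the weight is positive. *)
apply: filterS ae_n => y hy sy; have [b /(_ sy) /eqP] := hy (Num.truncn y.1).+1.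
rewrite mulf_eq0 => /orP[|]; last by rewrite normr_eq0 subr_eq0 => /eqP.
rewrite /window_weight indicE mem_set/=; last first.
  by rewrite in_itv/= sy.1 ltW// truncnS_gt.
by rewrite mul1r /weight gt_eqF// expR_gt0.
Qed.

Lemma below_off w y : @strip R y -> forall i, below (off i) w y = 0%R.
Proof.
by move=> sy i; rewrite /below/= ifF//; apply/negbTE; rewrite -ltNge (lt_le_trans _ sy.2)// oppr_lt0.
Qed.

Lemma window_gap_count T i lam w : predictable lam -> good (N i) w ->
  window_gap T 0 i lam off w = N i w (under (fun u => lam i (w, u)) [set u | (u <= T)%R]).
Proof.
move=> ml gw; rewrite /window_gap /strip_integral gw.
have mlw : measurable_fun setT (fun u => lam i (w, u)) by exact: (predictable_section hG w (ml i)).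
have mU : measurable (under (fun u => lam i (w, u)) [set u | (u <= T)%R]).
  by apply: measurable_under => //; rewrite (_ : [set _ | _] = `]-oo, T]%classic).
transitivity (\int[N i w]_(y in @strip R)
    (\1_(under (fun u => lam i (w, u)) [set u | (u <= T)%R]) y)%:E); last first.
  rewrite integral_indic//; last exact: measurable_strip.
  by congr (N i w _); apply/setIidPl => y [].
apply: eq_integral => y; rewrite inE => sy; rewrite below_off// subr0.
rewrite ger0_norm ?below_ge0// /window_weight weight0 mulr1 !indicE /below/=.
congr (_%:E); have [yl|ly] := leP y.2 _; last first.
  rewrite mulr0 memNset// => -[_ _ /le_lt_trans/(_ ly)].
  by rewrite ltxx.
rewrite mulr1; congr ((nat_of_bool _)%:R); apply/idP/idP; rewrite !inE/= in_itv/=.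
  by case: sy => y0 z0 /andP[_ yT].
by case=> -> _ _ ->.
Qed.

End window.

Section count.
Context (R : realType).
Variables (mu : {measure set (R * R) -> \bar R}) (g : R -> R).
Hypotheses (mg : measurable_fun setT g) (mu0 : mu ([set 0] `*` `[0, +oo[) = 0%E).

(** The equation integrates from time 0 included, the subgraph starts after time 0; the difference
    lies on the line at time 0, which [mu0] makes null. *)
Lemma count_equation (t : R) :
  (\int[mu]_(x in `[0%R, t] `*` `[0%R, +oo[) (\1_[set y : R * R | (y.2 <= g y.1)%R] x)%:E)%E =
  mu (under g [set u | u <= t]).
Proof.
have mle : measurable [set y : R * R | y.2 <= g y.1].
  have := measurable_fun_ler (@measurable_snd _ _ R R) (measurableT_comp mg (@measurable_fst _ _ R R)).
  by move=> /(_ measurableT [set true]); rewrite setTI; exact.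
have mQ : measurable (`[0%R, t] `*` `[0%R, +oo[ : set (R * R)) by exact: measurableX.
have m0 : measurable ([set 0%R] `*` `[0%R, +oo[ : set (R * R)) by exact: measurableX.
have mU : measurable (under g [set u | u <= t]).
  by apply: measurable_under => //; rewrite (_ : [set _ | _] = `]-oo, t]%classic).
rewrite integral_indic// setIC; apply/eqP; rewrite eq_le; apply/andP; split.
  rewrite -[leRHS]adde0 -[X in (_ <= _ + X)%E]mu0.
  apply: (@le_trans _ _ (mu (under g [set u | u <= t] `|` ([set 0] `*` `[0, +oo[)))).
    apply: le_measure; rewrite ?inE.
    - exact: measurableI.
    - exact: measurableU.
    - move=> y [[/=]]; rewrite !in_itv/= andbT => /andP[y0 yt] z0 zg.
      move: y0; rewrite le_eqVlt => /orP[/eqP y0|y0]; [right|left].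
        by split => /=; rewrite ?in_itv/= ?z0// -y0.
      by split.
  exact: measureU2.
apply: le_measure; rewrite ?inE//; first exact: measurableI.
move=> y [y0 z0 zg /= yt]; split => //; split => /=; rewrite in_itv/= ?andbT//.
by rewrite ltW.
Qed.

End count.

(** * From intensities to adapted counting paths *)

Section good_paths.
Context d (Omega : measurableType d) (R : realType) (S : countType).
Variables (P : probability Omega R) (G : R -> set (set Omega)) (E : set (S * S)).
Variable N : S -> Omega -> {measure set (R * R) -> \bar R}.
Variables (K : S -> S -> R -> R) (p : S -> R).
Hypotheses (hG : filtration G) (hN : forall i, compensated P G (N i)).
Hypothesis mK : forall j i, E (j, i) -> measurable_fun setT (K j i).
Hypothesis p_gt0 : forall i, 0 < p i.
Variable phi : S -> S -> R -> R.
Hypothesis phiK : forall j i r, E (j, i) -> 0 < r -> phi j i r = K j i r.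
Local Open Scope ereal_scope.
Local Notation predT := (g_sigma_algebraType (pred_rect G (@id R))).
Local Notation predictable := (predictable G).
Local Notation drive := (drive E N K).
Local Notation off := (@off _ Omega R S).
Local Notation locally_finite := (locally_finite P p).
Implicit Types lam : S -> Omega * R -> R.

Definition counts lam (Z : S -> R -> R) w := forall i t, (0 <= t)%R ->
  (Z i t)%:E = N i w (under (fun u => lam i (w, u)) [set u | (u <= t)%R]).

Lemma integral_path_shot lam Z w j (k : R -> R) s : predictable lam ->
  measurable_fun setT k -> good (N j) w -> counts lam Z w ->
  (\int[path_measure (Z j)]_(u in `[0%R, s[) k (s - u))%R = shot (N j) k (lam j) (w, s).
Proof.
move=> ml mk gw cZ; have mlw := predictable_section hG w (ml j).
rewrite /shot good_tame_past// /Rintegral; congr fine.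
rewrite (integral_path_measure_counting mlw (cZ j) (F := fun u => k (s - u)%R))//; last first.
  by apply: measurableT_comp => //; exact: measurable_funB.
rewrite bigcup_past integral_mkcond [RHS]integral_mkcond; apply: eq_integral => y _ /=.
rewrite !patchE /below/=.
have [/andP[y0 ys]|nys] := boolP (0 < y.1 < s)%R; last first.
  rewrite memNset; last first.
    by move=> [y0 _ _ /=]; rewrite in_itv/= => /andP[_ ys]; rewrite y0 ys in nys.
  by rewrite memNset// => -[y0s _]; move/negP : nys; apply.
have [z0|z0] := leP 0%R y.2; last first.
  by rewrite !memNset//= => -[_]; rewrite leNgt z0.
rewrite [in RHS]mem_set/=; last by split => //; rewrite y0.
case: ifPn => [|/negP nU].
  by rewrite inE => -[_ _ -> _]; rewrite mulr1.
rewrite ifF ?mulr0//; apply/negbTE/negP => zl; apply: nU.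
by rewrite inE; split => //=; rewrite in_itv/= ltW.
Qed.

(** The input evaluates [phi j i] at [s - u] for [u < s] only, where it agrees with [K j i]. *)
Lemma hawkes_input_drive lam (Z : S -> R -> Omega -> R) w i s : predictable lam ->
  (forall j, good (N j) w) -> counts lam (fun j t => Z j t w) w ->
  hawkes_input E phi Z i s w = drive lam i (w, s).
Proof.
move=> ml gw cZ; apply: eq_countable_sum => j Eji.
rewrite -(integral_path_shot (k := K j i) s ml _ (gw j) cZ); last exact: mK.
apply: eq_Rintegral => u; rewrite inE/= in_itv/= => /andP[_ us].
by rewrite phiK// subr_gt0.
Qed.

(** Bounded segments of the line have area 0, hence mean mass 0, and countably many of them cover
    it. *)
Lemma ae_no_atom : {ae P, forall w, forall i, N i w ([set 0%R] `*` `[0%R, +oo[) = 0}.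
Proof.
apply: ae_countable => i; have [mN _ _ EN] := hN i.
pose A n : set (R * R) := [set 0%R] `*` `[0%R, n%:R].
have mA n : measurable (A n) by exact: measurableX.
have Aq n : A n `<=` quadrant.
  move=> [u z] [/= -> ]; rewrite in_itv/= => /andP[z0 _].
  by split; rewrite /= in_itv/= ?lexx ?z0.
have leb0 n : leb2 R (A n) = 0.
  rewrite [LHS]product_measure1E//.
  have e : leb [set 0%R] = 0 :> \bar R := lebesgue_measure_set1 0%R.
  by rewrite [X in X * _]e mul0e.
have : {ae P, forall w, forall n, N i w (A n) = 0}.
  apply/ae_foralln => n.
  have mNn : measurable_fun setT (fun w => N i w (A n)) by exact: mN.
  have := (@ae_eq_integral_abs _ _ _ P setT measurableT _ mNn).1; case.
    under eq_integral do rewrite gee0_abs//.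
    by rewrite EN// leb0.
  by move=> B [mB B0 hB]; exists B; split => // w nw; apply: hB => wB; apply: nw; exact: wB.
apply: filterS => w hw.
rewrite (_ : [set 0%R] `*` _ = \bigcup_n A n); last first.
  apply/seteqP; split=> [y [/= y0]|y [n _ [/= ->]]]; rewrite !in_itv/= ?andbT; last by move=> /andP[->].
  move=> z0; exists (Num.truncn y.2).+1 => //; split => //=.
  by rewrite in_itv/= z0 ltW// truncnS_gt.
apply: measure_negligible; first exact: bigcupT_measurable.
by apply: negligible_bigcup => n; exists (A n); split => //; exact: mA.
Qed.

Lemma ae_count_lty lam : predictable lam -> locally_finite lam ->
  {ae P, forall w, forall i t, N i w (under (fun u => lam i (w, u)) [set u | (u <= t)%R]) < +oo}.
Proof.
move=> ml fl; apply: ae_countable => i.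
have mo : predictable off := @predictable_off _ _ _ _ G.
have : {ae P, forall w, forall n, window_gap N n%:R 0 i lam off w < +oo}.
  apply/ae_foralln => n.
  have mw := measurable_window_gap hG hN n%:R 0 i ml mo.
  have : P.-integrable setT (window_gap N n%:R 0 i lam off).
    apply/integrableP; split; first exact: mw.
    under eq_integral do rewrite gee0_abs ?window_gap_ge0//.
    have := mean_window_gap_le hG hN p_gt0 n%:R 0 i ml mo.
    move=> /le_lt_trans/(_ (fl _ (ler0n _ n))); apply: lty_pmull => //.
    by apply: integral_ge0 => w _; exact: window_gap_ge0.
  move=> /(integrable_ae measurableT); apply: filterS => w /(_ Logic.I).
  by rewrite ge0_fin_numE// window_gap_ge0.
apply: filterS2 (ae_good (hN i)) => w gw hw t.
have mlw := predictable_section hG w (ml i).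
apply: le_lt_trans (hw (Num.truncn t).+1); rewrite (window_gap_count hG)//.
have mr r : measurable [set u : R | (u <= r)%R] by rewrite (_ : [set _ | _] = `]-oo, r]%classic).
apply: le_measure; rewrite ?inE; [exact: measurable_under|exact: measurable_under|].
apply: le_under => u /= /le_trans; apply; exact: ltW (truncnS_gt _).
Qed.

Definition window (t : R) (n : nat) : set (R * R) := `]0%R, t] `*` `[0%R, n%:R].

Lemma measurable_window t n : measurable (window t n).
Proof. exact: measurableX. Qed.

Lemma bigcup_window t : \bigcup_n window t n = [set y | (0 < y.1 <= t)%R /\ (0 <= y.2)%R].
Proof.
apply/seteqP; split=> [y [n _ [/=]]|[u z] [/= us z0]].
  by rewrite !in_itv/= => -> /andP[].
exists (Num.truncn z).+1 => //; split; rewrite /= in_itv//= z0/=.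
exact: ltW (truncnS_gt _).
Qed.

(** Tameness is tested on windows up to [t], not by [good], which looks at all times: the value at
    [t] is thus measurable for [G t] itself, without completion. *)
Definition counting_path lam i t w : R :=
  fine (if tame (N i) (fun n _ => window t n) w then
    \int[N i w]_(y in \bigcup_n window t n) (below (lam i) w y)%:E else 0).

Lemma adapted_counting_path lam i t : predictable lam -> (0 <= t)%R ->
  measurable_fun [set: g_sigma_algebraType (G t)] (counting_path lam i t).
Proof.
move=> ml t0; pose T := g_sigma_algebraType (G t).
pose W := [set x : T * (R * R) | (0 < x.2.1 <= t)%R].
pose F (x : T * (R * R)) : \bar R := (below (lam i) x.1 x.2)%:E.
have mage : measurable_fun [set: T * (R * R)] (fun x => x.2.1 : R).
  by apply: measurableT_comp => //; exact: measurable_fst.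
have mfst : measurable_fun [set: R * R] (@fst R R) by [].
have mW : measurable W.
  rewrite (_ : W = [set: T * (R * R)] `&` (fun x => x.2.1) @^-1` `]0%R, t]).
    exact: mage.
  by rewrite setTI; apply/seteqP; split=> x /=; rewrite in_itv.
have mF : measurable_fun W F.
  apply/measurable_EFinP => mW'.
  have mu := measurable_until hG t0 mfst.
  have ml' : measurable_fun W (fun x => lam i (x.1, x.2.1)).
    have := @measurable_comp _ _ _ _ _ _ [set: predT] (lam i) _ _ measurableT (fun _ _ => Logic.I) (ml i) mu.
    exact.
  move: (mW'); apply: measurable_fun_if => //.
  apply: measurable_fun_ler => //.
  by apply: measurable_funTS; apply: measurableT_comp => //; exact: measurable_snd.
have mw n (w : T) : measurable (window t n) by exact: measurable_window.
have ndw (w : T) : nondecreasing_seq (window t).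
  move=> a b ab; apply/subsetPset => y [y1 /=]; rewrite in_itv/= => /andP[z0 za].
  by split => //=; rewrite in_itv/= z0 (le_trans za)// ler_nat.
have mN n B : measurable B -> measurable_fun [set: T] (fun w => N i w (B `&` window t n)).
  move=> mB; have [_ + _ _] := hN i; apply => //.
    by apply: measurableI => //; exact: measurable_window.
  move=> y [_ [/=]]; rewrite !in_itv/= => /andP[y0 yt] /andP[z0 _].
  by rewrite yt z0 ltW.
have := @ge0_measurable_fun_integral_tame _ _ T _ R (fun w : T => N i w) (fun n _ => window t n)
  mw ndw mN (F \_ W).
have FW0 x : 0 <= (F \_ W) x.
  by rewrite patchE; case: ifPn => // _; rewrite lee_fin below_ge0.
have mFW : measurable_fun [set: T * (R * R)] (F \_ W).
  by apply/measurable_restrict => //; apply: measurable_funS mF => // x [].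
move=> /(_ FW0 mFW) mI; rewrite /counting_path; apply: measurableT_comp => //.
apply: eq_measurable_fun mI => w _.
have e : \int[N i w]_(y in \bigcup_n window t n) (F \_ W) (w, y) =
    \int[N i w]_(y in \bigcup_n window t n) (below (lam i) w y)%:E.
  apply: eq_integral => y; rewrite bigcup_window inE/= => -[yt _].
  by rewrite patchE mem_set.
by rewrite e.
Qed.

Lemma counts_counting_path lam w : predictable lam -> (forall i, good (N i) w) ->
  (forall i t, N i w (under (fun u => lam i (w, u)) [set u | (u <= t)%R]) < +oo) ->
  counts lam (fun i t => counting_path lam i t w) w.
Proof.
move=> ml gw fw i t t0; have mlw := predictable_section hG w (ml i).
have tw : tame (N i) (fun n _ => window t n) w.
  apply/asboolP => n; have /asboolP gi := gw i.
  pose m := maxn n (Num.truncn t).+1.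
  apply: le_lt_trans (gi m); apply: le_measure; rewrite ?inE.
  - exact: measurable_window.
  - exact: measurable_box.
  move=> y [/=]; rewrite !in_itv/= => /andP[y0 yt] /andP[z0 zn].
  have nm : (n%:R <= m%:R :> R)%R by rewrite ler_nat leq_maxl.
  have sm : (t <= m%:R :> R)%R.
    by rewrite (le_trans (ltW (truncnS_gt _)))// ler_nat leq_maxr.
  split; rewrite /= in_itv/=.
    by rewrite y0 (le_trans yt).
  by rewrite z0 (le_trans zn).
have mU : measurable (under (fun u => lam i (w, u)) [set u | (u <= t)%R]).
  by apply: measurable_under => //; rewrite (_ : [set _ | _] = `]-oo, t]%classic).
rewrite /counting_path tw.
have -> : \int[N i w]_(y in \bigcup_n window t n) (below (lam i) w y)%:E =
    N i w (under (fun u => lam i (w, u)) [set u | (u <= t)%R]).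
  transitivity (\int[N i w]_(y in \bigcup_n window t n)
    (\1_(under (fun u => lam i (w, u)) [set u | (u <= t)%R]) y)%:E); last first.
    rewrite integral_indic//; last by apply: bigcupT_measurable => n; exact: measurable_window.
    by congr (N i w _); apply/setIidPl => y [y0 z0 _ yt]; rewrite bigcup_window/= y0.
  apply: eq_integral => y; rewrite bigcup_window inE/= => -[/andP[y0 yt] z0].
  rewrite /below indicE; have [yl|ly] := leP y.2 _.
    by rewrite mem_set.
  by rewrite memNset// => -[_ _ /le_lt_trans/(_ ly)]; rewrite ltxx.
by rewrite fineK// ge0_fin_numE.
Qed.

End good_paths.

(** * Existence *)

Lemma mass_under_eq d (Omega : measurableType d) (R : realType)
    (mu : {measure set (R * R) -> \bar R}) (l l' : Omega * R -> R) w t :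
  measurable_fun setT (fun u => l (w, u)) -> measurable_fun setT (fun u => l' (w, u)) ->
  {ae mu, forall y, @strip R y -> below l w y = below l' w y} ->
  mu (under (fun u => l (w, u)) [set u | u <= t]) =
  mu (under (fun u => l' (w, u)) [set u | u <= t]).
Proof.
move=> ml ml' agree.
have mU f : measurable_fun setT f -> measurable (under f [set u : R | u <= t]).
  by move=> mf; apply: measurable_under => //; rewrite (_ : [set _ | _] = `]-oo, t]%classic).
have muE A : measurable A -> mu A = (\int[mu]_y (\1_A y)%:E)%E.
  by move=> mA; rewrite integral_indic// setIT.
rewrite !muE; try exact: mU.
apply: ae_eq_integral => //.
- by apply/measurable_EFinP; exact: measurable_indic (mU _ ml).
- by apply/measurable_EFinP; exact: measurable_indic (mU _ ml').
apply: filterS agree => y ey _; congr (_%:E); rewrite !indicE.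
have key (f g : Omega * R -> R) : (@strip R y -> below f w y = below g w y) ->
    under (fun u => f (w, u)) [set u | u <= t] y ->
    under (fun u => g (w, u)) [set u | u <= t] y.
  move=> e [y0 z0 zl yt]; split => //.
  move: (e (conj y0 z0)); rewrite /below zl.
  by case: ifP => // _ /eqP; rewrite oner_eq0.
by congr ((nat_of_bool _)%:R); apply/idP/idP; rewrite !inE; apply: key => // sy; rewrite ey.
Qed.

Section existence.
Context d (Omega : measurableType d) (R : realType) (S : countType).
Variables (P : probability Omega R) (G : R -> set (set Omega)) (E : set (S * S)).
Variable N : S -> Omega -> {measure set (R * R) -> \bar R}.
Variables (K : S -> S -> R -> R) (h : S -> R -> R) (c p : S -> R) (Phi : R -> R).
Hypotheses (hG : filtration G) (hN : forall i, compensated P G (N i)).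
Hypotheses (mK : forall j i, E (j, i) -> measurable_fun setT (K j i))
  (K_le0 : forall j i r, r <= 0 -> K j i r = 0).
Hypotheses (c_ge0 : forall i, 0 <= c i) (p_gt0 : forall i, 0 < p i).
Hypotheses (Phi_ge0 : forall r, 0 <= Phi r) (mPhi : measurable_fun setT Phi)
  (Phi_le0 : forall r, r <= 0 -> Phi r = 0)
  (Phi_int : forall T, 0 <= T -> leb.-integrable `]0, T] (EFin \o Phi)).
Hypothesis h_ge0 : forall i x, 0 <= h i x.
Hypothesis h_lip : forall i x y, `|h i x - h i y| <= c i * `|x - y|.
Hypothesis h_sum : (\esum_(i in [set: S]) (h i 0 * p i)%:E < +oo)%E.
Hypothesis KPhi : forall r j,
  (\esum_(i in [set i | E (j, i)]) (c i * p i * `|K j i r|)%:E <= (p j * Phi r)%:E)%E.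
Variable phi : S -> S -> R -> R.
Hypothesis phiK : forall j i r, E (j, i) -> 0 < r -> phi j i r = K j i r.
Local Open Scope ereal_scope.
Local Notation predictable := (predictable G).
Local Notation off := (@off _ Omega R S).
Local Notation picard := (picard E N K h).
Local Notation dist := (dist P p).
Local Notation locally_finite := (locally_finite P p).
Implicit Types lam : S -> Omega * R -> R.

(** The path counts the points below [lam], whereas the equation asks for those below [picard lam];
    by [ae_eq_below] these are almost surely the same points, even if the two intensities differ at
    some times. *)
Lemma hawkes_counting_path lam : predictable lam -> locally_finite lam ->
  (forall T, (0 <= T)%R -> exists b : R, wint T b (dist (picard lam) lam) = 0) ->
  hawkes_process P G N E phi h (counting_path N lam).
Proof.
move=> ml fl fp; have mp := predictable_picard hG hN mK h_lip ml.
have ae_counts : {ae P, forall w, (forall i, good (N i) w) /\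
    counts N lam (fun i t => counting_path N lam i t w) w}.
  have gall : {ae P, forall w, forall i, good (N i) w}.
    by apply: ae_countable => i; exact: ae_good (hN i).
  apply: filterS2 gall (ae_count_lty hG hN p_gt0 ml fl) => w gw fw; split => //.
  exact: (counts_counting_path hG ml gw fw).
split.
- move=> i t t0 _ [B mB <-].
  have := adapted_counting_path hG hN i ml t0 measurableT mB.
  rewrite /measurable/= sigma_algebra_id//.
  by have [+ _ _] := hG; exact.
- apply: filterS ae_counts => w [_ cw] i.
  exact: counting_cadlag (predictable_section hG w (ml i)) (cw i).
- apply: filterS3 ae_counts (ae_no_atom hN) (ae_eq_below hG hN p_gt0 mp ml fp).
  move=> w [gw cw] atom agree i t t0.
  have mpw := predictable_section hG w (mp i).
  have mlw := predictable_section hG w (ml i).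
  have mray : measurable [set u : R | (u <= t)%R] by rewrite (_ : [set _ | _] = `]-oo, t]%classic).
  transitivity (N i w (under (fun u => picard lam i (w, u)) [set u | (u <= t)%R])); last first.
    rewrite -count_equation//; apply: eq_integral => y _; congr (_%:E).
    rewrite !indicE; congr ((nat_of_bool _)%:R).
    by apply/idP/idP; rewrite !inE/= (hawkes_input_drive hG mK phiK i y.1 ml gw cw).
  rewrite cw//.
  apply: mass_under_eq => //; apply: filterS (agree i) => y ey sy.
  by rewrite ey.
Qed.

(** By [esum_window_gap] at rate 0 against [off], the weighted mean of the counts is bounded by the
    integral that [locally_finite] controls. *)
Lemma finite_mean_counting_path lam : predictable lam -> locally_finite lam ->
  finite_weighted_mean P p (counting_path N lam).
Proof.
move=> ml fl t t0; have mo : predictable off := @predictable_off _ _ _ _ G.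
apply: le_lt_trans (fl t t0); rewrite -(esum_window_gap hG hN p_gt0 t 0 ml mo).
apply: le_esum => i _; apply: lee_wpmul2l; first by rewrite lee_fin ltW.
rewrite unlock.
have mZ : measurable_fun setT (counting_path N lam i t).
  have mf := adapted_counting_path hG hN i ml t0.
  move=> _ B mB; have := mf measurableT B mB; rewrite /measurable/= sigma_algebra_id//.
    by have [_ + _] := hG; apply.
  by have [+ _ _] := hG; exact.
have Z0 w : (0 <= counting_path N lam i t w)%R.
  rewrite /counting_path fine_ge0//; case: ifP => // _.
  by apply: integral_ge0 => y _; rewrite lee_fin below_ge0.
apply: ae_ge0_le_integral => //.
- by move=> w _; rewrite lee_fin.
- exact/measurable_EFinP.
- by move=> w _; exact: window_gap_ge0.
- exact: (measurable_window_gap hG hN).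
have gall : {ae P, forall w, forall i, good (N i) w}.
  by apply: ae_countable => j; exact: ae_good (hN j).
apply: filterS2 gall (ae_count_lty hG hN p_gt0 ml fl) => w gw fw _.
rewrite (window_gap_count hG t ml (gw i)).
by rewrite (counts_counting_path hG ml gw fw i t0).
Qed.

Lemma hawkes_process_exists : exists Z,
  hawkes_process P G N E phi h Z /\ finite_weighted_mean P p Z.
Proof.
exists (counting_path N (limit_intensity E N K h)).
have ml := predictable_limit hG hN mK h_lip.
have fl : locally_finite (limit_intensity E N K h).
  exact: (locally_finite_limit (c := c) (Phi := Phi) hG).
split; last exact: finite_mean_counting_path.
apply: hawkes_counting_path => // T T0.
exact: (limit_fixed_point (c := c) (Phi := Phi) hG).
Qed.

End existence.

(** * Uniqueness *)

Section completion.
Context d (Omega : measurableType d) (R : realType).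
Variables (P : probability Omega R) (F : R -> set (set Omega)).
Hypothesis hF : filtration F.

Definition completion (t : R) : set (set Omega) :=
  [set A | measurable A /\ exists B, [/\ F t B, P.-negligible (A `\` B) &
     P.-negligible (B `\` A)]].

Let mF t B : 0 <= t -> F t B -> measurable B.
Proof. by move=> t0; have [_ + _] := hF; exact. Qed.

Lemma completion_sub t : 0 <= t -> F t `<=` completion t.
Proof.
move=> t0 B FB; split; first exact: (mF t0).
by exists B; rewrite setDv; split => //; exact: negligible_set0.
Qed.

Lemma completion_negligible t A : 0 <= t -> measurable A -> P A = 0%E -> completion t A.
Proof.
move=> t0 mA A0; split => //; exists set0; split.
- by have [+ _ _] := hF; move=> /(_ t t0) [].
- by rewrite setD0; exact/negligibleP.
- by rewrite set0D; exact: negligible_set0.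
Qed.

Lemma filtration_completion : filtration completion.
Proof.
have [sF _ homF] := hF; split.
- move=> t t0; have [F0 FC FU] := sF t t0; split.
  + by apply: completion_sub.
  + move=> A [mA [B [FB AB BA]]]; rewrite setTD; split; first exact: measurableC.
    exists (setT `\` B); split; [exact: FC| |].
      apply: negligibleS BA => x [nAx nBx]; split => //.
      by apply: contrapT => Bx; apply: nBx; split.
    by apply: negligibleS AB => x [[_ nBx] /contrapT].
  + move=> A hA; have /choice[B hB] := fun n => (hA n).2.
    split; first by apply: bigcupT_measurable => n; have [] := hA n.
    exists (\bigcup_n B n); split; first by apply: FU => n; have [] := hB n.
      apply: (@negligibleS _ _ _ P (\bigcup_n (A n `\` B n))); last first.
        by apply: negligible_bigcup => n; have [] := hB n.
      by move=> x [[n _ Anx] nB]; exists n => //; split => // Bnx; apply: nB; exists n.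
    apply: (@negligibleS _ _ _ P (\bigcup_n (B n `\` A n))); last first.
      by apply: negligible_bigcup => n; have [] := hB n.
    by move=> x [[n _ Bnx] nA]; exists n => //; split => // Anx; apply: nA; exists n.
- by move=> t t0 A [].
- move=> s t s0 st A [mA [B [FB AB BA]]]; split => //; exists B; split => //.
  exact: homF st _ FB.
Qed.

Lemma measurable_fun_completion t d' (V : measurableType d') (f : Omega -> V) : 0 <= t ->
  measurable_fun [set: g_sigma_algebraType (F t)] f ->
  measurable_fun [set: g_sigma_algebraType (completion t)] f.
Proof.
move=> t0 mf _ B mB; have := mf measurableT B mB.
apply: smallest_sub; first exact: smallest_sigma_algebra.
by move=> C FC; apply: sub_sigma_algebra; exact: completion_sub.
Qed.

(** Replacing an event by an almost surely equal event of [F s] changes neither its probability nor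
    the integral over it. *)
Lemma compensated_completion N : compensated P F N -> compensated P completion N.
Proof.
move=> [mN adN EA EN]; split => //.
  by move=> t B t0 mB Bt; apply: measurable_fun_completion => //; exact: adN.
move=> s A B s0 [mA [A' [FA' AA' A'A]]] mB Bs Boo.
have mA' := mF s0 FA'.
have mNB : measurable_fun setT (fun w => N w B).
  apply: mN => // y /Bs [/=]; rewrite !in_itv/= !andbT => sy y0.
  by split; rewrite /= in_itv/= andbT// (le_trans s0)// ltW.
have ae_eq_patch : {ae P, forall w, (w \in A) = (w \in A')}.
  apply: negligibleS (negligibleU AA' A'A) => w /= nw.
  have [wA|wA] := pselect (A w); [left|right]; split => //.
    by move=> wA'; apply: nw; rewrite !mem_set.
  by apply: contrapT => wA'; apply: nw; rewrite !memNset.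
transitivity (\int[P]_(w in A') N w B)%E.
  rewrite integral_mkcond [RHS]integral_mkcond; apply: ae_eq_integral => //.
  - by apply/measurable_restrict => //; exact: measurable_funTS.
  - by apply/measurable_restrict => //; exact: measurable_funTS.
  by apply: filterS ae_eq_patch => w e _; rewrite !patchE e.
rewrite (EA s)//; congr (_ * _)%E.
have PE C : measurable C -> P C = (\int[P]_w (\1_C w)%:E)%E.
  by move=> mC; rewrite integral_indic// setIT.
rewrite !PE//; apply: ae_eq_integral => //.
- by apply/measurable_EFinP; exact: measurable_indic.
- by apply/measurable_EFinP; exact: measurable_indic.
by apply: filterS ae_eq_patch => w e _; rewrite !indicE e.
Qed.

End completion.

Lemma path_measure_itvoc (R : realType) (f : R -> R) (a b : R) :
  {homo prolong f : x y / x <= y} -> right_continuous (prolong f) -> a <= b ->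
  path_measure f (`]a, b]%classic : set R) = (prolong f b - prolong f a)%:E.
Proof.
move=> ndf rcf ab; rewrite /path_measure; case: pselect => [H|]; last by case.
exact: lebesgue_stieltjes_itvoc.
Qed.

(** Dynkin's argument from half-open intervals, whose mass is a difference of two values of the
    path. After intersection with []0, q]] only times in [[0, q]] are consulted, so the lemma can be
    applied with the sigma-algebra of time [q]. *)
Lemma measurable_path_measure dT (T : measurableType dT) (R : realType)
    (f : T -> R -> R) (q : R) (B : set R) : 0 <= q ->
  (forall w, {homo prolong (f w) : x y / x <= y}) ->
  (forall w, right_continuous (prolong (f w))) ->
  (forall r, 0 <= r <= q -> measurable_fun setT (fun w => f w r)) ->
  measurable B ->
  measurable_fun setT (fun w => path_measure (f w) (B `&` `]0, q])).
Proof.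
move=> q0 ndf rcf mf mB.
have itvE w a b : a <= b -> path_measure (f w) (`]a, b]%classic : set R) = (prolong (f w) b - prolong (f w) a)%:E.
  by move=> ab; exact: path_measure_itvoc.
have mp r : r <= q -> measurable_fun setT (fun w => prolong (f w) r).
  move=> rq; rewrite /prolong; apply: mf.
  by rewrite le_max lexx orbT ge_max rq.
pose D (B : set R) := measurable_fun setT (fun w => path_measure (f w) (B `&` `]0, q])).
have DT : D setT.
  rewrite /D; under eq_fun do rewrite setTI itvE//.
  by apply/measurable_EFinP; apply: measurable_funB; exact: mp.
apply: (@dynkin_induction _ (measurableTypeR R) (@ocitv R) D) => //.
- exact: ocitvI.
- move=> _ [[a b] _ <-] /=.
  have [ab|ba] := leP (Num.max a 0) (Num.min b q); last first.
    rewrite /D (_ : _ `&` _ = set0).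
      by under eq_fun do rewrite measure0; exact: measurable_cst.
    rewrite -subset0 => u [] /=; rewrite !in_itv/= => /andP[au ub] /andP[u0 uq].
    have h1 : Num.max a 0 < u by rewrite gt_max au.
    have h2 : u <= Num.min b q by rewrite le_min ub.
    by have := lt_trans (lt_le_trans h1 h2) ba; rewrite ltxx.
  rewrite /D (_ : _ `&` _ = `]Num.max a 0, Num.min b q]%classic); last first.
    apply/seteqP; split => u /=; rewrite !in_itv/= gt_max le_min.
      by move=> [/andP[-> ->] /andP[-> ->]].
    by move=> /andP[/andP[-> ->] /andP[-> ->]].
  under eq_fun do rewrite itvE//.
  apply/measurable_EFinP; apply: measurable_funB; apply: mp; last first.
    by rewrite (le_trans ab)// ge_min lexx orbT.
  by rewrite ge_min lexx orbT.
- move=> C mC DC.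
  rewrite /D (_ : (fun w => _) = (fun w => path_measure (f w) (`]0%R, q]%classic : set R) -
      path_measure (f w) (C `&` `]0%R, q]))%E); last first.
    apply/funext => w; rewrite (setIC C) -measureD//.
    - by congr (path_measure (f w) _); rewrite setDE setIC.
    - apply: (@le_lt_trans _ _ (prolong (f w) q - prolong (f w) 0)%:E); last exact: ltry.
      by rewrite -(itvE w 0 q q0).
  apply: emeasurable_funB => //.
  by have := DT; rewrite /D; under eq_fun do rewrite setTI.
- move=> C mC tC DC.
  rewrite /D (_ : (fun w => _) = (fun w =>
      \sum_(0 <= n <oo) path_measure (f w) (C n `&` `]0%R, q]))%E); last first.
    apply/funext => w; rewrite setI_bigcupl measure_semi_bigcup//.
    - by move=> n; exact: measurableI.
    - exact: trivIset_setIr.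
    - by apply: bigcupT_measurable => n; exact: measurableI.
  by apply: ge0_emeasurable_sum => // n _; exact: DC.
Qed.

(* Unlike [ge0_subset_integral], no measurability: the integral of a nonnegative
   function is a supremum over the simple functions below it. *)
Lemma ge0_subset_integral_any d (T : measurableType d) (R : realType)
    (mu : {measure set T -> \bar R}) (A B : set T) (f : T -> \bar R) :
  (forall x, 0 <= f x)%E -> A `<=` B ->
  (\int[mu]_(x in A) f x <= \int[mu]_(x in B) f x)%E.
Proof.
move=> f0 AB; rewrite !ge0_integralE//; apply: le_ereal_sup => _ [k kf <-].
exists k => // x; apply: le_trans (kf x) _; rewrite !patchE.
case: ifPn => [|_]; last by case: ifPn.
by rewrite inE => /AB xB; rewrite mem_set.
Qed.

(** * The intensity of a given solution *)

Section solution.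
Context d (Omega : measurableType d) (R : realType) (S : countType).
Variables (P : probability Omega R) (G : R -> set (set Omega)) (E : set (S * S)).
Variable N : S -> Omega -> {measure set (R * R) -> \bar R}.
Variables (K : S -> S -> R -> R) (h : S -> R -> R) (c p : S -> R).
Hypotheses (hG : filtration G) (hN : forall i, compensated P G (N i)).
Hypothesis mK : forall j i, E (j, i) -> measurable_fun setT (K j i).
Hypothesis p_gt0 : forall i, 0 < p i.
Hypothesis h_lip : forall i x y, `|h i x - h i y| <= c i * `|x - y|.
Variable phi : S -> S -> R -> R.
Hypothesis phiK : forall j i r, E (j, i) -> 0 < r -> phi j i r = K j i r.
Variable Z : S -> R -> Omega -> R.
Hypotheses (hZ : hawkes_process P G N E phi h Z) (Z_mean : finite_weighted_mean P p Z).
Local Open Scope ereal_scope.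
Local Notation Gc := (completion P G).
Local Notation predT := (g_sigma_algebraType (pred_rect Gc (@id R))).
Local Notation predictable := (predictable Gc).
Local Notation off := (@off _ Omega R S).
Local Notation picard := (picard E N K h).
Local Notation dist := (dist P p).
Local Notation locally_finite := (locally_finite P p).
Implicit Types lam : S -> Omega * R -> R.

Let hGc : filtration Gc. Proof. exact: filtration_completion. Qed.

Let hNc i : compensated P Gc (N i). Proof. exact: compensated_completion. Qed.

Definition regular w := [/\ forall i, good (N i) w,
  forall i, N i w ([set 0%R] `*` `[0%R, +oo[) = 0, forall i, cadlag (Z i ^~ w) &
  forall i t, (0 <= t)%R -> (Z i t w)%:E =
    \int[N i w]_(x in `[0%R, t] `*` `[0%R, +oo[)
      (\1_[set y : R * R | (y.2 <= h i (hawkes_input E phi Z i y.1 w))%R] x)%:E].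

Lemma ae_regular : {ae P, forall w, regular w}.
Proof.
have [_ cZ eZ] := hZ.
have gall : {ae P, forall w, forall i, good (N i) w}.
  by apply: ae_countable => j; exact: ae_good (hN j).
apply: filterS2 (filterI gall (ae_no_atom hN)) (filterI cZ eZ) => w [gw aw] [cw ew].
by split.
Qed.

Lemma exceptional_set : exists A : set Omega,
  [/\ measurable A, P A = 0 & forall w, ~ A w -> regular w].
Proof.
have [A [mA PA hA]] := ae_regular; exists A; split => // w nA.
by apply: contrapT => nr; apply: nA; exact: hA.
Qed.

Section modification.
Variable A : set Omega.
Hypotheses (mA : measurable A) (PA : P A = 0) (hA : forall w, ~ A w -> regular w).

(** Setting the paths to 0 on the exceptional set makes all of them nondecreasing and
    right-continuous; the price is adaptedness to the completed filtration only. *)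
Definition modification i t w : R := if w \in A then 0%R else Z i t w.

Lemma modification_nd i w : {homo prolong (modification i ^~ w) : x y / (x <= y)%R}.
Proof.
move=> x y xy; rewrite /prolong /modification; case: ifPn => // /negP wA.
have [_ _ _ eZ] : regular w by apply: hA => Aw; apply: wA; rewrite inE.
rewrite -lee_fin !eZ ?le_max ?lexx ?orbT//.
(* The measurability in time of [hawkes_input] is not established at this point, so monotonicity
   must come without it. *)
apply: ge0_subset_integral_any => [u|u [/=]]; first by rewrite lee_fin.
rewrite !in_itv/= => /andP[u0 ux] z0; rewrite u0 z0 (le_trans ux)//.
by rewrite ge_max !le_max xy lexx orbT.
Qed.

Lemma modification_rc i w : right_continuous (prolong (modification i ^~ w)).
Proof.
apply: prolong_right_continuous => t t0.
rewrite /modification; case: ifPn => [_|/negP wA]; first exact: cvg_cst.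
have [_ _ /(_ i) [+ _] _] : regular w by apply: hA => Aw; apply: wA; rewrite inE.
exact.
Qed.

Lemma adapted_modification i t : (0 <= t)%R ->
  measurable_fun [set: g_sigma_algebraType (Gc t)] (modification i t).
Proof.
move=> t0; apply: measurable_fun_if => //.
- apply: (measurable_fun_bool true); rewrite setTI.
  apply: sub_sigma_algebra; rewrite (_ : _ @^-1` _ = A).
    exact: completion_negligible.
  by apply/seteqP; split=> w /=; [move/set_mem|move/mem_set].
- have [aZ _ _] := hZ.
  apply: measurable_funTS; apply: measurable_fun_completion => // _ B mB.
  by apply: sub_sigma_algebra; apply: (aZ i t t0); exists B.
Qed.

(** Constant in [n]: path measures are already finite on []0, x.2[], and the sequence only serves to
    fit the form of [tame]. *)
Let D (n : nat) (x : predT) : set (measurableTypeR R) := `]0%R, x.2[%classic.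

Lemma predictable_modification_measure i n B : measurable B ->
  measurable_fun [set: predT] (fun x => path_measure (modification i ^~ x.1) (B `&` D n x)).
Proof.
move=> mB.
rewrite (_ : (fun x => _) = (fun x : Omega * R => path_measure (modification i ^~ x.1)
    (B `&` [set y | (0 < id y < x.2)%R]))); last first.
  by apply/funext => x; rewrite (_ : D n x = [set y | (0 < y < x.2)%R]).
apply: (@predictable_measure_before R _ Omega Gc hGc _ (measurableTypeR R) id
  (fun w => path_measure (modification i ^~ w))) => //.
move=> q q0.
have -> : [set y : R | (0 < id y <= q)%R] = `]0%R, q]%classic.
  by apply/seteqP; split=> u /=; rewrite in_itv.
apply: (@measurable_path_measure _ (g_sigma_algebraType (Gc q)) R
  (fun w r => modification i r w)) => //.
- by move=> w; exact: modification_nd.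
- by move=> w; exact: modification_rc.
- move=> r /andP[r0 rq] _ V mV; have := adapted_modification i r0 measurableT mV.
  apply: smallest_sub; first exact: smallest_sigma_algebra.
  move=> C hC; apply: sub_sigma_algebra.
  by have [_ _ homG] := hGc; exact: (homG r q).
Qed.

(** The intensity read off from the equation, with [modification] for [Z], [K] for [phi] and time 0
    removed from the integral, so that predictability can be proved; off the exceptional set these
    changes are invisible. *)
Definition modified_intensity i (x : Omega * R) : R :=
  h i (countable_sum [set j | E (j, i)] (fun j =>
    (\int[path_measure (modification j ^~ x.1)]_(u in `]0%R, x.2[) K j i (x.2 - u))%R)).

Lemma predictable_modified_intensity : predictable modified_intensity.
Proof.
move=> i; apply: measurableT_comp; first exact: lipschitz_measurable (h_lip i).
apply: measurable_countable_sum => j Eji; apply: measurableT_comp => //.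
have mD n (x : predT) : measurable (D n x) by exact: measurable_itv.
have ndD (x : predT) : nondecreasing_seq (D ^~ x) by move=> a b _; exact/subsetPset.
pose F (x : predT * measurableTypeR R) : \bar R := (K j i (x.1.2 - x.2))%:E.
have mF : measurable_fun setT F.
  apply/measurable_EFinP; apply: measurableT_comp; first exact: mK.
  apply: measurable_funB => //.
  apply: (@measurableT_comp _ _ _ _ _ _ (fun x : predT => x.2)) => //.
  exact: (@predictable_snd _ _ _ _ hGc _ R id _ R id).
have := @measurable_fun_integral_tame _ _ predT (measurableTypeR R) R
  (fun x => path_measure (modification j ^~ x.1)) D mD ndD
  (fun n B mB => predictable_modification_measure j n mB) F mF.
apply: eq_measurable_fun => x _.
have -> : \bigcup_n D n x = `]0%R, x.2[%classic.
  by apply/seteqP; split=> [u [n _]|u xu] //; exists 0%N.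
have -> // : tame (fun x : predT => path_measure (modification j ^~ x.1)) D x.
apply/asboolP => n; have [x0|x0] := leP 0%R x.2; last first.
  rewrite /D set_itv_ge ?measure0//.
  by rewrite bnd_simp -leNgt ltW.
apply: (@le_lt_trans _ _ (path_measure (modification j ^~ x.1) (`]0%R, x.2]%classic : set R))).
  apply: le_measure; rewrite ?inE//.
  by move=> u /=; rewrite /D/= !in_itv/= => /andP[-> /ltW].
rewrite path_measure_itvoc ?ltry//; [exact: modification_nd|exact: modification_rc].
Qed.

Lemma path_measure_le0 (f : R -> R) :
  {homo prolong f : x y / (x <= y)%R} -> right_continuous (prolong f) ->
  path_measure f (`]-oo, 0%R]%classic : set R) = 0.
Proof.
move=> ndf rcf.
have -> : (`]-oo, 0%R]%classic : set R) = \bigcup_n (`](- n%:R)%R, 0%R]%classic : set R).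
  apply/seteqP; split=> [u /=|u [n _ /=]]; rewrite !in_itv/=; last by move=> /andP[].
  move=> u0; exists (Num.truncn (- u)).+1 => //=; rewrite in_itv/= u0 andbT.
  by rewrite ltrNl truncnS_gt.
have itv0 n : path_measure f (`](- n%:R)%R, 0%R]%classic : set R) = 0.
  rewrite path_measure_itvoc ?oppr_le0// /prolong maxxx max_r ?oppr_le0//.
  by rewrite subrr.
apply: measure_negligible; first by apply: bigcupT_measurable => n; exact: measurable_itv.
apply: negligible_bigcup => n; exists (`](- n%:R)%R, 0%R]%classic : set R); split => //.
Qed.

Lemma modified_intensityE i w s : ~ A w ->
  modified_intensity i (w, s) = h i (hawkes_input E phi Z i s w).
Proof.
move=> nA; rewrite /modified_intensity /hawkes_input /=.
suff e j : E (j, i) -> (\int[path_measure (modification j ^~ w)]_(u in `]0%R, s[) K j i (s - u))%R =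
    (\int[path_measure (Z j ^~ w)]_(u in `[0%R, s[) phi j i (s - u))%R.
  by rewrite (eq_countable_sum e).
move=> Eji.
have -> : modification j ^~ w = Z j ^~ w.
  by apply/funext => t; rewrite /modification memNset.
have ndZ : {homo prolong (Z j ^~ w) : x y / (x <= y)%R}.
  by have := @modification_nd j w; rewrite /modification memNset.
have rcZ : right_continuous (prolong (Z j ^~ w)).
  by have := @modification_rc j w; rewrite /modification memNset.
transitivity (\int[path_measure (Z j ^~ w)]_(u in `[0%R, s[) K j i (s - u))%R; last first.
  by apply: eq_Rintegral => u; rewrite inE/= in_itv/= => /andP[_ us]; rewrite phiK// subr_gt0.
have mKs : measurable_fun [set: measurableTypeR R] (fun u : R => (K j i (s - u))%:E).
  apply/measurable_EFinP; apply: measurableT_comp; first exact: mK.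
  exact: measurable_funB.
rewrite /Rintegral; congr fine; rewrite integral_mkcond [RHS]integral_mkcond.
apply: ae_eq_integral => //.
- by apply/measurable_restrict => //; exact: measurable_funTS.
- by apply/measurable_restrict => //; exact: measurable_funTS.
(* The two domains differ at most by time 0, which lies in a half-line that is null for the measure
   of a prolonged path. *)
exists (`]-oo, 0%R]%classic : set R); split => //; first exact: path_measure_le0.
move=> u /= nu; rewrite in_itv/= leNgt; apply/negP => u0; apply: nu => _.
by rewrite !patchE !mem_setE/= !in_itv/= u0 ltW.
Qed.

(** Once the intensity is known to be predictable, its subgraph is measurable and the right-hand
    side of the equation is the mass of that subgraph. *)
Lemma counts_modified_intensity w : ~ A w ->
  counts N modified_intensity (fun i t => Z i t w) w.
Proof.
move=> nA i t t0; have [_ atom _ eqZ] := hA nA.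
have ml := predictable_section hGc w (predictable_modified_intensity i).
rewrite (eqZ i t t0) -(count_equation ml (atom i) t).
have e s : h i (hawkes_input E phi Z i s w) = modified_intensity i (w, s).
  by rewrite modified_intensityE.
have eset : [set y : R * R | (y.2 <= h i (hawkes_input E phi Z i y.1 w))%R] =
    [set y | (y.2 <= modified_intensity i (w, y.1))%R].
  by apply/funext => y; rewrite /mkset e.
exact: (congr1 (fun B : set (R * R) =>
  \int[N i w]_(x in `[0%R, t] `*` `[0%R, +oo[) (\1_B x)%:E) eset).
Qed.

Lemma picard_modified_intensity w i s : ~ A w ->
  picard modified_intensity i (w, s) = modified_intensity i (w, s).
Proof.
move=> nA; rewrite modified_intensityE// picardE; congr (h i _).
have [gw _ _ _] := hA nA.
exact: (esym (hawkes_input_drive hGc mK phiK i s predictable_modified_intensity gw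
  (counts_modified_intensity nA))).
Qed.

Lemma ae_not_exceptional : {ae P, forall w, ~ A w}.
Proof. by exists A; split => // w /= /contrapT. Qed.

Lemma dist_picard_modified_intensity s :
  dist (picard modified_intensity) modified_intensity s = 0.
Proof.
rewrite distE esum1// => i _; rewrite /mean_gap.
have ml := predictable_modified_intensity.
have mp := predictable_picard hGc hNc mK h_lip ml.
rewrite (@ae_eq_integral _ _ _ P setT (cst 0)) ?integral0 ?mule0//.
  by have := measurable_fun_pair1 s (measurable_gap hGc (mp i) (ml i)); exact.
apply: filterS ae_not_exceptional => w nA _.
by rewrite /gap picard_modified_intensity// subrr normr0.
Qed.

(** By compensation the weighted mean of [Z] at [T] is the integral over []0, T]] of the weighted
    mean intensity: the moment condition is local finiteness. *)
Lemma locally_finite_modified_intensity : locally_finite modified_intensity.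
Proof.
have ml := predictable_modified_intensity.
have mo : predictable off := @predictable_off _ _ _ _ Gc.
move=> T T0; rewrite -(esum_window_gap hGc hNc p_gt0 T 0 ml mo).
apply: le_lt_trans (Z_mean T0); apply: le_esum => i _.
apply: lee_wpmul2l; first by rewrite lee_fin ltW.
rewrite unlock le_eqVlt; apply/orP; left; apply/eqP.
apply: ae_eq_integral => //.
- exact: (measurable_window_gap hGc hNc).
- apply/measurable_EFinP => _ B mB; have [_ mG _] := hG; apply: (mG T T0).
  by have [aZ _ _] := hZ; apply: (aZ i T T0); exists B.
apply: filterS ae_not_exceptional => w nA _.
have [gw _ _ _] := hA nA.
by rewrite (window_gap_count hGc T ml (gw i)) (counts_modified_intensity nA).
Qed.

End modification.

Lemma solution_intensity : exists lam, [/\ predictable lam, locally_finite lam,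
  forall s, dist (picard lam) lam s = 0 &
  {ae P, forall w, counts N lam (fun i t => Z i t w) w}].
Proof.
have [A [mA PA hA]] := exceptional_set; exists (modified_intensity A); split.
- exact: predictable_modified_intensity.
- exact: locally_finite_modified_intensity.
- exact: dist_picard_modified_intensity.
- apply: filterS (ae_not_exceptional mA PA) => w; exact: counts_modified_intensity.
Qed.

End solution.

(** * Comparison of two solutions *)

Section uniqueness.
Context d (Omega : measurableType d) (R : realType) (S : countType).
Variables (P : probability Omega R) (G : R -> set (set Omega)) (E : set (S * S)).
Variable N : S -> Omega -> {measure set (R * R) -> \bar R}.
Variables (K : S -> S -> R -> R) (h : S -> R -> R) (c p : S -> R) (Phi : R -> R).
Hypotheses (hG : filtration G) (hN : forall i, compensated P G (N i)).
Hypotheses (mK : forall j i, E (j, i) -> measurable_fun setT (K j i))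
  (K_le0 : forall j i r, r <= 0 -> K j i r = 0).
Hypotheses (c_ge0 : forall i, 0 <= c i) (p_gt0 : forall i, 0 < p i).
Hypotheses (Phi_ge0 : forall r, 0 <= Phi r) (mPhi : measurable_fun setT Phi)
  (Phi_le0 : forall r, r <= 0 -> Phi r = 0)
  (Phi_int : forall T, 0 <= T -> leb.-integrable `]0, T] (EFin \o Phi)).
Hypothesis h_ge0 : forall i x, 0 <= h i x.
Hypothesis h_lip : forall i x y, `|h i x - h i y| <= c i * `|x - y|.
Hypothesis KPhi : forall r j,
  (\esum_(i in [set i | E (j, i)]) (c i * p i * `|K j i r|)%:E <= (p j * Phi r)%:E)%E.

Variable phi : S -> S -> R -> R.
Hypothesis phiK : forall j i r, E (j, i) -> 0 < r -> phi j i r = K j i r.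
Local Open Scope ereal_scope.
Local Notation Gc := (completion P G).
Local Notation predictable := (predictable Gc).
Local Notation off := (@off _ Omega R S).
Local Notation picard := (picard E N K h).
Local Notation dist := (dist P p).
Local Notation locally_finite := (locally_finite P p).

(** The weighted distance of two fixed points is at most half of itself, which forces 0 because it
    is finite; finiteness comes from the triangle inequality through [off]. *)
Lemma intensity_unique lam lam' : predictable lam -> predictable lam' ->
  locally_finite lam -> locally_finite lam' ->
  (forall s, dist (picard lam) lam s = 0) -> (forall s, dist (picard lam') lam' s = 0) ->
  forall T, (0 <= T)%R -> exists b : R, wint T b (dist lam lam') = 0.
Proof.
move=> ml ml' fl fl' fp fp' T T0.
have hGc := filtration_completion P hG.
have hNc i := compensated_completion hG (hN i).
have mp l : predictable l -> predictable (picard l) by exact: (predictable_picard hGc hNc mK h_lip).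
have [b [b0 hb]] := picard_contraction hGc hNc mK K_le0 c_ge0 p_gt0 Phi_ge0 mPhi Phi_le0
  Phi_int h_ge0 h_lip KPhi T0.
exists b; have {}hb := hb _ _ ml ml' fl fl'.
have mo : predictable off := @predictable_off _ _ _ _ Gc.
have d0 l l' s : 0 <= dist l l' s by exact: dist_ge0.
have md l l' : predictable l -> predictable l' -> measurable_fun setT (dist l l').
  by move=> pl pl'; exact: (measurable_dist P hGc p_gt0 pl pl').
have fin : wint T b (dist lam lam') < +oo.
  apply: le_lt_trans (wint_dist_triangle P hGc p_gt0 T b ml mo ml') _.
  rewrite (distC P p off); apply: lte_add_pinfty.
    by apply: le_lt_trans (fl T T0); apply: wint_le_weight0 => //; exact: md.
  by apply: le_lt_trans (fl' T T0); apply: wint_le_weight0 => //; exact: md.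
have w0 : 0 <= wint T b (dist lam lam') by exact: wint_ge0.
have : wint T b (dist lam lam') <= (2^-1)%:E * wint T b (dist lam lam').
  apply: le_trans hb; apply: le_wint => //; [exact: md|by apply: md; exact: mp|].
  move=> s; apply: le_trans (dist_triangle P hGc p_gt0 s ml (mp _ ml) ml') _.
  rewrite (distC P p lam) fp add0e.
  apply: le_trans (dist_triangle P hGc p_gt0 s (mp _ ml) (mp _ ml') ml') _.
  by rewrite fp' adde0.
move: fin w0; case: (wint T b _) => // r _; rewrite -EFinM !lee_fin => r0 rr.
by congr EFin; lra.
Qed.

Lemma hawkes_process_unique Z Z' :
  hawkes_process P G N E phi h Z -> finite_weighted_mean P p Z ->
  hawkes_process P G N E phi h Z' -> finite_weighted_mean P p Z' ->
  {ae P, forall w, forall i t, (0 <= t)%R -> Z i t w = Z' i t w}.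
Proof.
move=> hZ Zm hZ' Zm'.
have [lam [ml fl fp cl]] := solution_intensity hG hN mK p_gt0 h_lip phiK hZ Zm.
have [lam' [ml' fl' fp' cl']] := solution_intensity hG hN mK p_gt0 h_lip phiK hZ' Zm'.
have hGc := filtration_completion P hG.
have hNc i := compensated_completion hG (hN i).
have agree := ae_eq_below hGc hNc p_gt0 ml ml' (intensity_unique ml ml' fl fl' fp fp').
apply: filterS3 cl cl' agree => w cw cw' aw i t t0.
apply/EFin_inj; rewrite cw// cw'//; have mlw := predictable_section hGc w (ml i).
have mlw' := predictable_section hGc w (ml' i).
exact: mass_under_eq (aw i).
Qed.

End uniqueness.

Theorem theorem6 (R : realType)
    (d : measure_display) (Omega : measurableType d) (P : probability Omega R)
    (F : R -> set (set Omega)) (hF : filtration F)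
    (S : countType) (E : set (S * S))
    (pi : S -> Omega -> {measure set (R * R) -> \bar R})
    (hpi : iid_poisson_measures P F pi)
    (phi : S -> S -> R -> R)
    (phi_meas : forall j i, E (j, i) -> measurable_fun (`[0, +oo[ : set R) (phi j i))
    (h : S -> R -> R) (h_ge0 : forall i x, 0 <= h i x)
    (c p : S -> R) (c_ge0 : forall i, 0 <= c i) (p_gt0 : forall i, 0 < p i)
    (Phi : R -> R) (Phi_ge0 : forall s, 0 <= s -> 0 <= Phi s)
    (Phi_locint : forall T, 0 <= T ->
       lebesgue_measure.-integrable `[0, T] (EFin \o Phi))
    (hyp_a : forall i x y, `|h i x - h i y| <= c i * `|x - y|)
    (hyp_b : (\esum_(i in [set: S]) (h i 0 * p i)%:E < +oo)%E)
    (hyp_c : forall s j, 0 <= s ->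
       (\esum_(i in [set i | E (j, i)]) (c i * p i * `|phi j i s|)%:E
          <= (p j * Phi s)%:E)%E) :
  (exists Z : S -> R -> Omega -> R,
     hawkes_process P F pi E phi h Z /\ finite_weighted_mean P p Z) /\
  (forall Z Z' : S -> R -> Omega -> R,
     hawkes_process P F pi E phi h Z -> finite_weighted_mean P p Z ->
     hawkes_process P F pi E phi h Z' -> finite_weighted_mean P p Z' ->
     \forall w \ae P, forall i t, 0 <= t -> Z i t w = Z' i t w).
Proof.
(* The equation evaluates kernels only at [s - u > 0], so cutting them to positive arguments loses
   nothing; it makes them measurable on the whole line and the convolutions causal. *)
pose K j i : R -> R := (phi j i) \_ `]0, +oo[.
pose Phi' : R -> R := Phi \_ `]0, +oo[.
have hN i := adapted_poisson_compensated hF (hpi.1 i).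
have KE j i r : 0 < r -> K j i r = phi j i r.
  by move=> r0; rewrite /K patchE mem_set//= in_itv/= r0.
have PE r : 0 < r -> Phi' r = Phi r.
  by move=> r0; rewrite /Phi' patchE mem_set//= in_itv/= r0.
have K_le0 j i r : r <= 0 -> K j i r = 0.
  by move=> r0; rewrite /K patchE memNset//= in_itv/= andbT ltNge r0.
have P_le0 r : r <= 0 -> Phi' r = 0.
  by move=> r0; rewrite /Phi' patchE memNset//= in_itv/= andbT ltNge r0.
have mK j i : E (j, i) -> measurable_fun setT (K j i).
  move=> Eji; apply/measurable_restrict => //.
  apply: measurable_funS (phi_meas j i Eji) => //.
  by move=> r [_ /=]; rewrite !in_itv/= !andbT => /ltW.
have mPhi : measurable_fun setT Phi'.
  apply/measurable_restrict => //; rewrite setTI.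
  (* Measurability of [Phi] is drawn from its integrability on each [[0, n]] and glued over [n]. *)
  rewrite (_ : `]0, +oo[%classic = \bigcup_n (`]0, n%:R]%classic : set R)); last first.
    apply/seteqP; split=> [r|r [n _]] /=; rewrite !in_itv/= ?andbT; last by move=> /andP[].
    by move=> r0; exists (Num.truncn r).+1 => //=; rewrite in_itv/= r0 ltW// truncnS_gt.
  apply/measurable_fun_bigcup => // n.
  have /integrableP[+ _] := Phi_locint n%:R (ler0n _ n).
  move=> /measurable_EFinP mP; apply: measurable_funS mP => //.
  by move=> r /=; rewrite !in_itv/= => /andP[/ltW -> ->].
have Phi'_ge0 r : 0 <= Phi' r.
  have [r0|r0] := leP r 0; first by rewrite P_le0.
  by rewrite PE// Phi_ge0// ltW.
have Phi_int T : 0 <= T -> leb.-integrable `]0, T] (EFin \o Phi').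
  move=> T0; apply/integrableP; split.
    by apply: measurable_funTS; exact/measurable_EFinP.
  have /integrableP[mP fP] := Phi_locint T T0.
  apply: le_lt_trans fP; rewrite -ge0_integral_leb//; last first.
    by apply: measurable_funTS; apply/measurable_EFinP; exact: measurableT_comp.
  apply: (@le_trans _ _ (\int[lebesgue_measure]_(x in `]0%R, T]) `|(EFin \o Phi) x|)%E).
    rewrite le_eqVlt; apply/orP; left; apply/eqP; apply: eq_integral => r.
    by rewrite inE/= in_itv/= => /andP[r0 _]; rewrite PE.
  apply: ge0_subset_integral => //; first exact: measurableT_comp.
  by move=> r /=; rewrite !in_itv/= => /andP[/ltW -> ->].
have KPhi r j : (\esum_(i in [set i | E (j, i)]) (c i * p i * `|K j i r|)%:E <= (p j * Phi' r)%:E)%E.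
  have [r0|r0] := leP r 0.
    by rewrite esum1 ?P_le0 ?mulr0// => i _; rewrite K_le0// normr0 mulr0.
  rewrite PE//; apply: le_trans (hyp_c r j (ltW r0)).
  by apply: le_esum => i _; rewrite KE.
have phiK j i r : E (j, i) -> 0 < r -> phi j i r = K j i r by move=> _ r0; rewrite KE.
split.
  exact: (hawkes_process_exists hF hN mK K_le0 c_ge0 p_gt0 Phi'_ge0 mPhi P_le0 Phi_int h_ge0
    hyp_a hyp_b KPhi phiK).
move=> Z Z' hZ Zm hZ' Zm'.
exact: (hawkes_process_unique hF hN mK K_le0 c_ge0 p_gt0 Phi'_ge0 mPhi P_le0 Phi_int h_ge0
    hyp_a KPhi phiK hZ Zm hZ' Zm').
Qed.
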